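(* Let $T>0$ be fixed, $h_n=T/n$. Suppose that: (i) there is $C>0$ with $|b_{k,0}(x)-b_{k,0}(y)|\le C|x-y|$ for all $x,y\in\mathbb{R}^k$; $\sup_{t}\mathbb{E}[|f_{k,t}|^\ell]<\infty$ for all $\ell\ge 0$; and $b_{k,0}\in C^4_\uparrow(\mathbb{R}^k)$; (ii) there is $C>0$ with $|B_{i,0}(x)-B_{i,0}(y)|\le C|x-y|$ for all $x,y\in\mathbb{R}$ and $i=1,\dots,p$; $\sup_{t}\mathbb{E}[|e_t|^\ell]<\infty$ for all $\ell\ge0$; and $B_{i,0}\in C^4_\uparrow(\mathbb{R})$ for $i=1,\dots,p$; (iii) $\sigma_{i,0}>0$ for $i=1,\dots,p$. Then, as $h_n\to0$ (equivalently $n\to\infty$), $$Q_{XX}\to\Sigma_k(\theta_{k,0})\quad\text{in probability}$$ and $$\sqrt n\,\big(\mathrm{vech}(Q_{XX})-\mathrm{vech}(\Sigma_k(\theta_{k,0}))\big)\to N_{\bar p}(0,W_k(\theta_{k,0}))\quad\text{in distribution.}$$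
   Context: Fix integers $1\le k<p$ and $r\ge1$. The observed $p$-dimensional process is $X_t=\Lambda_{k,0}f_{k,t}+e_t$, $t\in[0,T]$, where $\Lambda_{k,0}\in\mathbb{R}^{p\times k}$ has top $k\times k$ block $I_k$ and bottom block $A_{k,0}\in\mathbb{R}^{(p-k)\times k}$. The latent factor $f_{k,t}\in\mathbb{R}^k$ solves $df_{k,t}=b_{k,0}(f_{k,t})dt+S_{k,0}dW_t$, $f_{k,0}=c_1\in\mathbb{R}^k$, with $W$ an $r$-dimensional standard Wiener process, $b_{k,0}:\mathbb{R}^k\to\mathbb{R}^k$, $S_{k,0}\in\mathbb{R}^{k\times r}$. The latent unique factor $e_t\in\mathbb{R}^p$ solves $de^{(i)}_t=B_{i,0}(e^{(i)}_t)dt+\sigma_{i,0}dB^{(i)}_t$ ($i=1,\dots,p$), $e_0=c_2\in\mathbb{R}^p$, with $B^{(1)},\dots,B^{(p)}$ independent one-dimensional standard Wiener processes, independent of $W$, and $B_{i,0}:\mathbb{R}\to\mathbb{R}$. The initial values are deterministic. Suprema over $t$ are over $[0,T]$. No ergodicity is assumed. Put $\Sigma_{ff,k,0}=S_{k,0}S_{k,0}^\top$, $\Sigma_{ee,0}=\mathrm{diag}(\sigma_{1,0}^2,\dots,\sigma_{p,0}^2)$, $\theta_{k,0}=(\mathrm{vec}(A_{k,0})^\top,\mathrm{vech}(\Sigma_{ff,k,0})^\top,\sigma_{1,0}^2,\dots,\sigma_{p,0}^2)^\top$ (the true parameter), and $\Sigma_k(\theta_{k,0})=\Lambda_{k,0}\Sigma_{ff,k,0}\Lambda_{k,0}^\top+\Sigma_{ee,0}$.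 Observations are $X_{t_i^n}$, $t_i^n=ih_n$, $0\le i\le n$, $T=nh_n$, and $Q_{XX}=\frac1T\sum_{i=1}^n(X_{t_i^n}-X_{t_{i-1}^n})(X_{t_i^n}-X_{t_{i-1}^n})^\top$. $\bar p=p(p+1)/2$; vec and vech are vectorization and half-vectorization; $D_p$ is the $p^2\times\bar p$ duplication matrix ($\mathrm{vec}A=D_p\mathrm{vech}A$ for symmetric $A$), $D_p^+=(D_p^\top D_p)^{-1}D_p^\top$, and $W_k(\theta_{k,0})=2D_p^+(\Sigma_k(\theta_{k,0})\otimes\Sigma_k(\theta_{k,0}))D_p^{+\top}$. $C^4_\uparrow(\mathbb{R}^d)$ is the set of functions that are four times continuously differentiable and that, together with all derivatives up to order 4, have polynomial growth, i.e. are bounded in absolute value by $C(1+|x|)^C$ for some $C>0$ (componentwise for vector-valued functions). *)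

(* Defs.v *)
From HB Require Import structures.
From mathcomp Require Import all_boot all_order all_algebra.
From mathcomp Require Import all_classical all_reals all_analysis.
From mathcomp.real_closed Require Import mxtens.
Set Implicit Arguments.
Unset Strict Implicit.
Unset Printing Implicit Defensive.
Import Order.TTheory GRing.Theory Num.Theory.
Import numFieldNormedType.Exports.

Local Open Scope classical_set_scope.
Local Open Scope ring_scope.

(* On columns this is the Euclidean norm, whereas the library norm of a matrix
   is the max norm. *)
Definition frob (R : realType) (m n : nat) (A : 'M[R]_(m, n)) : R :=
  Num.sqrt (\sum_i \sum_j A i j ^+ 2).

Section Vectorization.
Variable R : realType.

Definition pbar (p : nat) : nat := (p * p.+1)./2.

(* Pairs are (column, row).  The enumeration of a product type is
   lexicographic, hence it runs down the columns one after the other. *)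
Definition lower_tri (p : nat) : pred ('I_p * 'I_p) :=
  [pred ji : 'I_p * 'I_p | (ji.1 <= ji.2)%N].

Lemma card_lower_tri (p : nat) : #|@lower_tri p| = pbar p.
Proof.
rewrite -sum1_card.
rewrite (eq_bigl (fun ji : 'I_p * 'I_p => true && (ji.1 <= ji.2)%N))//.
rewrite -(pair_big_dep xpredT (fun j i : 'I_p => (j <= i)%N) (fun _ _ => 1%N)).
rewrite /= (exchange_big_dep xpredT) //=.
rewrite (eq_bigr (fun i : 'I_p => i.+1)); last first.
  move=> i _; rewrite (eq_bigl (fun j : 'I_p => (j < i.+1)%N))//.
  by rewrite (big_ord_narrow (ltn_ord i)) sum1_card card_ord.
have -> : (\sum_(i < p) i.+1 = \sum_(0 <= i < p.+1) i)%N.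
  by rewrite big_mkord big_ord_recl add0n; apply: eq_bigr.
by rewrite bin2_sum bin2 /= mulnC.
Qed.

Definition vech_pos (p : nat) (s : 'I_(pbar p)) : 'I_p * 'I_p :=
  enum_val (cast_ord (esym (card_lower_tri p)) s).

Definition vech (p : nat) (A : 'M[R]_p) : 'cV[R]_(pbar p) :=
  \col_s A (vech_pos s).2 (vech_pos s).1.

(* Entry (i, j) sits at position j * m + i: columns are stacked, and the
   indexing is the one of the Kronecker product tensmx. *)
Definition vec (m n : nat) (A : 'M[R]_(m, n)) : 'cV[R]_(n * m) :=
  \col_u A (mxtens_unindex u).2 (mxtens_unindex u).1.

Definition duplication_mx (p : nat) : 'M[R]_(p * p, pbar p) :=
  \matrix_(u, s) vec (\matrix_(i, j)
    (((j, i) == vech_pos s) || ((i, j) == vech_pos s))%:R) u 0.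

Lemma vec_duplication (p : nat) (A : 'M[R]_p) :
  A^T = A -> vec A = duplication_mx p *m vech A.
Proof.
move=> sA; apply/colP => u; rewrite !mxE.
under eq_bigr => s _ do rewrite !mxE.
case: (mxtens_unindex u) => j i /=.
have sAE a b : A a b = A b a by rewrite -{1}sA mxE.
wlog ji : i j / (j <= i)%N => [wl|].
  have [/wl//|/ltnW /wl E] := leqP j i.
  by rewrite sAE E; apply: eq_bigr => s _; rewrite orbC.
have inj : (j, i) \in @lower_tri p by [].
pose s0 : 'I_(pbar p) :=
  cast_ord (card_lower_tri p) (enum_rank_in inj (j, i)).
have s0E : vech_pos s0 = (j, i).
  by rewrite /vech_pos cast_ordK enum_rankK_in.
have pos_inj : injective (@vech_pos p).
  by move=> s t /enum_val_inj /cast_ord_inj.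
rewrite (bigD1 s0)//= s0E /= eqxx mul1r big1 ?addr0// => s ss0.
have [E|_] /= := eqVneq (j, i) (vech_pos s).
  by move: ss0; rewrite (_ : s = s0) ?eqxx//; apply: pos_inj; rewrite s0E.
have [E|_] := eqVneq (i, j) (vech_pos s); last by rewrite mul0r.
have : vech_pos s \in @lower_tri p by exact: enum_valP.
rewrite -E inE /= => ij.
have eij : i = j by apply/val_inj/eqP; rewrite /= eqn_leq ij ji.
move: ss0; rewrite (_ : s = s0) ?eqxx//; apply: pos_inj.
by rewrite s0E -E eij.
Qed.

Definition duplication_pinv (p : nat) : 'M[R]_(pbar p, p * p) :=
  invmx ((duplication_mx p)^T *m duplication_mx p) *m (duplication_mx p)^T.

End Vectorization.

Section FactorModel.
Variables (R : realType) (k p : nat).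

Definition loading (kp : (k <= p)%N) (A : 'M[R]_(p - k, k)) : 'M[R]_(p, k) :=
  castmx (subnKC kp, erefl k) (col_mx 1%:M A).

Definition factor_cov (kp : (k <= p)%N) (A : 'M[R]_(p - k, k))
    (Sff : 'M[R]_k) (sig2 : 'I_p -> R) : 'M[R]_p :=
  loading kp A *m Sff *m (loading kp A)^T + diag_mx (\row_i sig2 i).

Definition asymptotic_cov (Sigma : 'M[R]_p) : 'M[R]_(pbar p) :=
  2 *: (duplication_pinv R p *m (Sigma *t Sigma) *m (duplication_pinv R p)^T).

Definition realized_cov (Om : Type) (T : R) (X : R -> Om -> 'cV[R]_p) (n : nat)
    (w : Om) : 'M[R]_p :=
  let h := T / n%:R in
  T^-1 *: \sum_(i < n) (X (i.+1%:R * h) w - X (i%:R * h) w) *m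
                       (X (i.+1%:R * h) w - X (i%:R * h) w)^T.

End FactorModel.

Section Coefficients.
Variables (R : realType) (V : normedModType R).

(* The norm N is a parameter since the library norm of R^q is not the Euclidean
   one. *)
Definition poly_growth (N : V -> R) (g : V -> R) : Prop :=
  exists2 C : R, 0 < C & forall x, `|g x| <= C * (1 + N x) `^ C.

(* Iterated derivatives are taken along arbitrary constant directions, which
   amounts to taking iterated partial derivatives. *)
Fixpoint C_up (N : V -> R) (m : nat) (g : V -> R) : Prop :=
  [/\ continuous g, poly_growth N g &
    if m is m'.+1 then
      forall v, (forall x, derivable g x v) /\ C_up N m' (fun x => 'D_v g x)
    else True].

End Coefficients.

Section Processes.
Variables (R : realType) (d : measure_display) (Om : measurableType d).
Variable P : probability Om R.

Definition generated (J : Type) (D : set J) (Y : J -> Om -> R) : set (set Om) :=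
  <<s \bigcup_(j in D) preimage_set_system setT (Y j) measurable >>.

(* The F i are meant to be sigma-algebras; as they contain the whole space, the
   product rule for subfamilies is included. *)
Definition mutually_indep (I : finType) (F : I -> set (set Om)) : Prop :=
  forall E : I -> set Om, (forall i, F i (E i)) ->
    P (\bigcap_i E i) = (\prod_i P (E i))%E.

(* normal_prob m 0 is not the Dirac mass at m. *)
Definition gauss1 (m v : R) (A : set R) : \bar R :=
  if v == 0 then dirac m A else normal_prob m (Num.sqrt v) A.

Definition wiener1 (T : R) (Y : R -> Om -> R) : Prop :=
  [/\ forall t, 0 <= t <= T -> measurable_fun setT (Y t),
      {ae P, forall w, Y 0 w = 0},
      {ae P, forall w, {within `[0, T], continuous (fun t => Y t w)}},
      forall (m : nat) (t : nat -> R), 0 <= t 0%N -> t m <= T ->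
        (forall i, (i < m)%N -> t i <= t i.+1) ->
        mutually_indep (fun i : 'I_m =>
          generated setT (fun _ : unit => Y (t i.+1) \- Y (t i))) &
      forall s t, 0 <= s -> s < t -> t <= T ->
        forall A : set R, measurable A ->
          P ((Y t \- Y s) @^-1` A) = gauss1 0 (t - s) A].

Definition sigma_scalar (T : R) (Y : R -> Om -> R) : set (set Om) :=
  generated `[0, T] Y.

Definition sigma_vector (q : nat) (T : R) (Y : R -> Om -> 'cV[R]_q) :
    set (set Om) :=
  generated [set ti : R * 'I_q | 0 <= ti.1 <= T]
    (fun ti w => Y ti.1 w ti.2 0).

Definition wiener (q : nat) (T : R) (Y : R -> Om -> 'cV[R]_q) : Prop :=
  (forall i, wiener1 T (fun t w => Y t w i 0)) /\
  mutually_indep (fun i => sigma_scalar T (fun t w => Y t w i 0)).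

(* W, B_1, ..., B_p are jointly independent processes on [0, T]. *)
Definition noises_indep (q p : nat) (T : R) (W : R -> Om -> 'cV[R]_q)
    (B : 'I_p -> R -> Om -> R) : Prop :=
  mutually_indep (fun o : option 'I_p =>
    if o is Some i then sigma_scalar T (B i) else sigma_vector T W).

(* The process x solves dx = beta dt + dN on [0, T] with x_0 = c.  When the
   diffusion coefficient s is constant, the stochastic integral of s against a
   Wiener process Y is s Y, so no stochastic integral is needed. *)
Definition ito_eq (T c : R) (beta N x : R -> Om -> R) : Prop :=
  (forall t, 0 <= t <= T -> measurable_fun setT (x t)) /\
  {ae P, forall w,
    {within `[0, T], continuous (fun t => x t w)} /\
    forall t, 0 <= t <= T ->
      x t w = c + \int[lebesgue_measure]_(s in `[0, t]) beta s w + N t w}.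

Definition bounded_moments (q : nat) (T : R) (x : R -> Om -> 'cV[R]_q) : Prop :=
  forall l : R, 0 <= l ->
    (ereal_sup [set 'E_P[fun w => frob (x t w) `^ l]%R | t in `[0%R, T]] < +oo)%E.

Definition cvg_in_prob (m n : nat) (Q : nat -> Om -> 'M[R]_(m, n))
    (L : 'M[R]_(m, n)) : Prop :=
  forall eps : R, 0 < eps ->
    (fun i => P [set w | eps <= frob (Q i w - L)]) @ \oo --> 0%E.

End Processes.

Section Laws.
Variables (R : realType) (q : nat).

Definition borel_cV : measurableType _ :=
  g_sigma_algebraType (@open 'cV[R]_q).

(* mu is the normal law N_q(m, S), possibly degenerate: every linear functional
   u is normal under mu, with mean u^T m and variance u^T S u. *)
Definition is_normal_law (m : 'cV[R]_q) (S : 'M[R]_q)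
    (mu : probability borel_cV R) : Prop :=
  forall (u : 'cV[R]_q) (A : set R), measurable A ->
    mu [set x : 'cV[R]_q | A ((u^T *m x) 0 0)] =
    gauss1 ((u^T *m m) 0 0) ((u^T *m S *m u) 0 0) A.

Definition cvg_in_law (d : measure_display) (Om : measurableType d)
    (P : probability Om R) (Y : nat -> Om -> 'cV[R]_q)
    (mu : probability borel_cV R) : Prop :=
  forall g : 'cV[R]_q -> R, continuous g ->
    (exists M : R, forall x, `|g x| <= M) ->
    (fun n => 'E_P[g \o Y n]%E) @ \oo --> (\int[mu]_x (g x)%:E)%E.

End Laws.

(* Main.v *)
(* On [0, T] one has X = D + G N, where N collects the components of W and the
   B_i into one family of independent Wiener processes, G = [Lambda S, diag sigma]
   satisfies G G^T = Sigma, and the drift part D is almost surely a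
   continuously differentiable path.  Hence every increment of X is that of G N up
   to a smooth remainder: its square is negligible at rate sqrt n, and its products
   with increments of N are handled path by path by Abel summation, so neither
   adaptedness nor stochastic integration is needed.
   For G N the increments are exactly independent Gaussian.  A linear functional
   u^T vech of the realized covariance is a normalized sum of independent centred
   quadratic forms in standard Gaussian variables, with matrix G^T M G where
   vec M = D^+T u, and with variance 2 |G^T M G|^2 = u^T W u by Isserlis' formula.
   The central limit theorem is proved for cosines (a recursion on the number of
   summands replaces complex characteristic functions), and is transferred to
   bounded continuous functions by tightness and by uniform approximation on cubes
   with trigonometric polynomials, obtained from a Bernstein-type random walk.
   The limit law is realized as the law of a linear image of normalized Wiener
   increments. *)
From HB Require Import structures.
Require Import Defs.
From mathcomp Require Import all_boot all_order all_algebra.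
From mathcomp Require Import all_classical all_reals all_analysis.
From mathcomp Require Import measurable_realfun random_variable normal_distribution.
From mathcomp.real_closed Require Import mxtens.
From mathcomp Require Import ring lra.
Set Implicit Arguments.
Unset Strict Implicit.
Unset Printing Implicit Defensive.
Import Order.TTheory GRing.Theory Num.Theory.
Import numFieldNormedType.Exports.

Local Open Scope classical_set_scope.
Local Open Scope ring_scope.

(** * Independence *)

(** The obstacle is the cross term between drift and noise. By Cauchy-Schwarz a sum of [n] products
    of their increments is only of order [n^(-1/2)], which the factor [sqrt n] does not let vanish.
    This asks for a bounded quadratic variation of the noise, which Markov's inequality gives only
    with large probability and for one [n] at a time; hence pathwise statements restricted to those
    [n] whose variation is at most [K]. Cosines carry a free phase [th], so that sines are included.
    The recursion behind the limit theorem also yields the cosine transform of the normal law: a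
    Wiener increment is a sum of arbitrarily many independent smaller ones, so the error bound can
    be sent to zero. In the limit theorem itself Gaussianity enters only through moments: orders 1,
    2 and 4 exactly, order 8 as a bound, because the fourth moment of a quadratic form is needed. *)

Section independence.
Context {R : realType} {d : measure_display} {Om : measurableType d}.
Variable P : probability Om R.

(** With [B] fixed, both sides are finite measures of [A], the right one being [P] scaled by [P B];
    they agree on the pi-system [G], hence on the sigma-algebra it generates. *)
Lemma pi_systems_indep_half (G : set (set Om)) (B : set Om) :
  G `<=` measurable -> setI_closed G -> G setT -> measurable B ->
  (forall A, G A -> P (A `&` B) = (P A * P B)%E) ->
  forall A, <<s G >> A -> P (A `&` B) = (P A * P B)%E.
Proof.
move=> Gm GI GT mB H A sA.
have PB0 : (0 <= fine (P B))%R by apply: fine_ge0.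
pose m2 := mscale (NngNum PB0) P.
have m2E X : m2 X = (P X * P B)%E.
  by rewrite /m2 /mscale /= fineK ?fin_num_measure// muleC.
rewrite -[RHS]m2E.
rewrite -/(mrestr P mB A).
apply: (g_sigma_algebra_measure_unique G Gm (fun=> setT)) => //.
- by apply: bigcup_const; exists 0%N.
- by move=> X GX; apply: etrans (esym (m2E X)); exact: H.
- move=> k /=; rewrite /mrestr setTI.
  by rewrite (le_lt_trans (probability_le1 _ _))// ltry.
Qed.

Lemma pi_systems_indep (G1 G2 : set (set Om)) :
  G1 `<=` measurable -> setI_closed G1 -> G1 setT ->
  G2 `<=` measurable -> setI_closed G2 -> G2 setT ->
  (forall A B, G1 A -> G2 B -> P (A `&` B) = (P A * P B)%E) ->
  forall A B, <<s G1 >> A -> <<s G2 >> B -> P (A `&` B) = (P A * P B)%E.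
Proof.
move=> G1m G1I G1T G2m G2I G2T H A B sA sB.
have sm2 := smallest_sub (@sigma_algebra_measurable _ Om) G2m.
have sm1 := smallest_sub (@sigma_algebra_measurable _ Om) G1m.
apply: (pi_systems_indep_half G1m G1I G1T) => //; first exact: sm2.
move=> {sA}A GA; rewrite setIC muleC.
apply: (pi_systems_indep_half G2m G2I G2T) => //; first exact: G1m.
by move=> C GC; rewrite setIC muleC; exact: H.
Qed.

Definition rv_indep (U V : Om -> R) := forall A B, measurable A -> measurable B ->
  P (U @^-1` A `&` V @^-1` B) = (P (U @^-1` A) * P (V @^-1` B))%E.

Definition family_indep (I : finType) (x : I -> Om -> R) :=
  forall A : I -> set R, (forall i, measurable (A i)) ->
    P (\bigcap_i (x i @^-1` A i)) = (\prod_i P (x i @^-1` A i))%E.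

Definition family_sets (I : Type) (J : set I) (x : I -> Om -> R) : set (set Om) :=
  \bigcup_(j in J) preimage_set_system setT (x j) measurable.

(** Means that [U] is a function of the coordinates in [J] only. Stated as measurability for the
    sigma-algebra of these coordinates, it inherits stability under sums and products from the
    general lemmas on measurable functions. *)
Definition family_mfun (I : Type) (J : set I) (x : I -> Om -> R) (U : Om -> R) :=
  measurable_fun (setT : set (g_sigma_algebraType (family_sets J x))) U.

Lemma family_mfun_coord (I : Type) (J : set I) (x : I -> Om -> R) (i : I) :
  J i -> family_mfun J x (x i).
Proof.
move=> Ji _ A mA; rewrite setTI; apply: sub_sigma_algebra.
by exists i => //; exists A => //; rewrite setTI.
Qed.

(** Cylinders over [J] and over [K] are pi-systems. A [J]-cylinder met with a [K]-cylinder is a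
    cylinder of the whole family, and since every index lies outside [J] or outside [K], one of its
    two factors there is the whole line: the product formula splits. *)
Lemma block_indep (I : finType) (x : I -> Om -> R) (J K : set I) :
  (forall i, measurable_fun setT (x i)) ->
  family_indep x -> J `&` K = set0 ->
  forall U V, family_mfun J x U -> family_mfun K x V -> rv_indep U V.
Proof.
move=> mx ix JK U V mU mV A B mA mB.
pose cyl (J : set I) : set (set Om) := [set E | exists A : I -> set R,
  [/\ forall i, measurable (A i), forall i, ~ J i -> A i = setT &
      E = \bigcap_i (x i @^-1` A i)]].
have cyl_meas L : cyl L `<=` measurable.
  move=> _ [C [mC _ ->]]; apply: fin_bigcap_measurable => //.
  by move=> i _; rewrite -[_ @^-1` _]setTI; exact: mx.
have cylI L : setI_closed (cyl L).
  move=> _ _ [C [mC CT ->]] [D [mD DT ->]].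
  exists (fun i => C i `&` D i); split.
  - by move=> i; exact: measurableI.
  - by move=> i Li; rewrite CT// DT// setTI.
  - by rewrite -bigcapI.
have cylT L : cyl L setT.
  exists (fun=> setT); split => //.
  by apply/seteqP; split.
have gen L W C : family_mfun L x W -> measurable C -> <<s cyl L >> (W @^-1` C).
  move=> mW mC; have := mW measurableT C mC; rewrite setTI.
  apply: (smallest_sub (smallest_sigma_algebra setT (cyl L))).
  move=> E [i Li [D mD <-]].
  rewrite setTI.
  apply: sub_sigma_algebra.
  exists (fun j => if j == i then D else setT); split.
  - by move=> j; case: ifP.
  - by move=> j Lj; case: ifP => // /eqP ji; move: Lj; rewrite ji.
  - apply/seteqP; split=> w /=.
      by move=> Dw j _ /=; case: eqP => [->|].
    by move=> /(_ i Logic.I) /=; rewrite eqxx.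
apply: (pi_systems_indep (cyl_meas J) (cylI J) (cylT J)
   (cyl_meas K) (cylI K) (cylT K)); [|exact: gen..].
move=> _ _ [C [mC CT ->]] [D [mD DT ->]].
rewrite -bigcapI.
have -> : \bigcap_i (x i @^-1` C i `&` x i @^-1` D i) =
          \bigcap_i (x i @^-1` (C i `&` D i)) by [].
rewrite (ix (fun i => C i `&` D i)); last by move=> i; exact: measurableI.
rewrite (ix C)// (ix D)// -big_split; apply: eq_bigr => i _ /=.
have [Ji|nJi] := pselect (J i).
  have nKi : ~ K i.
    by move=> Ki; have : (J `&` K) i by []; rewrite JK.
  by rewrite (DT i nKi) preimage_setT setIT probability_setT mule1.
by rewrite (CT i nJi) preimage_setT setTI probability_setT mul1e.
Qed.

Lemma family_mfunS (I : Type) (J J' : set I) (x : I -> Om -> R) (U : Om -> R) :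
  J `<=` J' -> family_mfun J x U -> family_mfun J' x U.
Proof.
move=> JJ' mU _ B mB; rewrite setTI.
have := mU measurableT B mB; rewrite setTI.
by apply: sub_sigma_algebra2; exact: bigcup_subset.
Qed.

(** [blk] labels each variable with the number of the summand that uses it, so a partial sum and the
    next summand read disjoint blocks. This is the form of independence that [cos_sum_bound]
    consumes. *)
Lemma partial_sum_indep (I : finType) (x : I -> Om -> R) (blk : I -> nat) (n : nat)
    (z : nat -> Om -> R) :
  (forall i, measurable_fun setT (x i)) -> family_indep x ->
  (forall i, (i < n)%N -> family_mfun [set k | blk k = i] x (z i)) ->
  forall j, (j < n)%N -> rv_indep (fun w => \sum_(i < j) z i w) (z j).
Proof.
move=> mx ix mz j jn.
apply: (@block_indep _ x [set k | (blk k < j)%N] [set k | blk k = j]) => //.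
- by apply/seteqP; split => // k /= [kj kE]; rewrite kE ltnn in kj.
- apply: measurable_sum => i; apply: (family_mfunS _ (mz i _)).
    by move=> k /= ->.
  exact: ltn_trans jn.
- exact: mz.
Qed.

Lemma rv_indep_comp (U V : Om -> R) (f g : R -> R) :
  measurable_fun setT f -> measurable_fun setT g -> rv_indep U V ->
  rv_indep (f \o U) (g \o V).
Proof.
move=> mf mg UV A B mA mB.
have mfA : measurable (f @^-1` A) by rewrite -[_ @^-1` _]setTI; exact: mf.
have mgB : measurable (g @^-1` B) by rewrite -[_ @^-1` _]setTI; exact: mg.
exact: (UV _ _ mfA mgB).
Qed.

(** Independence makes the joint law agree with the product of the marginal laws on rectangles,
    hence everywhere; Tonelli then gives integrability of the product and Fubini its
    factorization. *)
Lemma rv_indep_expectation (U V : Om -> R) :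
  measurable_fun setT U -> measurable_fun setT V -> rv_indep U V ->
  P.-integrable setT (EFin \o U) -> P.-integrable setT (EFin \o V) ->
  P.-integrable setT (EFin \o (U \* V)) /\
  \int[P]_w (U w * V w) = (\int[P]_w U w) * (\int[P]_w V w).
Proof.
move=> mU mV UV iU iV.
pose U' : {RV P >-> R} := HB.pack U (isMeasurableFun.Build _ _ _ _ _ mU).
pose V' : {RV P >-> R} := HB.pack V (isMeasurableFun.Build _ _ _ _ _ mV).
have mUV : measurable_fun setT (fun w => (U w, V w)).
  exact: measurable_fun_pair.
pose UV' : {RV P >-> _} := HB.pack (fun w => (U w, V w))
  (isMeasurableFun.Build _ _ _ _ _ mUV).
pose PU := distribution P U'; pose PV := distribution P V'.
have law : forall X, measurable X -> (PU \x PV)%E X = distribution P UV' X.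
  apply: product_measure_unique => A B mA mB.
  by rewrite /distribution /pushforward /= -UV.
have mpr : measurable_fun [set: R * R] (fun z : R * R => (z.1 * z.2)%:E).
  by apply/measurable_EFinP; apply: measurable_funM.
have iPU : PU.-integrable setT (EFin \o id).
  by apply: integrable_pushforward => //; exact/measurable_EFinP.
have iPV : PV.-integrable setT (EFin \o id).
  by apply: integrable_pushforward => //; exact/measurable_EFinP.
have ipr : (PU \x PV)%E.-integrable setT (fun z : R * R => (z.1 * z.2)%:E).
  apply/integrable12ltyP => //=.
  have cfin : (\int[PV]_y `|y%:E| < +oo)%E by move/integrableP : iPV => [].
  under eq_integral => x _.
    under eq_integral => y _ do rewrite normrM EFinM.
    rewrite ge0_integralZl//; last first.
      by apply/measurable_EFinP; exact: normr_measurable.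
    over.
  rewrite ge0_integralZr//; last 2 first.
  - by apply/measurable_EFinP; exact: normr_measurable.
  - by apply: integral_ge0.
  have := iPU => /integrableP[_ /= dfin].
  by rewrite lte_mul_pinfty// ?integral_ge0// ge0_fin_numE// integral_ge0.
have lawE (g : R * R -> \bar R) :
    (\int[distribution P UV']_z g z = \int[(PU \x PV)%E]_z g z)%E.
  by apply/esym/eq_measure_integral => A mA _; exact: law.
have iUV : P.-integrable setT (EFin \o (U \* V)).
  apply/integrableP; split; first exact/measurable_EFinP/measurable_funM.
  have /integrableP[_] := ipr; rewrite -lawE.
  by rewrite ge0_integral_pushforward//; exact: measurableT_comp.
split => //; rewrite /Rintegral.
transitivity (fine (\int[distribution P UV']_z (z.1 * z.2)%:E)).
  by rewrite integral_pushforward.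
rewrite lawE -integral12_prod_meas1//= /fubini_F /=.
under eq_integral => x _.
  under eq_integral => y _ do rewrite EFinM.
  rewrite integralZl//; over.
rewrite -(fineK (integrable_fin_num _ iPV))//= integralZr//=.
rewrite fineM//; last exact: integrable_fin_num iPU.
by rewrite /=; congr (fine _ * fine _); rewrite integral_distribution//; exact/measurable_EFinP.
Qed.
End independence.

(** * Trigonometric and probabilistic preliminaries *)

Section real_inequalities.
Context {R : realType}.
Implicit Types x y : R.

(** Engine of the bounds that follow, which climb alternately: [sin x <= x], then a lower bound of
    [cos] by the half-angle formula, then a lower bound of [sin] by this lemma, then an upper bound
    of [cos] by the half-angle formula again. *)
Lemma ge0_of_derive (f df : R -> R) : f 0 = 0 ->
  (forall x, is_derive x 1 f (df x)) -> (forall x, 0 <= x -> 0 <= df x) ->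
  forall x, 0 <= x -> 0 <= f x.
Proof.
move=> f0 fd df0 x; rewrite le_eqVlt => /predU1P[<-|x0]; first by rewrite f0.
have [c] : exists2 c, c \in `]0, x[%R & f x - f 0 = df c * (x - 0).
  apply: MVT => //.
  by apply: continuous_subspaceT => y; apply: differentiable_continuous;
    apply/derivable1_diffP; have [] := fd y.
rewrite in_itv/= f0 !subr0 => /andP[c0 _] ->.
by rewrite mulr_ge0 ?df0 ?ltW.
Qed.

Lemma sin_le_id x : 0 <= x -> sin x <= x.
Proof.
move=> x0; rewrite -subr_ge0; move: x x0.
apply: (@ge0_of_derive (fun x => x - sin x) (fun x => 1 - cos x)).
- by rewrite sin0 subr0.
- by move=> x _; rewrite subr_ge0 cos_le1.
Qed.

Lemma sqr_sin_le x : sin x ^+ 2 <= x ^+ 2.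
Proof.
wlog x0 : x / 0 <= x => [H|].
  by have [/H//|/ltW x0] := leP 0 x; rewrite -sqrrN -sinN -(sqrrN x) H ?oppr_ge0.
have h := sin_le_id x0.
have [s0|s0] := leP 0 (sin x); first by rewrite ler_sqr ?nnegrE.
have [x1|x1] := leP 1 x.
  by rewrite (@le_trans _ _ 1)// ?sin2cos2 ?expr_ge1//; nra.
have x2 : 0 < x < 2.
  rewrite (lt_trans x1 _) ?ltr1n// andbT lt_neqAle x0 andbT.
  by apply/eqP => x00; rewrite -x00 sin0 ltxx in s0.
by have := sin2_gt0 x2; rewrite ltNge (ltW s0).
Qed.

Lemma cos_half x : cos x = 1 - sin (x / 2) ^+ 2 *+ 2.
Proof.
rewrite {1}(_ : x = (x / 2) *+ 2); last by rewrite -mulr_natr; field.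
by rewrite cos_mulr2n cos2sin2 mulrnBl addrAC; congr (_ - _); rewrite mulr2n; lra.
Qed.

Lemma cos_ge x : 1 - x ^+ 2 / 2 <= cos x.
Proof.
rewrite cos_half lerD2l lerN2 -mulr_natr.
have := sqr_sin_le (x / 2); nra.
Qed.

Lemma sin_ge x : 0 <= x -> x - x ^+ 3 <= sin x.
Proof.
move=> x0; rewrite -subr_ge0; move: x x0.
apply: (@ge0_of_derive (fun x => sin x - (x - x ^+ 3))
   (fun x => cos x - (1 - x ^+ 2 *+ 3))).
- by rewrite sin0 expr0n !subr0.
- move=> x; apply: is_deriveB; apply: is_deriveB.
  have -> : (@GRing.exp R)^~ 3%N = id ^+ 3.
    by apply/funext => y; rewrite /GRing.exp /= /GRing.mul.
  by apply: is_derive_eq; rewrite /GRing.scale /= mulr1 mulr_natl.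
- move=> x _; have := cos_ge x; rewrite -mulr_natr; nra.
Qed.

Lemma sin_sub_id x : `|sin x - x| <= `|x| ^+ 3.
Proof.
wlog x0 : x / 0 <= x => [H|].
  have [/H//|/ltW x0] := leP 0 x.
  by have := H (- x); rewrite sinN -opprD !normrN; apply; rewrite oppr_ge0.
rewrite (ger0_norm x0) ler_norml.
by have := sin_le_id x0; have := sin_ge x0; have := exprn_ge0 3 x0; lra.
Qed.

Lemma cos_le x : cos x <= 1 - x ^+ 2 / 2 + x ^+ 4.
Proof.
wlog x0 : x / 0 <= x => [H|].
  have [/H//|/ltW x0] := leP 0 x.
  by have := H (- x); rewrite cosN sqrrN exprNn/= -[(-1) ^+ 4]signr_odd/= expr0 mul1r; apply; rewrite oppr_ge0.
rewrite cos_half.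
pose y := x / 2; rewrite -/y (_ : x = 2 * y); last by rewrite /y; field.
have y0 : 0 <= y by rewrite divr_ge0.
suff : y ^+ 2 - 2 * y ^+ 4 <= sin y ^+ 2.
  have := exprn_ge0 4 y0; rewrite !exprMn -mulr_natr; lra.
have [y1|y1] := leP y 1; last first.
  have := sqr_ge0 (sin y); have : 1 <= y ^+ 2 by rewrite expr_ge1// ltW.
  by rewrite (_ : y ^+ 4 = y ^+ 2 * y ^+ 2) -?exprD//; nra.
have sy := sin_ge y0.
have y3 : 0 <= y - y ^+ 3.
  by rewrite exprS -{1}(mulr1 y) -mulrBr mulr_ge0// subr_ge0 expr_le1.
rewrite (@le_trans _ _ ((y - y ^+ 3) ^+ 2))//; last first.
  by rewrite ler_sqr ?nnegrE// (le_trans y3).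
rewrite sqrrB -!exprM -exprS/= -mulr_natr.
by have := exprn_ge0 6 y0; lra.
Qed.

Lemma cos_taylor x : `|cos x - (1 - x ^+ 2 / 2)| <= x ^+ 4.
Proof.
rewrite ler_norml; have := cos_le x; have := cos_ge x.
have : 0 <= x ^+ 4 by rewrite exprn_even_ge0.
lra.
Qed.

(** Both sides come from [1 + x <= expR x]: at [- y] for the lower bound, and at [y] for
    [expR (- y) <= 1 / (1 + y)], which is below [1 - y + y ^+ 2]. *)
Lemma expRN_taylor y : 0 <= y -> `|expR (- y) - (1 - y)| <= y ^+ 2.
Proof.
move=> y0; have h1 := expR_ge1Dx (- y).
have h2 : expR (- y) * (1 + y) <= 1.
  rewrite expRN mulrC ler_pdivrMr ?expR_gt0// mul1r; exact: expR_ge1Dx.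
have h3 := expR_gt0 (- y).
rewrite ler_norml; nra.
Qed.

End real_inequalities.

Lemma measurable_cosT d (T : measurableType d) (R : realType) (f : T -> R) : measurable_fun setT f ->
  measurable_fun setT (fun w => cos (f w)).
Proof.
move=> mf; apply: (measurableT_comp _ mf).
by apply: continuous_measurable_fun; exact: continuous_cos.
Qed.

Lemma measurable_sinT d (T : measurableType d) (R : realType) (f : T -> R) : measurable_fun setT f ->
  measurable_fun setT (fun w => sin (f w)).
Proof.
move=> mf; apply: (measurableT_comp _ mf).
by apply: continuous_measurable_fun; exact: continuous_sin.
Qed.

Section expectation_layer.
Context {R : realType} {d : measure_display} {Om : measurableType d}.
Variable P : probability Om R.
Implicit Types f g : Om -> R.

Lemma bounded_integrable f M : measurable_fun setT f ->
  (forall w, `|f w| <= M) -> P.-integrable setT (EFin \o f).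
Proof.
move=> mf fM; apply: measurable_bounded_integrable => //.
  by rewrite (le_lt_trans (probability_le1 _ _))// ltry.
by exists M; split; [exact: num_real|move=> x Mx w _; exact: le_trans (ltW Mx)].
Qed.

Lemma cst_integrable (c : R) : P.-integrable setT (EFin \o (fun _ : Om => c)).
Proof. exact: (@bounded_integrable _ `|c|). Qed.

Lemma dominated_integrable f g : measurable_fun setT f ->
  (forall w, `|f w| <= g w) -> P.-integrable setT (EFin \o g) ->
  P.-integrable setT (EFin \o f).
Proof.
move=> mf fg ig; apply: (le_integrable _ _ _ ig) => //; first exact/measurable_EFinP.
by move=> w _; rewrite /= lee_fin (le_trans (fg w))// ler_norm.
Qed.

Lemma integrableDR f g : P.-integrable setT (EFin \o f) ->
  P.-integrable setT (EFin \o g) ->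
  P.-integrable setT (EFin \o (fun w => f w + g w)).
Proof. by move=> /integrableD /[apply] => /(_ measurableT). Qed.

Lemma integrableZR (c : R) f : P.-integrable setT (EFin \o f) ->
  P.-integrable setT (EFin \o (fun w => c * f w)).
Proof. by move=> /(integrableZl measurableT c). Qed.

Lemma integrable_sumR (I : Type) (s : seq I) (Q : pred I) (F : I -> Om -> R) :
  (forall i, Q i -> P.-integrable setT (EFin \o F i)) ->
  P.-integrable setT (EFin \o (fun w => \sum_(i <- s | Q i) F i w)).
Proof.
move=> iF; have -> : EFin \o (fun w => \sum_(i <- s | Q i) F i w) =
    (fun w => \sum_(i <- s | Q i) (EFin \o F i) w)%E.
  by apply/funext => w /=; rewrite sumEFin.
exact: integrable_sum.
Qed.

Lemma Rintegral_sumR (I : Type) (s : seq I) (Q : pred I) (F : I -> Om -> R) :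
  (forall i, Q i -> P.-integrable setT (EFin \o F i)) ->
  \int[P]_w (\sum_(i <- s | Q i) F i w) = \sum_(i <- s | Q i) \int[P]_w F i w.
Proof.
move=> iF; elim: s => [|i s IH].
  under eq_Rintegral do rewrite big_nil.
  by rewrite big_nil Rintegral_cst// mul0r.
under eq_Rintegral do rewrite big_cons.
rewrite big_cons; case: ifPn => // Qi; rewrite RintegralD//.
- by rewrite IH.
- exact: iF.
- exact: integrable_sumR.
Qed.

Lemma Rintegral_prob_cst (c : R) : \int[P]_w c = c.
Proof. by rewrite Rintegral_cst// [X in fine X]probability_setT mulr1. Qed.

Lemma le_Rintegral_cst f c : measurable_fun setT f -> (forall w, `|f w| <= c) ->
  `|\int[P]_w f w| <= c.
Proof.
move=> mf fc; have iF := bounded_integrable mf fc.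
rewrite (le_trans (le_normr_Rintegral _ iF))// -[leRHS]Rintegral_prob_cst.
apply: le_Rintegral => //; [exact: integrable_norm|exact: cst_integrable].
Qed.

Lemma EFin_Rintegral f : P.-integrable setT (EFin \o f) ->
  (\int[P]_w (f w)%:E)%E = (\int[P]_w f w)%:E.
Proof. by move=> iF; rewrite /Rintegral fineK//; exact: (integrable_fin_num _ iF). Qed.

Lemma integrable_cos f : measurable_fun setT f ->
  P.-integrable setT (EFin \o (fun w => cos (f w))).
Proof.
by move=> mf; apply: (@bounded_integrable _ 1) => [|w];
  [exact: measurable_cosT|exact: cos_max].
Qed.

Lemma integrable_sin f : measurable_fun setT f ->
  P.-integrable setT (EFin \o (fun w => sin (f w))).
Proof.
by move=> mf; apply: (@bounded_integrable _ 1) => [|w];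
  [exact: measurable_sinT|exact: sin_max].
Qed.

(* [cos (th + S + z) = cos (th + S) cos z - sin (th + S) sin z]: independence
   factors each expectation, so no complex exponential is needed. *)
Lemma cos_sum_bound (n : nat) (z : nat -> Om -> R) (rho : nat -> R) (th : R) :
  (forall i, (i < n)%N -> measurable_fun setT (z i)) ->
  (forall j, (j < n)%N -> rv_indep P (fun w => \sum_(i < j) z i w) (z j)) ->
  (forall i, (i < n)%N -> `|rho i| <= 1) ->
  `|\int[P]_w cos (th + \sum_(i < n) z i w) - cos th * \prod_(i < n) rho i| <=
  \sum_(i < n) (`|\int[P]_w cos (z i w) - rho i| + `|\int[P]_w sin (z i w)|).
Proof.
elim: n => [|n IH] mz iz r1.
  under eq_Rintegral do rewrite big_ord0 addr0.
  by rewrite Rintegral_prob_cst !big_ord0 mulr1 subrr normr0.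
have {}IH : _ := IH (fun i h => mz i (ltnW h)) (fun i h => iz i (ltnW h))
  (fun i h => r1 i (ltnW h)).
pose S w := th + \sum_(i < n) z i w.
have mS0 : measurable_fun setT (fun w => \sum_(i < n) z i w).
  by apply: measurable_sum => i; apply: mz; exact: ltnW (ltn_ord i).
have mS : measurable_fun setT S by exact: measurable_funD.
have mzn : measurable_fun setT (z n) by exact: mz.
have mct : measurable_fun setT (fun x : R => cos (th + x)).
  exact/measurable_cosT/measurable_funD.
have mst : measurable_fun setT (fun x : R => sin (th + x)).
  exact/measurable_sinT/measurable_funD.
have mc : measurable_fun setT (@cos R).
  by apply: continuous_measurable_fun; exact: continuous_cos.
have ms : measurable_fun setT (@sin R).
  by apply: continuous_measurable_fun; exact: continuous_sin.
have [ic Ec] := rv_indep_expectation (measurable_cosT mS) (measurable_cosT mzn)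
  (rv_indep_comp mct mc (iz n (ltnSn n))) (integrable_cos mS) (integrable_cos mzn).
have [isn Es] := rv_indep_expectation (measurable_sinT mS) (measurable_sinT mzn)
  (rv_indep_comp mst ms (iz n (ltnSn n))) (integrable_sin mS) (integrable_sin mzn).
have -> : \int[P]_w cos (th + \sum_(i < n.+1) z i w) =
    (\int[P]_w cos (S w)) * (\int[P]_w cos (z n w)) -
    (\int[P]_w sin (S w)) * (\int[P]_w sin (z n w)).
  rewrite -Ec -Es -RintegralB//.
  by apply: eq_Rintegral => w _; rewrite big_ord_recr addrA cosD.
rewrite !big_ord_recr /=.
set C := \int[P]_w cos (S w) in IH *; set D := \int[P]_w sin (S w).
set c := \int[P]_w cos (z n w); set s := \int[P]_w sin (z n w).
set Pi := \prod_(i < n) _ in IH *.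
have -> : C * c - D * s - cos th * (Pi * rho n) =
  (C - cos th * Pi) * rho n + (C * (c - rho n) - D * s) by ring.
have C1 : `|C| <= 1.
  by apply: le_Rintegral_cst; [exact: measurable_cosT|move=> w; exact: cos_max].
have D1 : `|D| <= 1.
  by apply: le_Rintegral_cst; [exact: measurable_sinT|move=> w; exact: sin_max].
rewrite (le_trans (ler_normD _ _))// lerD//.
  by rewrite normrM (le_trans _ IH)// ler_piMr// r1.
rewrite (le_trans (ler_normB _ _))// !normrM lerD// ler_piMl//.
Qed.

End expectation_layer.

(** * Moments of the centred normal law *)

Section exp_remainder.
Context {R : realType}.
Implicit Types x y : R.

Definition exp_trunc (n : nat) x : R := \sum_(k < n) x ^+ k / k`!%:R.

Lemma is_derive_exp_trunc n x : is_derive x 1 (exp_trunc n.+1) (exp_trunc n x).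
Proof.
elim: n => [|n IH].
  have -> : exp_trunc 1 = cst 1.
    by apply/funext => y; rewrite /exp_trunc big_ord1 expr0 fact0 divr1.
  by rewrite /exp_trunc big_ord0; exact: is_derive_cst.
have -> : exp_trunc n.+2 = exp_trunc n.+1 + (id ^+ n.+1) * cst (n.+1)`!%:R^-1.
  by apply/funext => y; rewrite !fctE /exp_trunc big_ord_recr.
rewrite [exp_trunc n.+1 x]/exp_trunc big_ord_recr /=.
apply: is_deriveD; apply: is_derive_eq.
rewrite !fctE scaler0 add0r /GRing.scale /= mulr1 factS natrM invfM.
by rewrite mulrACA mulVf ?pnatr_eq0// mul1r mulrC.
Qed.

(** The remainder of order [n.+1] vanishes at 0 and has the remainder of order [n] as derivative, so
    each induction step is one use of the mean value theorem. *)
Lemma exp_remainder n x : `|expR x - exp_trunc n x| <= `|x| ^+ n * expR `|x|.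
Proof.
elim: n x => [|n IH] x.
  rewrite /exp_trunc big_ord0 subr0 expr0 mul1r ger0_norm ?expR_ge0//.
  by rewrite ler_expR ler_norm.
pose g y := expR y - exp_trunc n.+1 y.
have gd y : is_derive y 1 g (expR y - exp_trunc n y).
  by apply: is_deriveB; exact: is_derive_exp_trunc.
have g0 : g 0 = 0.
  rewrite /g expR0 /exp_trunc big_ord_recl big1 ?addr0 => [|i _].
    by rewrite fact0 expr0 divr1 subrr.
  by rewrite lift0 expr0n mul0r.
have gc (a b : R) : {within `[a, b], continuous g}.
  apply: continuous_subspaceT => y; apply: differentiable_continuous.
  by apply/derivable1_diffP; have [] := gd y.
rewrite -/(g x).
have [c cx ->] : exists2 c, `|c| <= `|x| & g x = (expR c - exp_trunc n c) * x.
  have [x0|x0|->] := ltgtP x 0.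
  - have [c] := MVT x0 (fun y _ => gd y) (gc _ _).
    rewrite in_itv/= => /andP[xc c0]; rewrite g0 sub0r => E; exists c.
      by rewrite !ltr0_norm// lerN2 ltW.
    by apply: oppr_inj; rewrite E; ring.
  - have [c] := MVT x0 (fun y _ => gd y) (gc _ _).
    rewrite in_itv/= => /andP[xc c0]; rewrite g0 !subr0 => E; exists c => //.
    by rewrite !gtr0_norm// ltW.
  - by exists 0; rewrite ?mulr0.
rewrite normrM exprSr -mulrA [_ * expR _]mulrC mulrA ler_wpM2r//.
apply: (le_trans (IH c)); apply: ler_pM; rewrite ?exprn_ge0 ?expR_ge0//.
  by rewrite lerXn2r// nnegrE.
by rewrite ler_expR.
Qed.

Lemma expR_norm_le x : expR `|x| <= expR x + expR (- x).
Proof.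
by case: (ger0P x) => _; [rewrite lerDl expR_ge0|rewrite lerDr expR_ge0].
Qed.

Lemma exprn_le_expR n x : `|x| ^+ n <= n`!%:R * expR `|x|.
Proof.
case: n => [|n]; first by rewrite expr0 fact0 mul1r -expR0 ler_expR.
rewrite mulrC -ler_pdivrMr ?ltr0n ?fact_gt0//.
by rewrite (le_trans _ (expR_ge1Dxn n _))// lerDr.
Qed.

(** Letting [l] tend to 0 kills the constant coefficient; dividing by [l] leaves the same situation
    with one coefficient fewer. It serves to match moments with the Taylor coefficients of a moment
    generating function, without differentiating under the integral. *)
Lemma poly_small_eq0 n (a : nat -> R) (C : R) :
  (forall l : R, 0 < l <= 1 -> `|\sum_(k < n) a k * l ^+ k| <= C * l ^+ n) ->
  forall k, (k < n)%N -> a k = 0.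
Proof.
elim: n a => // n IH a H.
have a0 : a 0%N = 0.
  pose D := `|C| + \sum_(k < n) `|a k.+1|.
  have D0 : 0 <= D by rewrite addr_ge0// sumr_ge0.
  have bd l : 0 < l <= 1 -> `|a 0%N| <= D * l.
    move=> /andP[l0 l1]; have := H l; rewrite l0 l1 => /(_ isT).
    rewrite big_ord_recl expr0 mulr1 /= => h.
    have -> : a 0%N = (a 0%N + \sum_(i < n) a (lift ord0 i) * l ^+ lift ord0 i) -
       \sum_(i < n) a (lift ord0 i) * l ^+ lift ord0 i by rewrite addrK.
    rewrite (le_trans (ler_normB _ _))// mulrDl lerD//.
      apply: (le_trans h); apply: (@le_trans _ _ (`|C| * l ^+ n.+1)).
        by rewrite ler_wpM2r ?exprn_ge0 ?ler_norm// ltW.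
      by rewrite ler_wpM2l// exprS ler_piMr ?(ltW l0)// exprn_ile1// ltW.
    rewrite (le_trans (ler_norm_sum _ _ _))// mulr_suml ler_sum// => i _.
    rewrite normrM lift0 ler_wpM2l// normrX gtr0_norm//.
    by rewrite exprS ler_piMr ?(ltW l0)// exprn_ile1// ltW.
  apply/eqP; rewrite -normr_le0; apply/ler_addgt0Pl => e e0; rewrite addr0.
  pose l := Num.min 1 (e / (D + 1)).
  have D1 : 0 < D + 1 by rewrite ltr_wpDl.
  have l0 : 0 < l by rewrite lt_min ltr01 divr_gt0.
  have l1 : 0 < l <= 1 by rewrite l0 ge_min lexx.
  rewrite (le_trans (bd l l1))// (@le_trans _ _ ((D + 1) * l))//.
    by rewrite ler_wpM2r ?(ltW l0)// lerDl.
  by rewrite mulrC -ler_pdivlMr// ge_min lexx orbT.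
case=> [//|k] kn; apply: (IH (fun k => a k.+1)) => // l /andP[l0 l1].
have := H l; rewrite l0 l1 => /(_ isT).
rewrite big_ord_recl a0 mul0r add0r.
under eq_bigr do rewrite lift0 exprSr mulrA.
rewrite -mulr_suml normrM exprSr mulrA (gtr0_norm l0).
by rewrite ler_pM2r.
Qed.

End exp_remainder.

Section normal_integrals.
Context {R : realType}.
Notation mu := (@lebesgue_measure R).
Implicit Types (s l : R).

Lemma ge0_integral_normal_prob (m s : R) (f : R -> \bar R) :
  measurable_fun setT f -> (forall x, 0 <= f x)%E ->
  (\int[normal_prob m s]_x f x = \int[mu]_x (f x * (normal_pdf m s x)%:E))%E.
Proof.
move=> mf f0.
have dom := normal_prob_dominates m s.
rewrite -(Radon_Nikodym_SigmaFinite.change_of_variables dom)//.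
have mpdf : measurable_fun setT (fun x => (normal_pdf m s x)%:E).
  by apply/measurable_EFinP; exact: measurable_normal_pdf.
have mrn : measurable_fun setT (Radon_Nikodym_SigmaFinite.f (normal_prob m s) mu).
  exact: (measurable_int _ (Radon_Nikodym_SigmaFinite.f_integrable dom)).
apply: ae_eq_integral => //; [exact: emeasurable_funM..|].
apply: ae_eqe_mul2l; apply: integral_ae_eq => //.
  exact: Radon_Nikodym_SigmaFinite.f_integrable.
by move=> E _ mE; rewrite -Radon_Nikodym_SigmaFinite.f_integral.
Qed.

(* Completing the square: [expR (l x)] times the centred density is a multiple
   of the density with mean [l s^2]. *)
Lemma normal_mgf s l : s != 0 ->
  (\int[normal_prob 0 s]_x (expR (l * x))%:E = (expR (l ^+ 2 * s ^+ 2 / 2))%:E)%E.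
Proof.
move=> s0.
have mE : measurable_fun [set: R] (fun x : R => (expR (l * x))%:E).
  by apply/measurable_EFinP; apply: measurableT_comp => //; exact: measurable_funM.
have E0 (x : R) : (0 <= (expR (l * x))%:E)%E by rewrite lee_fin expR_ge0.
rewrite (ge0_integral_normal_prob _ _ mE E0).
transitivity (\int[mu]_x ((expR (l ^+ 2 * s ^+ 2 / 2))%:E *
    (normal_pdf (l * s ^+ 2) s x)%:E))%E.
  apply: eq_integral => x _; rewrite -!EFinM !normal_pdfE//; congr EFin.
  rewrite !mulrA ![_ * normal_peak s]mulrC -!mulrA; congr (_ * _).
  rewrite /normal_fun -!expRD; congr expR; field.
  by rewrite s0.
rewrite integralZl//; last exact: integrable_normal_pdf.
by rewrite integral_normal_pdf mule1.
Qed.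

Lemma normal_scale s (G : R -> R) : 0 < s -> continuous G -> (forall x, 0 <= G x) ->
  (\int[normal_prob 0 s]_x (G x)%:E = \int[normal_prob 0 1]_x (G (s * x))%:E)%E.
Proof.
move=> s0 cG G0.
have sn0 : s != 0 by rewrite gt_eqF.
have mG : measurable_fun setT G by exact: continuous_measurable_fun.
have mGs : measurable_fun setT (fun x => G (s * x)).
  by apply: measurableT_comp => //; exact: measurable_funM.
have mG' : measurable_fun [set: R] (fun x : R => (G x)%:E) by exact/measurable_EFinP.
have mGs' : measurable_fun [set: R] (fun x : R => (G (s * x))%:E) by exact/measurable_EFinP.
have G0' x : (0 <= (G x)%:E)%E by rewrite lee_fin.
rewrite (ge0_integral_normal_prob _ _ mG' G0').
rewrite (ge0_integral_normal_prob _ _ mGs' (fun x => G0' (s * x))).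
have dF : (fun x : R => s * x)^`()%classic = cst s.
  by apply/funext => x; rewrite derive1E deriveM// derive_cst scaler0 addr0 derive_id /GRing.scale /= mulr1.
transitivity (\int[mu]_x (G x * normal_pdf 0 s x)%:E)%E.
  by apply: eq_integral => x _; rewrite EFinM.
rewrite (@increasing_ge0_integration_by_substitutionT _ (fun x : R => s * x)) ?dF.
- apply: eq_integral => x _; rewrite !fctE -EFinM; congr EFin.
  rewrite !normal_pdfE ?oner_eq0// -!mulrA; congr (_ * _).
  rewrite mulrCA mulrC; rewrite /normal_peak /normal_fun.
  congr (_ * expR _); last by field.
  rewrite -mulrnAr sqrtrM ?sqr_ge0// sqrtr_sqr gtr0_norm// invfM mulrAC mulVf//.
  by rewrite mul1r expr1n mul1r.
- by move=> x y xy; rewrite ltr_pM2l.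
- by move=> x; exact: cvg_cst.
- exact: is_cvg_cst.
- exact: is_cvg_cst.
- by move=> x; exact: derivableM.
- exact/gt0_cvgMrNy.
- exact/gt0_cvgMry.
- by move=> x; apply: cvgM; [exact: cG|exact: continuous_normal_pdf].
- by move=> x; rewrite mulr_ge0// normal_pdf_ge0.
Qed.

End normal_integrals.

Section normal_rv.
Context {R : realType} {d : measure_display} {Om : measurableType d}.
Variables (P : probability Om R) (X : Om -> R) (s : R).
Hypothesis mX : measurable_fun setT X.
Hypothesis lawX : forall A : set R, measurable A -> P (X @^-1` A) = normal_prob 0 s A.
Hypothesis s0 : 0 < s.

Lemma ge0_integral_normal_rv (f : R -> \bar R) :
  measurable_fun setT f -> (forall x, 0 <= f x)%E ->
  (\int[P]_w f (X w) = \int[normal_prob 0 s]_x f x)%E.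
Proof.
move=> mf f0.
have mX' : measurable_fun setT (X : Om -> measurableTypeR R) := mX.
pose X' : {RV P >-> measurableTypeR R} :=
  HB.pack (X : Om -> measurableTypeR R) (isMeasurableFun.Build _ _ _ _ _ mX').
have mf' : measurable_fun setT (f : measurableTypeR R -> \bar R) := mf.
transitivity (\int[distribution P X']_x f x)%E.
  by rewrite ge0_integral_distribution.
apply: (eq_measure_integral (normal_prob 0 s)) => A mA _.
exact: lawX.
Qed.

Lemma normal_rv_mgf l : P.-integrable setT (EFin \o (fun w => expR (l * X w))) /\
  \int[P]_w expR (l * X w) = expR (l ^+ 2 * s ^+ 2 / 2).
Proof.
have mE : measurable_fun [set: R] (fun x : R => (expR (l * x))%:E).
  by apply/measurable_EFinP; apply: measurableT_comp => //; exact: measurable_funM.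
have E0 (x : R) : (0 <= (expR (l * x))%:E)%E by rewrite lee_fin expR_ge0.
have E := ge0_integral_normal_rv mE E0.
rewrite normal_mgf ?gt_eqF// in E.
split; last by rewrite /Rintegral E.
apply/integrableP; split.
  apply/measurable_EFinP; apply: measurableT_comp => //; exact: measurable_funM.
under eq_integral do rewrite /= ger0_norm ?expR_ge0//.
by rewrite E ltry.
Qed.

Lemma normal_rv_integrable_exp k : P.-integrable setT
  (EFin \o (fun w => `|X w| ^+ k * expR `|X w|)).
Proof.
have i2 : P.-integrable setT
    (EFin \o (fun w => k`!%:R * (expR (2 * X w) + expR (- 2 * X w)))).
  by apply/integrableZR/integrableDR; exact: (normal_rv_mgf _).1.
apply: dominated_integrable i2.
  apply: measurable_funM; first by apply: measurable_funX; exact: measurableT_comp.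
  by apply: measurableT_comp => //; exact: measurableT_comp.
move=> w; rewrite ger0_norm ?mulr_ge0 ?expR_ge0 ?exprn_ge0//.
apply: (@le_trans _ _ (k`!%:R * expR `|X w| * expR `|X w|)).
  by rewrite ler_wpM2r ?expR_ge0// exprn_le_expR.
rewrite -mulrA ler_wpM2l// -expRD.
have -> : `|X w| + `|X w| = `|2 * X w| by rewrite normrM ger0_norm//; ring.
by rewrite mulNr; exact: expR_norm_le.
Qed.

Lemma normal_rv_integrable k : P.-integrable setT (EFin \o (fun w => X w ^+ k)).
Proof.
apply: dominated_integrable (normal_rv_integrable_exp k).
  exact: measurable_funX.
move=> w; rewrite normrX ler_peMr ?exprn_ge0//.
by rewrite -expR0 ler_expR.
Qed.

(** The expected Taylor polynomial of [expR (l * X)] and the expansion of [expR (l^2 s^2 / 2)] both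
    differ from the moment generating function by [O(l^5)], so their coefficients up to degree 4
    coincide. *)
Lemma normal_rv_moments : [/\ \int[P]_w X w = 0, \int[P]_w (X w ^+ 2) = s ^+ 2 &
  \int[P]_w (X w ^+ 4) = 3 * s ^+ 4].
Proof.
pose m k := \int[P]_w (X w ^+ k).
(* Coefficients of [1 + y + y^2 / 2] in powers of [l], where [y = l^2 s^2 / 2]. *)
pose c := [:: 1; 0; s ^+ 2 / 2; 0; s ^+ 4 / 8].
pose C := \int[P]_w (`|X w| ^+ 5 * expR `|X w|) + s ^+ 6 / 8 * expR (s ^+ 2 / 2).
have bd (l : R) : 0 < l <= 1 ->
    `|\sum_(k < 5) (m k / k`!%:R - c`_k) * l ^+ k| <= C * l ^+ 5.
  move=> /andP[l0 l1]; pose y : R := l ^+ 2 * s ^+ 2 / 2.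
  have mlX : measurable_fun setT (fun w => l * X w) by exact: measurable_funM.
  have iT : P.-integrable setT (EFin \o (fun w => exp_trunc 5 (l * X w))).
    apply: integrable_sumR => i _.
    rewrite (_ : (fun w => _) = (fun w => (l ^+ i / i`!%:R) * X w ^+ i)).
      exact/integrableZR/normal_rv_integrable.
    by apply/funext => w; rewrite exprMn mulrAC.
  have -> : \sum_(k < 5) (m k / k`!%:R - c`_k) * l ^+ k =
      \int[P]_w exp_trunc 5 (l * X w) - exp_trunc 3 y.
    have -> : \int[P]_w exp_trunc 5 (l * X w) =
        \sum_(k < 5) m k / k`!%:R * l ^+ k.
      rewrite /exp_trunc Rintegral_sumR => [|i _].
        apply: eq_bigr => i _; rewrite mulrAC -mulrA mulrC -RintegralZl//.
          by apply: eq_Rintegral => w _; rewrite exprMn; ring.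
        exact: normal_rv_integrable.
      rewrite (_ : (fun w => _) = (fun w => (l ^+ i / i`!%:R) * X w ^+ i)).
        exact/integrableZR/normal_rv_integrable.
      by apply/funext => w; rewrite exprMn mulrAC.
    rewrite /exp_trunc /y /c !big_ord_recr !big_ord0 /=.
    have [-> -> ->] : [/\ 0`! = 1%N, 1`! = 1%N & 2`! = 2%N] by [].
    by field; rewrite !pnatr_eq0 -!lt0n !fact_gt0.
  have [iM EM] := normal_rv_mgf l.
  have -> : \int[P]_w exp_trunc 5 (l * X w) - exp_trunc 3 y =
     (expR y - exp_trunc 3 y) - \int[P]_w (expR (l * X w) - exp_trunc 5 (l * X w)).
    by rewrite RintegralB// EM; ring.
  have y0 : 0 <= y by apply: divr_ge0 => //; apply: mulr_ge0; exact: sqr_ge0.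
  have l21 : l ^+ 2 <= 1 by rewrite exprn_ile1// ltW.
  rewrite (le_trans (ler_normB _ _))// addrC mulrDl lerD//.
    rewrite -RintegralZr//; last exact: normal_rv_integrable_exp.
    have iB : P.-integrable setT
        (EFin \o (fun w => expR (l * X w) - exp_trunc 5 (l * X w))).
      by have := integrableB measurableT iM iT.
    rewrite (le_trans (le_normr_Rintegral _ iB))//.
    apply: le_Rintegral => //; first exact: integrable_norm.
      have /(integrableZR (l ^+ 5)) := normal_rv_integrable_exp 5.
      by under eq_fun do rewrite mulrC.
    move=> w _; rewrite (le_trans (exp_remainder 5 _))//.
    rewrite normrM exprMn (gtr0_norm l0) -mulrA [leRHS]mulrC.
    rewrite ler_wpM2l ?exprn_ge0 ?(ltW l0)// ler_wpM2l ?exprn_ge0//.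
    by rewrite ler_expR ler_piMl// ltW.
  rewrite (le_trans (exp_remainder 3 y))// (ger0_norm y0).
  rewrite [leRHS]mulrAC ler_pM ?exprn_ge0 ?expR_ge0//.
    have -> : y ^+ 3 = s ^+ 6 / 8 * (l ^+ 5 * l) by rewrite /y; field.
    by rewrite ler_wpM2l ?ler_piMr ?exprn_ge0 ?divr_ge0 ?exprn_ge0 ?(ltW l0) ?(ltW s0).
  by rewrite ler_expR /y ler_pM2r ?invr_gt0// ler_piMl ?sqr_ge0.
have a0 := @poly_small_eq0 _ 5 (fun k => m k / k`!%:R - c`_k) C bd.
have := a0 1%N isT; have := a0 2%N isT; have := a0 4%N isT.
rewrite /c /= /m -![\int[P]_w _]/(\int[P]_w _) => e4 e2 e1.
split.
- move: e1; rewrite (_ : 1`! = 1%N)// divr1 subr0.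
  by under eq_Rintegral do rewrite expr1.
- move: e2; rewrite (_ : 2`! = 2%N)//; lra.
- move: e4; rewrite (_ : 4`! = 24%N)//; lra.
Qed.

(** A crude bound suffices, as eighth moments only serve to bound the fourth moment of quadratic
    forms: [(X / s)^8] is at most [8!] times a sum of two exponentials, each of mean
    [expR (1/2)]. *)
Lemma normal_rv_moment8 :
  \int[P]_w (X w ^+ 8) <= 8`!%:R * (2 * expR (2^-1)) * s ^+ 8.
Proof.
have [i1 E1] := normal_rv_mgf s^-1; have [i2 E2] := normal_rv_mgf (- s^-1).
have -> : 8`!%:R * (2 * expR (2^-1)) * s ^+ 8 =
    \int[P]_w ((8`!%:R * s ^+ 8) * (expR (s^-1 * X w) + expR (- s^-1 * X w))).
  rewrite RintegralZl//; last exact: integrableDR.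
  rewrite RintegralD// E1 E2 sqrrN -exprMn mulVf ?gt_eqF// expr1n mul1r.
  ring.
apply: le_Rintegral => //; first exact: normal_rv_integrable.
  exact/integrableZR/integrableDR.
move=> w _; rewrite -mulrA mulrCA.
have -> : X w ^+ 8 = s ^+ 8 * (`|s^-1 * X w| ^+ 8).
  rewrite -normrX ger0_norm ?exprn_even_ge0// exprMn mulrA -exprMn.
  by rewrite mulfV ?gt_eqF// expr1n mul1r.
rewrite ler_wpM2l ?exprn_ge0 ?(ltW s0)//.
apply: (le_trans (exprn_le_expR 8 _)); rewrite ler_wpM2l//.
by rewrite mulNr expR_norm_le.
Qed.

End normal_rv.

(** * Density of trigonometric polynomials *)

Section bernstein_walk.
Context {R : realType} {q : nat}.
Notation V := 'cV[R]_q.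
Implicit Types (u : 'I_q -> R) (l : seq 'I_q) (y z : V) (phi psi : V -> R).

(* Expectation of [phi] at the end of a random walk started at [y]: at each step
   [c] of [l] the walk moves by [h] along coordinate [c] with probability
   [u c]. *)
Fixpoint walk_exp u (h : R) l phi y : R :=
  if l is c :: l' then
    u c * walk_exp u h l' phi (y + h *: delta_mx c 0) +
    (1 - u c) * walk_exp u h l' phi y
  else phi y.

Variables (u : 'I_q -> R) (h : R).
Hypothesis u01 : forall c, 0 <= u c <= 1.

Lemma le_walk_exp l phi psi y : (forall z, phi z <= psi z) ->
  walk_exp u h l phi y <= walk_exp u h l psi y.
Proof.
move=> le; elim: l y => [|c l IH] y //=.
have /andP[u0 u1] := u01 c.
by rewrite lerD// ler_wpM2l// subr_ge0.
Qed.

Lemma walk_exp_affine l (a b : R) phi y :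
  walk_exp u h l (fun z => a + b * phi z) y = a + b * walk_exp u h l phi y.
Proof. by elim: l y => [//|c l IH] y /=; rewrite !IH; ring. Qed.

(** Bias and variance: the mean end point moves by [h * u c] for each occurrence of [c] in [l], and
    each step adds [h ^+ 2] times the variance of a Bernoulli variable. *)
Lemma walk_exp_sqr l y z :
  walk_exp u h l (fun x => \sum_c (x c 0 - z c 0) ^+ 2) y =
  \sum_c (y c 0 + h * (count_mem c l)%:R * u c - z c 0) ^+ 2 +
  h ^+ 2 * \sum_(c <- l) u c * (1 - u c).
Proof.
elim: l y => [|c l IH] y /=.
  by rewrite big_nil (mulr0 (h ^+ 2)) addr0; apply: eq_bigr => c _; rewrite mulr0 mul0r addr0.
rewrite !IH big_cons.
pose n i : R := (count_mem i l)%:R.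
pose rest := \sum_(i < q | i != c) (y i 0 + h * n i * u i - z i 0) ^+ 2.
have E0 : \sum_i (y i 0 + h * (count_mem i l)%:R * u i - z i 0) ^+ 2 =
    (y c 0 + h * n c * u c - z c 0) ^+ 2 + rest by rewrite (bigD1 c).
have E1 : \sum_i ((y + h *: delta_mx c 0) i 0 + h * (count_mem i l)%:R * u i -
      z i 0) ^+ 2 = (y c 0 + h + h * n c * u c - z c 0) ^+ 2 + rest.
  rewrite (bigD1 c)//= !mxE !eqxx mulr1; congr (_ + _).
  by apply: eq_bigr => i ic; rewrite !mxE (negbTE ic) /= mulr0 addr0.
have E2 : \sum_i (y i 0 + h * ((c == i) + count_mem i l)%:R * u i - z i 0) ^+ 2 =
    (y c 0 + h * (1 + n c) * u c - z c 0) ^+ 2 + rest.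
  rewrite (bigD1 c)//= eqxx natrD; congr (_ + _).
  by apply: eq_bigr => i ic; rewrite eq_sym (negbTE ic).
rewrite E0 E1 E2; ring.
Qed.

Lemma walk_exp_dist l (phi : V -> R) y (phi0 e C : R) z :
  (forall x, `|phi x - phi0| <= e + C * \sum_c (x c 0 - z c 0) ^+ 2) ->
  `|walk_exp u h l phi y - phi0| <=
  e + C * walk_exp u h l (fun x => \sum_c (x c 0 - z c 0) ^+ 2) y.
Proof.
move=> H.
pose N x := \sum_c ((x : V) c 0 - z c 0) ^+ 2.
have up : walk_exp u h l phi y <= walk_exp u h l (fun x => (phi0 + e) + C * N x) y.
  by apply: le_walk_exp => x; have := H x; rewrite ler_norml /N; lra.
have lo : walk_exp u h l (fun x => (phi0 - e) + (- C) * N x) y <= walk_exp u h l phi y.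
  by apply: le_walk_exp => x; have := H x; rewrite ler_norml /N; lra.
rewrite walk_exp_affine in up; rewrite walk_exp_affine in lo.
by rewrite ler_norml; move: up lo; rewrite /N; lra.
Qed.

Lemma walk_exp_bounded l (phi : V -> R) y M : (forall x, `|phi x| <= M) ->
  `|walk_exp u h l phi y| <= M.
Proof.
move=> H; have := @walk_exp_dist l phi y 0 M 0 0; rewrite subr0 mul0r addr0; apply.
by move=> x; rewrite subr0 mul0r addr0.
Qed.

End bernstein_walk.

Section trigonometric_functions.
Context {R : realType} {q : nat}.
Notation V := 'cV[R]_q.

Definition dotc (u x : V) : R := \sum_c u c 0 * x c 0.

(** Only linear operations are constructors, because expectations pass through them; products are
    recovered by [trig_mul]. The phase [th] provides the sines. *)
Inductive trig : (V -> R) -> Prop :=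
| trig_cos th u : trig (fun x => cos (th + dotc u x))
| trig_add f g : trig f -> trig g -> trig (fun x => f x + g x)
| trig_scale c f : trig f -> trig (fun x => c * f x).

Lemma trig_ext f g : f =1 g -> trig f -> trig g.
Proof. by move=> /funext ->. Qed.

Lemma dotcDl u v x : dotc (u + v) x = dotc u x + dotc v x.
Proof. by rewrite /dotc -big_split; apply: eq_bigr => c _; rewrite !mxE mulrDl. Qed.

Lemma dotcNl u x : dotc (- u) x = - dotc u x.
Proof. by rewrite /dotc -sumrN; apply: eq_bigr => c _; rewrite !mxE mulNr. Qed.

Lemma trig_mul f g : trig f -> trig g -> trig (fun x => f x * g x).
Proof.
move=> tf tg; elim: tf => {f} [th u|f1 f2 _ IH1 _ IH2|c f _ IH].
- elim: tg => {g} [th' u'|g1 g2 _ IH1 _ IH2|c g _ IH].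
  + have t1 := trig_cos (th + th') (u + u').
    have t2 := trig_cos (th - th') (u - u').
    apply: trig_ext (trig_scale 2^-1 (trig_add t1 t2)) => x.
    rewrite !dotcDl dotcNl.
    have -> : th + th' + (dotc u x + dotc u' x) =
      (th + dotc u x) + (th' + dotc u' x) by ring.
    have -> : th - th' + (dotc u x - dotc u' x) =
      (th + dotc u x) - (th' + dotc u' x) by ring.
    by rewrite cosB cosD; field.
  + by apply: trig_ext (trig_add IH1 IH2) => x; rewrite mulrDr.
  + by apply: trig_ext (trig_scale c IH) => x; rewrite mulrCA.
- by apply: trig_ext (trig_add IH1 IH2) => x; rewrite mulrDl.
- by apply: trig_ext (trig_scale c IH) => x; rewrite mulrA.
Qed.

Lemma trig_cst c : trig (fun=> c).
Proof.
apply: trig_ext (trig_scale c (trig_cos 0 0)) => x.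
by rewrite /dotc big1 ?addr0 ?cos0 ?mulr1// => i _; rewrite mxE mul0r.
Qed.

Lemma trig_sin_coord (a : R) (c : 'I_q) : trig (fun x => sin (a * x c 0)).
Proof.
apply: trig_ext (trig_cos (- (pi / 2)) (a *: delta_mx c 0)) => x.
rewrite /dotc (bigD1 c)//= big1 ?addr0 => [|i ic].
  by rewrite !mxE !eqxx mulr1 addrC cosBpihalf.
by rewrite !mxE (negbTE ic) mulr0 mul0r.
Qed.

(** The expectation is a polynomial in the probabilities, with values of [phi] as coefficients;
    trigonometric probabilities therefore give a trigonometric polynomial. *)
Lemma trig_walk_exp (U : 'I_q -> V -> R) (h : R) l phi y :
  (forall c, trig (U c)) -> trig (fun x => walk_exp (U^~ x) h l phi y).
Proof.
move=> tU; elim: l y => [|c l IH] y /=; first exact: trig_cst.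
apply: trig_add; apply: trig_mul => //.
apply: trig_add; first exact: trig_cst.
by apply: trig_ext (trig_scale (-1) (tU c)) => x; rewrite mulN1r.
Qed.

Lemma continuous_to_mx (T : topologicalType) (m n : nat) (F : T -> 'M[R]_(m, n)) :
  (forall i j, continuous (fun t => F t i j)) -> continuous F.
Proof.
move=> cF t A [B nB BA].
have : \forall t' \near t, forall i j, B i j (F t' i j).
  have H (ij : 'I_m * 'I_n) : \forall t' \near t, B ij.1 ij.2 (F t' ij.1 ij.2).
    exact: (cF ij.1 ij.2 t).
  have := @filter_forall _ _ (fun ij t' => B ij.1 ij.2 (F t' ij.1 ij.2)) (nbhs t) _ H.
  by move=> /(_ (nbhs_filter t)); apply: filterS => t' Ht' i j; exact: (Ht' (i, j)).
by apply: filterS => t' ?; exact: BA.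
Qed.

Lemma compact_cube (a b : R) : compact [set x : V | forall c, a <= x c 0 <= b].
Proof.
have := @rV_compact R q (fun=> `[a, b]%classic) (fun=> @segment_compact _ a b).
move=> /(continuous_compact (f := @trmx R 1 q)) => H.
have : continuous (@trmx R 1 q).
  apply: continuous_to_mx => i j.
  under eq_fun do rewrite mxE.
  exact: coord_continuous.
move=> /(@continuous_subspaceT _ _ _ _) /H.
congr compact; apply/seteqP; split => [_ [x Hx <-] c /=|x Hx].
  by rewrite mxE; have := Hx c; rewrite /= in_itv.
exists x^T; last exact: trmxK.
by move=> c /=; rewrite in_itv mxE; exact: Hx.
Qed.

(** Only [x] is confined to the compact set: [walk_exp_dist] asks for an estimate at every
    conceivable end point [y]. *)
Lemma compact_unif_cont (g : V -> R) (K : set V) (e : R) : continuous g -> compact K ->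
  0 < e -> exists2 dl : R, 0 < dl & forall x, K x -> forall y : V,
    (forall c, `|y c 0 - x c 0| < dl) -> `|g y - g x| < e.
Proof.
move=> cg /compact_near_coveringP cK e0.
pose Q (dl : R) (x : V) := forall y : V,
    (forall c, `|y c 0 - x c 0| < dl) -> `|g y - g x| < e.
have : \forall dl \near 0^'+, K `<=` Q dl.
  apply: (cK R (0^'+) Q) => x Kx.
  have /cvgrPdist_lt /(_ (e / 2)) := cg x.
  rewrite divr_gt0// => /(_ isT) /nbhs_ballP[r /= r0 br].
  exists (ball x (r / 2), [set dl : R | dl < r / 2]) => /=.
    split; first by apply: nbhsx_ballx; rewrite divr_gt0.
    by apply: nbhs_right_lt; rewrite divr_gt0.
  move=> [x' dl] [/= xx' dlr] y yx'.
  have h1 : `|g x - g x'| < e / 2.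
    by apply: br; apply: le_ball xx'; rewrite ler_pdivrMr// ler_peMr ?(ltW r0)// ler1n.
  have h2 : `|g x - g y| < e / 2.
    apply: br; split => // i j; rewrite (ord1 j).
    have := xx'.2 i 0; have := yx' i; rewrite /ball /= => a1 a2.
    rewrite (_ : x i 0 - y i 0 = (x i 0 - x' i 0) - (y i 0 - x' i 0)); last by ring.
    rewrite (le_lt_trans (ler_normB _ _))//; move: a1 a2 dlr; lra.
  rewrite (_ : g y - g x' = (g x - g x') - (g x - g y)); last by ring.
  by rewrite (le_lt_trans (ler_normB _ _))//; move: h1 h2; lra.
move=> H; have [dl [/= dl0 Hdl]] : exists dl : R, 0 < dl /\ K `<=` Q dl.
  near (0 : R)^'+ => dl; exists dl; split; first by near: dl; exact: nbhs_right_gt.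
  by near: dl.
by exists dl => // x Kx y; exact: Hdl.
Unshelve. all: by end_near. Qed.

End trigonometric_functions.

Section trig_approximation.
Context {R : realType} {q : nat}.
Notation V := 'cV[R]_q.

Lemma sin_range (y : R) : -1 <= y <= 1 -> - sin 1 <= sin y <= sin 1.
Proof.
move=> /andP[y1 y2].
have p1 : 1 <= pi / 2 :> R by exact: pihalf_ge1.
have pN : - (pi / 2) <= -1 :> R by rewrite lerN2.
have p0 : 0 <= pi / 2 :> R by rewrite (le_trans _ p1).
have inI (x : R) : -1 <= x <= 1 -> x \in `[(- (pi / 2)), pi / 2].
  by move=> /andP[x1 x2]; rewrite in_itv/= (le_trans pN x1) (le_trans x2 p1).
have ls (x z : R) : -1 <= x <= 1 -> -1 <= z <= 1 -> x <= z -> sin x <= sin z.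
  move=> x1 z1; rewrite le_eqVlt => /predU1P[->//|xz].
  by rewrite ltW// ltr_sin ?inI.
have N11 : -1 <= 1 :> R by lra.
by rewrite -sinN !ls ?lexx ?N11 ?y1 ?y2.
Qed.

(* A continuous left inverse of [sin] on [-1, 1], extended to the line. *)
Definition arcsin_ext (t : R) : R := asin (Num.max (- sin 1) (Num.min (sin 1) t)).

Lemma sin1_01 : 0 < sin (1 : R) < 1.
Proof.
have s0 : 0 < sin 1 :> R by apply: sin2_gt0; rewrite ltr01 ltr1n.
rewrite s0 /= -(@ltr_pXn2r _ 2)// ?nnegrE ?(ltW s0)// expr1n sin2cos2.
by rewrite ltrBlDr ltrDl exprn_gt0// cos1_gt0.
Qed.

Lemma arcsin_extK (y : R) : -1 <= y <= 1 -> arcsin_ext (sin y) = y.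
Proof.
move=> y1; have /andP[s1 s2] := sin_range y1.
rewrite /arcsin_ext (min_r s2) (max_r s1) sinK// in_itv/=.
have p1 : 1 <= pi / 2 :> R by exact: pihalf_ge1.
by move/andP: y1 => [y1 y2]; rewrite (le_trans y2 p1) andbT (le_trans _ y1)// lerN2.
Qed.

Lemma continuous_arcsin_ext : continuous arcsin_ext.
Proof.
move=> t; have /andP[s0 s1] := sin1_01.
pose cl (t : R) := Num.max (- sin 1) (Num.min (sin 1) t).
apply: (@continuous_comp _ _ _ cl asin).
  apply: continuous_max; first exact: cvg_cst.
  by apply: continuous_min; [exact: cvg_cst|exact: cvg_id].
apply: continuous_asin; rewrite /cl lt_max ltrN2 s1 /= gt_max gt_min s1 /= andbT.
by rewrite ltrNl (lt_trans _ s0)// oppr_lt0.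
Qed.

(** On the cube, [x] is recovered from the numbers [U c x = (1 + sin (x c / L)) / 2], which lie in
    [0, 1]. So [g] becomes a continuous function [G] of them, and the Bernstein average of [G] is a
    polynomial in the [U c x], hence trigonometric in [x]. Being an average, it keeps the bound [M]
    on the whole space, which later controls the mass outside the cube. *)
Lemma trig_approx (g : V -> R) (M L e : R) : continuous g ->
  (forall x, `|g x| <= M) -> 0 < L -> 0 < e ->
  exists t : V -> R, [/\ trig t, forall x, `|t x| <= M &
    forall x : V, (forall c, `|x c 0| <= L) -> `|t x - g x| <= e].
Proof.
move=> cg gM L0 e0.
have M0 : 0 <= M by rewrite (le_trans _ (gM 0)).
(* Inverse of [x |-> vu x] on the cube: undo the affine map, the sine and the scaling by [L]. The
   extended arcsine keeps it continuous everywhere. *)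
pose node (y : V) : V := \col_c (L * arcsin_ext (2 * y c 0 - 1)).
pose G y := g (node y).
have ca : continuous (fun s : R => L * arcsin_ext (2 * s - 1)).
  move=> s; apply: cvgM; first exact: cvg_cst.
  apply: (cvg_comp (fun s : R => 2 * s - 1) arcsin_ext); last first.
    exact: continuous_arcsin_ext.
  by apply: cvgB; [apply: cvgM; [exact: cvg_cst|exact: cvg_id]|exact: cvg_cst].
have cG : continuous G.
  move=> y; apply: (@continuous_comp _ _ _ node g); last exact: cg.
  move: y; apply: continuous_to_mx => i j.
  under eq_fun do rewrite mxE.
  move=> y; apply: (@continuous_comp _ _ _ (fun y : V => y i 0)
    (fun s : R => L * arcsin_ext (2 * s - 1))); first exact: coord_continuous.
  exact: ca.
pose U c (x : V) := 2^-1 + 2^-1 * sin (L^-1 * x c 0).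
have U01 x c : 0 <= U c x <= 1.
  have := sin_le1 (L^-1 * x c 0); have := sin_geN1 (L^-1 * x c 0).
  by rewrite /U; lra.
pose vu (x : V) : V := \col_c U c x.
have [dl dl0 Hdl] := compact_unif_cont cG (@compact_cube R q 0 1)
  (divr_gt0 e0 (ltr0n _ 2)).
(* If some coordinate is off by at least [dl], then [C] times the squared distance is at least
   [2 * M], the largest possible gap. *)
pose C := 2 * M / dl ^+ 2.
have C0 : 0 <= C by rewrite divr_ge0 ?mulr_ge0 ?exprn_ge0 ?(ltW dl0).
have near x y : `|G y - G (vu x)| <= e / 2 + C * \sum_c (y c 0 - vu x c 0) ^+ 2.
  have [far|close] := pselect (exists c, dl <= `|y c 0 - vu x c 0|); last first.
    rewrite (@le_trans _ _ (e / 2))//; last first.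
      by rewrite lerDl mulr_ge0// sumr_ge0// => c _; exact: sqr_ge0.
    apply/ltW/Hdl => c; first by rewrite mxE.
    by rewrite ltNge; apply/negP => h; apply: close; exists c.
  have [c hc] := far.
  apply: (@le_trans _ _ (2 * M)).
    have := gM (node y); have := gM (node (vu x)).
    by rewrite -!/(G _) !ler_norml; lra.
  apply: (@le_trans _ _ (C * (y c 0 - vu x c 0) ^+ 2)).
    rewrite /C -mulrA ler_peMr ?mulr_ge0// mulrC ler_pdivlMr ?exprn_gt0// mul1r.
    by rewrite -[leRHS]real_normK ?num_real// ler_sqr ?nnegrE// ltW.
  rewrite -[leLHS]add0r lerD ?divr_ge0 ?(ltW e0)// ler_wpM2l// (bigD1 c)//= lerDl.
  by rewrite sumr_ge0// => i _; exact: sqr_ge0.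
have [m m0 Hm] : exists2 m : nat, (0 < m)%N & C * (q%:R / m%:R) <= e / 2.
  pose K := (e / 2)^-1 * (C * q%:R); exists (Num.bound K).+1 => //.
  rewrite mulrA ler_pdivrMr ?ltr0n// -ler_pdivrMl ?divr_gt0// -/K.
  rewrite ltW// (lt_le_trans (archi_boundP _)) ?ler_nat ?leqnSn//.
  by apply: mulr_ge0; [rewrite invr_ge0 divr_ge0 ?(ltW e0)|rewrite mulr_ge0].
(* Each coordinate is visited exactly [m] times with step [1 / m]: from 0 the mean end point is
   [vu x], so the bias vanishes, and the variance is at most [q / m]. *)
pose l := flatten [seq nseq m c | c <- enum 'I_q].
have cl c : count_mem c l = m.
  rewrite count_flatten -map_comp sumnE big_map big_enum /= (bigD1 c)//=.
  rewrite count_nseq /= eqxx mul1n big1 ?addn0// => i ic.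
  by rewrite count_nseq /= (negbTE ic).
exists (fun x => walk_exp (U^~ x) m%:R^-1 l G 0); split.
- apply: trig_walk_exp => c; apply: trig_add; first exact: trig_cst.
  exact/trig_scale/trig_sin_coord.
- by move=> x; apply: walk_exp_bounded => // y; exact: gM.
move=> x xL.
have vuK : node (vu x) = x.
  apply/colP => c; rewrite !mxE /U.
  have -> : 2 * (2^-1 + 2^-1 * sin (L^-1 * x c 0)) - 1 = sin (L^-1 * x c 0) by field.
  rewrite arcsin_extK ?mulrA ?mulfV ?mul1r ?gt_eqF//.
  rewrite -ler_norml normrM gtr0_norm ?invr_gt0// mulrC ler_pdivrMr// mul1r.
  exact: xL.
have mn0 : m%:R != 0 :> R by rewrite pnatr_eq0 -lt0n.
have := walk_exp_dist m%:R^-1 (U01 x) l 0 (near x).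
rewrite (_ : G (vu x) = g x); last by rewrite /G vuK.
move=> /le_trans; apply.
rewrite walk_exp_sqr big1 ?add0r => [|c _]; last first.
  by rewrite cl !mxE mulVf// mul1r add0r subrr expr0n.
rewrite [leRHS]splitr lerD2l// (le_trans _ Hm)// ler_wpM2l//.
apply: (@le_trans _ _ (m%:R^-1 ^+ 2 * \sum_(c <- l) 1)).
  rewrite ler_wpM2l ?exprn_ge0 ?invr_ge0// ler_sum// => c _.
  have /andP[u0 u1] := U01 x c; nra.
have -> : \sum_(c <- l) 1 = m%:R * q%:R :> R.
  rewrite big_const_seq count_predT iter_addr_0 size_flatten /shape -map_comp sumnE big_map big_enum /=.
  by under eq_bigr do rewrite size_nseq; rewrite sum_nat_const card_ord mulnC natrM.
by rewrite le_eqVlt; apply/orP; left; apply/eqP; field.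
Qed.

End trig_approximation.

(** * Weak convergence from convergence of cosines *)

Section random_vectors.
Context {R : realType} {q : nat} {d : measure_display} {Om : measurableType d}.
Variable P : probability Om R.
Notation V := 'cV[R]_q.
Implicit Types (Y : Om -> V) (t g : V -> R).

Definition mvec Y := forall c, measurable_fun setT (fun w => Y w c 0).

Definition exceed (L : R) Y : set Om := [set w | exists c, L < `|Y w c 0|].

Lemma measurable_gt (f : Om -> R) (c : R) : measurable_fun setT f ->
  measurable [set w | c < f w].
Proof.
move=> mf; rewrite (_ : [set w | _] = f @^-1` `]c, +oo[).
  by rewrite -[X in measurable X]setTI; exact: mf.
by apply/seteqP; split => w /=; rewrite in_itv/= andbT.
Qed.

Lemma le_fine_prob (A B : set Om) : measurable A -> measurable B -> A `<=` B ->
  fine (P A) <= fine (P B).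
Proof. by move=> mA mB AB; rewrite fine_le ?fin_num_measure// le_measure ?inE. Qed.

Lemma measurable_exceed L Y : mvec Y -> measurable (exceed L Y).
Proof.
move=> mY.
have -> : exceed L Y = \bigcup_(c in [set: 'I_q]) [set w | L < `|Y w c 0|].
  by apply/seteqP; split => w /=; [case=> c ?; exists c|case=> c _ ?; exists c].
apply: fin_bigcup_measurable => // c _; apply: measurable_gt.
by apply: measurableT_comp => //; exact: mY.
Qed.

Lemma exceed_mono (Y : Om -> V) (L L' : R) : mvec Y -> L <= L' ->
  fine (P (exceed L' Y)) <= fine (P (exceed L Y)).
Proof.
move=> mY LL; apply: le_fine_prob; [exact: measurable_exceed..|].
by move=> w [c Lc]; exists c; rewrite (le_lt_trans LL).
Qed.

Lemma measurable_dotc Y (u : V) : mvec Y -> measurable_fun setT (fun w => dotc u (Y w)).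
Proof. by move=> mY; apply: measurable_sum => c; apply: measurable_funM. Qed.

Lemma measurable_trig Y t : mvec Y -> trig t -> measurable_fun setT (fun w => t (Y w)).
Proof.
move=> mY; elim=> {t} [th u|f h _ IHf _ IHh|c f _ IHf].
- by apply/measurable_cosT/measurable_funD => //; exact: measurable_dotc.
- exact: measurable_funD.
- exact: measurable_funM.
Qed.

Lemma trig_bounded t : trig t -> exists M : R, forall x, `|t x| <= M.
Proof.
elim=> {t} [th u|f h _ [M fM] _ [N hN]|c f _ [M fM]].
- by exists 1 => x; exact: cos_max.
- by exists (M + N) => x; rewrite (le_trans (ler_normD _ _))// lerD.
- by exists (`|c| * M) => x; rewrite normrM ler_wpM2l.
Qed.

Lemma integrable_trig Y t : mvec Y -> trig t ->
  P.-integrable setT (EFin \o (fun w => t (Y w))).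
Proof.
move=> mY tt; have [M tM] := trig_bounded tt.
by apply: (@bounded_integrable _ _ _ _ _ M) => [|w]; [exact: measurable_trig|exact: tM].
Qed.

(** [g] is a pointwise limit of trigonometric polynomials, accurate to [1 / n.+1] on the cube of
    half-side [n.+1]; composed with [Y] these are measurable because the coordinates of [Y] are. *)
Lemma measurable_cont_vec Y g (M : R) : mvec Y -> continuous g -> (forall x, `|g x| <= M) ->
  measurable_fun setT (fun w => g (Y w)).
Proof.
move=> mY cg gM.
have H (n : nat) : exists t : V -> R, trig t /\
    forall x : V, (forall c, `|x c 0| <= n.+1%:R) -> `|t x - g x| <= n.+1%:R^-1.
  have [|t [tt _ tg]] := @trig_approx R q g M n.+1%:R (n.+1%:R^-1) cg gM (ltr0Sn _ n).
    by rewrite invr_gt0.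
  by exists t.
have [t tP] := choice H.
apply: (measurable_fun_cvg (fun n => measurable_trig mY (tP n).1)) => w _.
apply/cvgrPdist_le => e e0.
near=> n.
rewrite distrC (le_trans ((tP n).2 _ _))//.
- move=> c; rewrite (@le_trans _ _ n%:R)//; last by rewrite ler_nat.
  rewrite (@le_trans _ _ (\sum_i `|Y w i 0|))//.
    by rewrite (bigD1 c)//= lerDl sumr_ge0.
  by near: n; exact: nbhs_infty_ger.
- rewrite -[leRHS]invrK lef_pV2 ?posrE ?invr_gt0//.
  rewrite (@le_trans _ _ n%:R)//; last by rewrite ler_nat.
  by near: n; exact: nbhs_infty_ger.
Unshelve. all: by end_near. Qed.

(** Inside the cube the two functions are [e]-close; outside they differ by at most [2 * M], because
    [t] obeys the same bound as [g]. *)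
Lemma expectation_trig_dist Y t g (M L e : R) : mvec Y -> trig t -> continuous g ->
  (forall x, `|g x| <= M) -> (forall x, `|t x| <= M) -> 0 <= e ->
  (forall x : V, (forall c, `|x c 0| <= L) -> `|t x - g x| <= e) ->
  `|\int[P]_w t (Y w) - \int[P]_w g (Y w)| <= e + 2 * M * fine (P (exceed L Y)).
Proof.
move=> mY tt cg gM tM e0 close.
have mg := measurable_cont_vec mY cg gM; have mt := measurable_trig mY tt.
have it := integrable_trig mY tt.
have ig : P.-integrable setT (EFin \o (fun w => g (Y w))).
  by apply: (@bounded_integrable _ _ _ _ _ M).
have mE := measurable_exceed L mY.
have iE : P.-integrable setT (EFin \o (fun w => e + 2 * M * \1_(exceed L Y) w)).
  by apply: integrableDR; [exact: cst_integrable|apply: integrableZR; exact: integrable_indic].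
have -> : e + 2 * M * fine (P (exceed L Y)) =
    \int[P]_w (e + 2 * M * \1_(exceed L Y) w).
  rewrite RintegralD//; last 2 first.
  - exact: cst_integrable.
  - by apply: integrableZR; exact: integrable_indic.
  rewrite Rintegral_prob_cst RintegralZl//; last exact: integrable_indic.
  by rewrite /Rintegral integral_indic// setIT.
have M0 : 0 <= M by rewrite (le_trans _ (gM 0)).
rewrite -RintegralB//.
have iB : P.-integrable setT (EFin \o (fun w => t (Y w) - g (Y w))).
  by have := integrableB measurableT it ig.
rewrite (le_trans (le_normr_Rintegral _ iB))//.
apply: le_Rintegral => //; first exact: integrable_norm.
move=> w _; rewrite indicE; case: (boolP (w \in _)) => [_|].
  have := gM (Y w); have := tM (Y w); rewrite mulr1 !ler_norml; lra.
rewrite notin_setE => /= nE; rewrite mulr0 addr0; apply: close => c.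
by rewrite leNgt; apply/negP => h; apply: nE; exists c.
Qed.

End random_vectors.

Section weak_convergence.
Context {R : realType} {q : nat} {d d' : measure_display}.
Context {Om : measurableType d} {Om' : measurableType d'}.
Variables (P : probability Om R) (P' : probability Om' R).
Notation V := 'cV[R]_q.
Variables (Y : nat -> Om -> V) (G : Om' -> V).
Hypotheses (mY : forall n, mvec (Y n)) (mG : mvec G).
Hypothesis cvg_cos : forall th u,
  \int[P]_w cos (th + dotc u (Y n w)) @[n --> \oo] --> \int[P']_w cos (th + dotc u (G w)).
Hypothesis tight : forall e : R, 0 < e -> exists2 L : R, 0 < L &
  (\forall n \near \oo, fine (P (exceed L (Y n))) <= e) /\ fine (P' (exceed L G)) <= e.

Lemma cvg_expectation_trig (t : V -> R) : trig t ->
  \int[P]_w t (Y n w) @[n --> \oo] --> \int[P']_w t (G w).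
Proof.
elim=> {t} [th u|f h tf IHf th IHh|c f tf IHf]; first exact: cvg_cos.
- under eq_fun do rewrite RintegralD ?integrable_trig//.
  by rewrite RintegralD ?integrable_trig//; exact: cvgD.
- under eq_fun do rewrite RintegralZl ?integrable_trig//.
  by rewrite RintegralZl ?integrable_trig//; apply: cvgM => //; exact: cvg_cst.
Qed.

Lemma cvg_expectation_cont (g : V -> R) (M : R) : continuous g ->
  (forall x, `|g x| <= M) ->
  \int[P]_w g (Y n w) @[n --> \oo] --> \int[P']_w g (G w).
Proof.
move=> cg gM; apply/cvgrPdist_le => e e0.
have M0 : 0 <= M by rewrite (le_trans _ (gM 0)).
(* Five errors of [e / 5]: an approximation and a tail for [Y n], the same for [G], and one for the
   convergence of the trigonometric expectation. The [+ 1] protects the case [M = 0]. *)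
pose e' := e / 5 / (2 * M + 1).
have M1 : 0 < 2 * M + 1 by rewrite ltr_wpDl ?mulr_ge0.
have e'0 : 0 < e' by rewrite !divr_gt0.
have [L L0 [tY tG]] := tight e'0.
have e50 : 0 < e / 5 by rewrite divr_gt0.
have [t [tt tM tg]] := trig_approx cg gM L0 e50.
have small (x : R) : x <= e' -> 2 * M * x <= e / 5.
  move=> xe; apply: (@le_trans _ _ (2 * M * e')); first by rewrite ler_wpM2l ?mulr_ge0.
  by rewrite /e' mulrCA ler_piMr ?(ltW e50)// ler_pdivrMr// mul1r lerDl.
have /cvgrPdist_le /(_ _ e50) := cvg_expectation_trig tt.
move=> ct; near=> n.
have h1 : `|\int[P']_w t (G w) - \int[P]_w t (Y n w)| <= e / 5 by near: n.
have tYn : fine (P (exceed L (Y n))) <= e' by near: n.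
have h2 := expectation_trig_dist P (mY n) tt cg gM tM (ltW e50) tg.
have h3 := expectation_trig_dist P' mG tt cg gM tM (ltW e50) tg.
have h4 := small _ tYn; have h5 := small _ tG.
move: h1 h2 h3; rewrite !ler_norml; lra.
Unshelve. all: by end_near. Qed.

End weak_convergence.

(** * Smooth paths against rough paths *)

Section pathwise.
Context {R : realType}.
Variable T : R.
Hypothesis T0 : 0 < T.
Implicit Types (D Z a : R -> R).

Let grid (n i : nat) : R := i%:R * (T / n%:R).

Lemma grid_in n i : (i <= n)%N -> 0 <= grid n i <= T.
Proof.
case: n => [|n] i_n; first by rewrite /grid invr0 mulr0 mulr0 lexx ltW.
rewrite /grid mulr_ge0 ?divr_ge0 ?(ltW T0)//= mulrA ler_pdivrMr// mulrC.
by rewrite ler_wpM2l ?ler_nat ?(ltW T0).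
Qed.

Definition incr (n : nat) (D : R -> R) (i : nat) : R := D (grid n i.+1) - D (grid n i).

(** Strict differentiability, uniform on [[0, T]], with slope [a]. Three points occur because the
    slope will be frozen at a point [s] of a coarse grid while the increment runs over a fine cell
    from [t] to [t']. *)
Definition udiff (D : R -> R) : Prop := exists (a : R -> R) (M : R),
  (forall s, 0 <= s <= T -> `|a s| <= M) /\
  forall e, 0 < e -> exists2 dl : R, 0 < dl & forall s t t',
    0 <= s <= T -> 0 <= t <= T -> 0 <= t' <= T ->
    `|t - s| <= dl -> `|t' - s| <= dl ->
    `|D t' - D t - a s * (t' - t)| <= e * `|t' - t|.

Lemma udiffZ c D : udiff D -> udiff (fun t => c * D t).
Proof.
move=> [a [M [aM H]]]; exists (fun s => c * a s), (`|c| * M); split.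
  by move=> s sT; rewrite normrM ler_wpM2l// aM.
move=> e e0; have c1 : 0 < `|c| + 1 by rewrite ltr_wpDl.
have [dl dl0 Hdl] := H (e / (`|c| + 1)) (divr_gt0 e0 c1).
exists dl => // s t t' sT tT t'T ts t's.
have -> : c * D t' - c * D t - c * a s * (t' - t) = c * (D t' - D t - a s * (t' - t)).
  by ring.
rewrite normrM; have h := Hdl s t t' sT tT t'T ts t's.
apply: (@le_trans _ _ ((`|c| + 1) * (e / (`|c| + 1) * `|t' - t|))).
  by rewrite ler_pM// lerDl.
by rewrite mulrA mulrCA mulfV ?mulr1// gt_eqF.
Qed.

Lemma udiffD D D' : udiff D -> udiff D' -> udiff (fun t => D t + D' t).
Proof.
move=> [a [M [aM H]]] [a' [M' [aM' H']]].
exists (fun s => a s + a' s), (M + M'); split.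
  by move=> s sT; rewrite (le_trans (ler_normD _ _))// lerD ?aM ?aM'.
move=> e e0; have e20 : 0 < e / 2 by rewrite divr_gt0.
have [dl dl0 Hdl] := H _ e20; have [dl' dl'0 Hdl'] := H' _ e20.
exists (Num.min dl dl'); first by rewrite lt_min dl0.
move=> s t t' sT tT t'T; rewrite !le_min => /andP[ts ts'] /andP[t's t's'].
have -> : D t' + D' t' - (D t + D' t) - (a s + a' s) * (t' - t) =
  (D t' - D t - a s * (t' - t)) + (D' t' - D' t - a' s * (t' - t)) by ring.
have h1 := Hdl s t t' sT tT t'T ts t's; have h2 := Hdl' s t t' sT tT t'T ts' t's'.
rewrite (le_trans (ler_normD _ _))// (le_trans (lerD h1 h2))// -mulrDl.
by rewrite -splitr.
Qed.

Lemma udiff_cst c : udiff (fun=> c).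
Proof.
exists (fun=> 0), 0; split => [s _|e e0]; first by rewrite normr0.
by exists 1 => // s t t' *; rewrite mul0r subrr subr0 normr0 mulr_ge0// ltW.
Qed.

Lemma udiff_sum (I : Type) (r : seq I) (F : I -> R -> R) :
  (forall i, udiff (F i)) -> udiff (fun t => \sum_(i <- r) F i t).
Proof.
move=> H; elim: r => [|i r IH].
  by under eq_fun do rewrite big_nil; exact: udiff_cst.
by under eq_fun do rewrite big_cons; exact: udiffD.
Qed.

Lemma eventually_small (c e : R) : 0 < e ->
  exists N : nat, forall n, (N <= n)%N -> (0 < n)%N /\ c / Num.sqrt n%:R <= e.
Proof.
move=> e0; pose K := (`|c| / e) ^+ 2; exists (Num.bound K).+1 => n Nn.
have n0 : (0 < n)%N by exact: leq_trans Nn.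
split => //; have sn0 : 0 < Num.sqrt n%:R :> R by rewrite sqrtr_gt0 ltr0n.
rewrite ler_pdivrMr// mulrC -ler_pdivrMr// (@le_trans _ _ (`|c| / e))//.
  by rewrite ler_pM2r ?invr_gt0// ler_norm.
rewrite -(@ler_pXn2r _ 2)// ?nnegrE ?divr_ge0 ?(ltW e0) ?sqrtr_ge0//.
rewrite sqr_sqrtr// -/K ltW// (lt_le_trans (archi_boundP _)) ?sqr_ge0//.
by rewrite ler_nat ltnW.
Qed.

Lemma eventually_fine (c e : R) : 0 < e ->
  exists N : nat, forall n, (N <= n)%N -> (0 < n)%N /\ c / n%:R <= e.
Proof.
move=> e0; have [N HN] := @eventually_small `|c| e e0.
exists N => n /HN[n0 h]; split => //; apply: le_trans h.
apply: (@le_trans _ _ (`|c| / n%:R)); first by rewrite ler_pM2r ?invr_gt0 ?ltr0n ?ler_norm.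
rewrite ler_wpM2l// lef_pV2 ?posrE ?sqrtr_gt0 ?ltr0n//.
rewrite -(@ler_pXn2r _ 2)// ?nnegrE ?sqrtr_ge0// sqr_sqrtr//.
by rewrite expr2 ler_peMr ?ler1n.
Qed.

Lemma grid_step n i : (0 < n)%N -> grid n i.+1 - grid n i = T / n%:R.
Proof. by move=> n0; rewrite /grid -mulrBl -natrB// subSnn mul1r. Qed.

Lemma udiff_incr D : udiff D -> exists2 M : R, 0 <= M & exists N : nat,
  forall n, (N <= n)%N -> forall i, (i < n)%N -> `|incr n D i| <= M * (T / n%:R).
Proof.
move=> [a [M [aM /(_ 1 ltr01)[dl dl0 Hdl]]]].
have M0 : 0 <= M by rewrite (le_trans _ (aM 0 _))// lexx ltW.
exists (M + 1); first by rewrite addr_ge0.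
have [N HN] := eventually_fine T dl0; exists N => n /HN[n0 hn] i i_n.
have hT : 0 <= T / n%:R by rewrite divr_ge0// ltW.
have gi := grid_in (ltnW i_n); have gi1 := grid_in i_n.
have := Hdl (grid n i) (grid n i) (grid n i.+1) gi gi gi1.
rewrite subrr normr0 grid_step// (ger0_norm hT) => /(_ (ltW dl0) hn).
rewrite mul1r -/(incr n D i) => h.
rewrite -[incr n D i](subrK (a (grid n i) * (T / n%:R))).
rewrite (le_trans (ler_normD _ _))// mulrDl mul1r addrC lerD//.
by rewrite normrM (ger0_norm hT) ler_wpM2r// aM.
Qed.

(** A sum of [n] products of size [1 / n^2] is of order [1 / n], which beats the factor [sqrt n]. *)
Lemma udiff_quad D D' : udiff D -> udiff D' -> forall e : R, 0 < e ->
  exists N : nat, forall n, (N <= n)%N ->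
    Num.sqrt n%:R * `|\sum_(i < n) incr n D i * incr n D' i| <= e.
Proof.
move=> /udiff_incr[M M0 [N1 H1]] /udiff_incr[M' M'0 [N2 H2]] e e0.
have [N3 H3] := @eventually_small (M * M' * T ^+ 2) e e0.
exists (maxn N1 (maxn N2 N3)) => n; rewrite !geq_max => /and3P[n1 n2 n3].
have [n0 h3] := H3 n n3; apply: le_trans h3.
have sn0 : 0 < Num.sqrt n%:R :> R by rewrite sqrtr_gt0 ltr0n.
have snE : Num.sqrt n%:R ^+ 2 = n%:R :> R by rewrite sqr_sqrtr.
set sn := Num.sqrt n%:R in sn0 snE *.
apply: (@le_trans _ _ (sn * \sum_(i < n) (M * (T / n%:R)) * (M' * (T / n%:R)))).
  rewrite ler_wpM2l ?(ltW sn0)// (le_trans (ler_norm_sum _ _ _))// ler_sum// => i _.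
  by rewrite normrM ler_pM// ?H1 ?H2.
rewrite sumr_const card_ord -[_ *+ n]mulr_natl -snE le_eqVlt; apply/orP; left; apply/eqP.
by field; rewrite gt_eqF.
Qed.

(* Abel summation: a step function with [m] jumps contributes a bounded amount,
   whatever the number [n] of increments of the rough path [Z]. *)
Lemma abel_bound (n : nat) (j : nat -> nat) (b Zs : nat -> R) (M B : R) :
  (forall i, `|b i| <= M) -> (forall i, (i <= n)%N -> `|Zs i| <= B) ->
  (forall i, (j i <= j i.+1)%N) ->
  `|\sum_(i < n) b (j i) * (Zs i.+1 - Zs i)| <= 2 * M * B * (1 + (j n)%:R - (j 0%N)%:R).
Proof.
move=> bM ZB jj.
have M0 : 0 <= M by rewrite (le_trans _ (bM 0%N)).
have B0 : 0 <= B by rewrite (le_trans _ (ZB 0%N _)).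
(* The boundary term is subtracted so that the induction adds a single product,
   [b (j n.+1) - b (j n)] times [Zs n.+1]. It is zero unless [j] increases, and then [j n.+1 - j n]
   is at least 1. *)
have : `|\sum_(i < n) b (j i) * (Zs i.+1 - Zs i) - b (j n) * Zs n| <=
    M * B + 2 * M * B * ((j n)%:R - (j 0%N)%:R).
  elim: n ZB => [|n IH] ZB.
    rewrite big_ord0 sub0r normrN subrr mulr0 addr0 normrM ler_pM//.
    by rewrite ZB.
  have {}IH := IH (fun i h => ZB i (leqW h)).
  rewrite big_ord_recr /=.
  rewrite (_ : _ + _ - _ = (\sum_(i < n) b (j i) * (Zs i.+1 - Zs i) - b (j n) * Zs n) -
     (b (j n.+1) - b (j n)) * Zs n.+1); last by ring.
  rewrite (le_trans (ler_normB _ _))//.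
  have -> : M * B + 2 * M * B * ((j n.+1)%:R - (j 0%N)%:R) =
      M * B + 2 * M * B * ((j n)%:R - (j 0%N)%:R) +
      2 * M * B * ((j n.+1)%:R - (j n)%:R) by ring.
  rewrite lerD// normrM.
  rewrite (_ : 2 * M * B * _ = (2 * M * ((j n.+1)%:R - (j n)%:R)) * B); last by ring.
  rewrite ler_pM// ?ZB//.
  have := jj n; rewrite leq_eqVlt => /predU1P[->|jlt].
    by rewrite !subrr normr0 mulr0.
  have : 1 <= (j n.+1)%:R - (j n)%:R :> R.
    by rewrite lerBrDr addrC natr1 ler_nat.
  move=> h1; apply: (@le_trans _ _ (2 * M)); last by rewrite ler_peMr// mulr_ge0.
  by have := bM (j n); have := bM (j n.+1); rewrite !ler_norml; lra.
move=> h; rewrite -[\sum_(i < n) _](subrK (b (j n) * Zs n)).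
rewrite (le_trans (ler_normD _ _))//.
have h2 : `|b (j n) * Zs n| <= M * B by rewrite normrM ler_pM// ZB.
rewrite (le_trans (lerD h h2))// le_eqVlt; apply/orP; left; apply/eqP; ring.
Qed.

Lemma udiff_cross D Z (B K : R) : udiff D -> (forall t, 0 <= t <= T -> `|Z t| <= B) ->
  forall e : R, 0 < e -> exists N : nat, forall n, (N <= n)%N ->
    \sum_(i < n) incr n Z i ^+ 2 <= K ->
    Num.sqrt n%:R * `|\sum_(i < n) incr n D i * incr n Z i| <= e.
Proof.
move=> [a [M [aM H]]] ZB e e0.
have M0 : 0 <= M by rewrite (le_trans _ (aM 0 _))// lexx ltW.
have B0 : 0 <= B by rewrite (le_trans _ (ZB 0 _))// lexx ltW.
have TK : 0 < T * (1 + `|K|) by rewrite mulr_gt0// ltr_pwDl.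
(* Chosen so that [sqrt n] times [e1 * h] times [sqrt n * (1 + |K|)], with [h = T / n], is
   [e / 2]. *)
pose e1 := e / 2 / (T * (1 + `|K|)).
have e10 : 0 < e1 by rewrite !divr_gt0.
have [dl dl0 Hdl] := H e1 e10.
have dl20 : 0 < dl / 2 by rewrite divr_gt0.
have [m Hm] := eventually_fine T dl20; have {Hm}[m0 Tm] := Hm m (leqnn m).
have [N1 H1] := eventually_fine T dl20.
have [N2 H2] := @eventually_small (2 * M * B * T * (1 + m%:R)) _ (divr_gt0 e0 (ltr0n R 2)).
exists (maxn N1 N2) => n; rewrite geq_max => /andP[n1 n2] ZK.
have [n0 Tn] := H1 n n1; have [_ h2] := H2 n n2.
have nn0 : 0 < n%:R :> R by rewrite ltr0n.
have mm0 : 0 < m%:R :> R by rewrite ltr0n.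
have sn0 : 0 < Num.sqrt n%:R :> R by rewrite sqrtr_gt0.
have snE : Num.sqrt n%:R ^+ 2 = n%:R :> R by rewrite sqr_sqrtr.
set sn := Num.sqrt n%:R in sn0 snE h2 *.
pose h := T / n%:R; have h0 : 0 < h by rewrite divr_gt0.
(* [s i] is the last point of the coarse grid not beyond [grid n i]. *)
pose j i := ((i * m) %/ n)%N; pose s i := grid m (j i).
pose rr i := incr n D i - a (s i) * h.
have rb i : (i < n)%N -> `|rr i| <= e1 * h.
  move=> i_n.
  have jm : (j i <= m)%N by rewrite -[leqRHS](mulKn m n0) leq_div2r// leq_mul2r (ltnW i_n) orbT.
  have sdist : 0 <= grid n i - s i <= T / m%:R.
    have e1' := divn_eq (i * m) n; have e2' := ltn_pmod (i * m) n0.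
    have -> : grid n i - s i = ((i * m) %% n)%:R / n%:R * (T / m%:R).
      have : (i * m)%:R = ((i * m) %/ n * n + (i * m) %% n)%:R :> R by rewrite -e1'.
      rewrite natrD !natrM -/(j i) /grid /s /grid => E.
      have -> : ((i * m) %% n)%:R = i%:R * m%:R - (j i)%:R * n%:R :> R by rewrite E; ring.
      by field; rewrite !gt_eqF.
    have Tm0 : 0 <= T / m%:R by rewrite divr_ge0 ?(ltW T0).
    have q0 : 0 <= ((i * m) %% n)%:R / n%:R :> R by rewrite divr_ge0.
    by rewrite (mulr_ge0 q0 Tm0)/= ler_piMl// ler_pdivrMr// mul1r ler_nat ltnW.
  have step := grid_step i n0.
  have d1 : `|grid n i - s i| <= dl.
    by rewrite ger0_norm; move: sdist Tm dl0 => /andP[]; lra.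
  have d2 : `|grid n i.+1 - s i| <= dl.
    rewrite (_ : grid n i.+1 - s i = (grid n i - s i) + (grid n i.+1 - grid n i)); last by ring.
    by rewrite step ger0_norm; move: sdist Tm Tn h0 => /andP[]; rewrite /h; lra.
  have := Hdl (s i) (grid n i) (grid n i.+1) (grid_in jm) (grid_in (ltnW i_n)) (grid_in i_n) d1 d2.
  by rewrite step -/h (gtr0_norm h0).
have -> : \sum_(i < n) incr n D i * incr n Z i =
    \sum_(i < n) rr i * incr n Z i + h * \sum_(i < n) a (s i) * incr n Z i.
  by rewrite mulr_sumr -big_split; apply: eq_bigr => i _ /=; rewrite /rr; ring.
have p1 : sn * `|\sum_(i < n) rr i * incr n Z i| <= e / 2.
  (* From [y <= 1 + y ^+ 2] at [y = sn * |x|]: over [n] terms this costs [sn] for the ones and [sn]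
     times the variation. *)
  have absZ : \sum_(i < n) `|incr n Z i| <= sn * (1 + `|K|).
    apply: (@le_trans _ _ (\sum_(i < n) (sn^-1 + sn * incr n Z i ^+ 2))).
      apply: ler_sum => i _; set x := incr n Z i.
      have -> : sn * x ^+ 2 = sn^-1 * (sn * `|x|) ^+ 2.
        by rewrite exprMn real_normK ?num_real//; field; rewrite gt_eqF.
      rewrite [leLHS](_ : `|x| = sn^-1 * (sn * `|x|)); last by field; rewrite gt_eqF.
      rewrite -{2}(mulr1 sn^-1) -mulrDr ler_wpM2l ?invr_ge0 ?(ltW sn0)//.
      have : 0 <= sn * `|x| by rewrite mulr_ge0 ?(ltW sn0).
      move: (sn * `|x|) => y; nra.
    rewrite big_split /= sumr_const card_ord -mulr_sumr -mulr_natl -snE.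
    rewrite mulrDr mulr1 (_ : sn ^+ 2 / sn = sn); last by field; rewrite gt_eqF.
    by rewrite lerD2l ler_wpM2l ?(ltW sn0)// (le_trans ZK)// ler_norm.
  apply: (@le_trans _ _ (sn * (e1 * h * (sn * (1 + `|K|))))).
    rewrite ler_wpM2l ?(ltW sn0)// (le_trans (ler_norm_sum _ _ _))//.
    apply: (@le_trans _ _ (e1 * h * \sum_(i < n) `|incr n Z i|)).
      rewrite mulr_sumr ler_sum// => i _; rewrite normrM ler_wpM2r//.
      exact: rb.
    by rewrite ler_wpM2l// mulr_ge0 ?(ltW e10) ?(ltW h0).
  rewrite /e1 /h -snE le_eqVlt; apply/orP; left; apply/eqP; field.
  by rewrite !gt_eqF// ltr_pwDl.
have p2 : sn * `|h * \sum_(i < n) a (s i) * incr n Z i| <= e / 2.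
  apply: le_trans h2; rewrite normrM (gtr0_norm h0).
  (* [abel_bound] wants a bound at every index, so coarse points beyond [T] are brought back to
     [T]. *)
  pose b (l : nat) := a (Num.min T (grid m l)).
  have bM l : `|b l| <= M.
    apply: aM; rewrite le_min ge_min lexx (ltW T0) /=.
    by rewrite /grid mulr_ge0 ?divr_ge0 ?(ltW T0).
  have jj i : (j i <= j i.+1)%N by rewrite leq_div2r// leq_mul2r leqnSn orbT.
  have gB i : (i <= n)%N -> `|Z (grid n i)| <= B by move=> ?; apply/ZB/grid_in.
  have := @abel_bound n j b (fun i => Z (grid n i)) M B bM gB jj.
  have -> : \sum_(i < n) b (j i) * (Z (grid n i.+1) - Z (grid n i)) =
      \sum_(i < n) a (s i) * incr n Z i.
    apply: eq_bigr => i _; rewrite /b min_r//.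
    have jm : (j i <= m)%N by rewrite -[leqRHS](mulKn m n0) leq_div2r// leq_mul2r (ltnW (ltn_ord i)) orbT.
    by have /andP[] := grid_in jm.
  rewrite {1 2}/j mulKn// mul0n div0n subr0 => ab.
  apply: (@le_trans _ _ (sn * (h * (2 * M * B * (1 + m%:R))))).
    by rewrite !ler_wpM2l ?(ltW sn0) ?(ltW h0).
  rewrite /h -snE le_eqVlt; apply/orP; left; apply/eqP; field.
  by rewrite gt_eqF.
apply: (@le_trans _ _ (e / 2 + e / 2)); last by rewrite -splitr.
apply: le_trans (lerD p1 p2); rewrite -mulrDr ler_wpM2l ?(ltW sn0)//.
exact: ler_normD.
Qed.

End pathwise.

(** * Quadratic forms of independent standard variables *)

Lemma add_pow4 (R : realType) (y z : R) : (y + z) ^+ 4 <= 8 * (y ^+ 4 + z ^+ 4).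
Proof.
have s1 (s t : R) : (s + t) ^+ 2 <= 2 * s ^+ 2 + 2 * t ^+ 2.
  by have := sqr_ge0 (s - t); nra.
have -> : (y + z) ^+ 4 = ((y + z) ^+ 2) ^+ 2 by rewrite -exprM.
apply: (@le_trans _ _ ((2 * y ^+ 2 + 2 * z ^+ 2) ^+ 2)).
  by rewrite ler_sqr ?nnegrE ?s1 ?sqr_ge0// addr_ge0// mulr_ge0// sqr_ge0.
have := s1 (2 * y ^+ 2) (2 * z ^+ 2); lra.
Qed.

Lemma sum_pow4 (R : realType) (n : nat) (a : 'I_n -> R) :
  (\sum_i a i) ^+ 4 <= 8 ^+ n * \sum_i a i ^+ 4.
Proof.
elim: n a => [|n IH] a; first by rewrite !big_ord0 expr0n /= mulr0.
rewrite !big_ord_recr /=; apply: (le_trans (add_pow4 _ _)).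
rewrite [8 ^+ n.+1]exprS -mulrA ler_wpM2l// mulrDr lerD//.
by rewrite ler_peMl ?exprn_even_ge0// exprn_ege1// ler1n.
Qed.

Section cosine_moments.
Context {R : realType} {d : measure_display} {Om : measurableType d}.
Variable P : probability Om R.

Lemma family_indep_comp (I : finType) (x : I -> Om -> R) (f : I -> R -> R) :
  (forall i, measurable_fun setT (f i)) -> family_indep P x ->
  family_indep P (fun i => f i \o x i).
Proof.
move=> mf ix A mA; apply: (ix (fun i => f i @^-1` A i)) => i.
by rewrite -[_ @^-1` _]setTI; exact: mf.
Qed.

Lemma integrable_le_pow (X : Om -> R) (k n : nat) : (k <= n)%N ->
  measurable_fun setT X -> P.-integrable setT (EFin \o (fun w => `|X w| ^+ n)) ->
  P.-integrable setT (EFin \o (fun w => X w ^+ k)).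
Proof.
move=> kn mX iX.
have i1 := integrableDR (cst_integrable P 1) iX.
apply: dominated_integrable i1; first exact: measurable_funX.
move=> w; rewrite normrX; have [x1|x1] := leP `|X w| 1.
  by rewrite (@le_trans _ _ 1)// ?exprn_ile1// lerDl exprn_ge0.
by rewrite (@le_trans _ _ (`|X w| ^+ n))// ?ler_weXn2l ?ltW// ltrDr.
Qed.

(** Taylor expansion of a centred variable: the sine of [t * z] is compared with [t * z], whose mean
    is zero, and the third absolute moment is absorbed in [1 + z ^+ 4], so that only moments 1, 2
    and 4 occur. *)
Lemma cos_sin_moment (z : Om -> R) (v K t : R) : measurable_fun setT z -> 0 <= v -> 0 <= t ->
  P.-integrable setT (EFin \o (fun w => z w ^+ 4)) ->
  \int[P]_w z w = 0 -> \int[P]_w (z w ^+ 2) = v -> \int[P]_w (z w ^+ 4) <= K ->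
  `|\int[P]_w cos (t * z w) - expR (- (t ^+ 2 * v / 2))| <= t ^+ 4 * (K + v ^+ 2) /\
  `|\int[P]_w sin (t * z w)| <= t ^+ 3 * (1 + K).
Proof.
move=> mz v0 t0 i4 e1 e2 e4.
have i4' : P.-integrable setT (EFin \o (fun w => `|z w| ^+ 4)).
  rewrite (_ : (fun w => _) = (fun w => z w ^+ 4))//.
  by apply/funext => w; rewrite -normrX ger0_norm ?exprn_even_ge0.
have i2 := integrable_le_pow (isT : (2 <= 4)%N) mz i4'.
have i1 : P.-integrable setT (EFin \o z) by exact: (integrable_le_pow (isT : (1 <= 4)%N) mz i4').
have mtz : measurable_fun setT (fun w => t * z w) by exact: measurable_funM.
split.
- have E : \int[P]_w (1 - t ^+ 2 / 2 * z w ^+ 2) = 1 - t ^+ 2 * v / 2.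
    rewrite RintegralB//; [|exact: cst_integrable|exact: integrableZR].
    by rewrite Rintegral_prob_cst RintegralZl// e2 mulrAC.
  have iq : P.-integrable setT (EFin \o (fun w => 1 - t ^+ 2 / 2 * z w ^+ 2)).
    by have := integrableB measurableT (cst_integrable P 1) (integrableZR (t ^+ 2 / 2) i2).
  have ic := integrable_cos P mtz.
  have h1 : `|\int[P]_w cos (t * z w) - (1 - t ^+ 2 * v / 2)| <= t ^+ 4 * K.
    rewrite -E -RintegralB//.
    have iB : P.-integrable setT
        (EFin \o (fun w => cos (t * z w) - (1 - t ^+ 2 / 2 * z w ^+ 2))).
      by have := integrableB measurableT ic iq.
    rewrite (le_trans (le_normr_Rintegral _ iB))//.
    apply: (@le_trans _ _ (\int[P]_w (t ^+ 4 * z w ^+ 4))).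
      apply: le_Rintegral => //; [exact: integrable_norm|exact: integrableZR|].
      move=> w _; rewrite -exprMn (le_trans _ (cos_taylor _))//.
      by rewrite exprMn mulrAC.
    by rewrite RintegralZl// ler_wpM2l// exprn_ge0.
  have y0 : 0 <= t ^+ 2 * v / 2 by rewrite divr_ge0 ?mulr_ge0 ?sqr_ge0.
  have h2 := expRN_taylor y0.
  rewrite (_ : _ - expR _ = (\int[P]_w cos (t * z w) - (1 - t ^+ 2 * v / 2)) -
     (expR (- (t ^+ 2 * v / 2)) - (1 - t ^+ 2 * v / 2))); last by ring.
  rewrite (le_trans (ler_normB _ _))// mulrDr lerD// (le_trans h2)//.
  have -> : (t ^+ 2 * v / 2) ^+ 2 = (t ^+ 4 * v ^+ 2) / 4 by field.
  by rewrite ler_pdivrMr// ler_peMr ?mulr_ge0 ?exprn_ge0// ler1n.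
- have iS := integrable_sin P mtz.
  have -> : \int[P]_w sin (t * z w) = \int[P]_w (sin (t * z w) - t * z w).
    by rewrite RintegralB//; [rewrite RintegralZl// e1 mulr0 subr0|exact: integrableZR].
  have iB : P.-integrable setT (EFin \o (fun w => sin (t * z w) - t * z w)).
    by have := integrableB measurableT iS (integrableZR t i1).
  rewrite (le_trans (le_normr_Rintegral _ iB))//.
  apply: (@le_trans _ _ (\int[P]_w (t ^+ 3 * (1 + z w ^+ 4)))).
    apply: le_Rintegral => //; first exact: integrable_norm.
      by apply/integrableZR/integrableDR => //; exact: cst_integrable.
    move=> w _; rewrite (le_trans (sin_sub_id _))// normrM (ger0_norm t0) exprMn.
    rewrite ler_wpM2l ?exprn_ge0//.
    have -> : z w ^+ 4 = `|z w| ^+ 4 by rewrite -normrX ger0_norm ?exprn_even_ge0.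
    have := normr_ge0 (z w); move: `|z w| => y y0.
    have [y1|/ltW y1] := leP y 1.
      by rewrite (@le_trans _ _ 1)// ?exprn_ile1// lerDl exprn_ge0.
    by rewrite (@le_trans _ _ (y ^+ 4))// ?ler_weXn2l// lerDr.
  rewrite RintegralZl//; last by apply: integrableDR => //; exact: cst_integrable.
  rewrite ler_wpM2l ?exprn_ge0// RintegralD//; last exact: cst_integrable.
  by rewrite Rintegral_prob_cst lerD2l.
Qed.

End cosine_moments.

Section gaussian_quadratic_form.
Context {R : realType} {d : measure_display} {Om : measurableType d}.
Variable P : probability Om R.
Variables (I : finType) (x : I -> Om -> R) (K8 : R).

(** All that the limit theorem retains of the Gaussian law. The value 3 of the fourth moment makes
    [isserlis] hold on the diagonal; the eighth moment bounds the fourth moment of quadratic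
    forms. *)
Definition std_family : Prop :=
  [/\ forall i, measurable_fun setT (x i), family_indep P x,
      forall i, P.-integrable setT (EFin \o (fun w => x i w ^+ 8)) &
      forall i, [/\ \int[P]_w x i w = 0, \int[P]_w (x i w ^+ 2) = 1,
        \int[P]_w (x i w ^+ 4) = 3 & \int[P]_w (x i w ^+ 8) <= K8]].

Hypothesis sx : std_family.
Let mx i : measurable_fun setT (x i). Proof. by case: sx. Qed.
Let ix : family_indep P x. Proof. by case: sx. Qed.

Let ipow k i : (k <= 8)%N -> P.-integrable setT (EFin \o (fun w => x i w ^+ k)).
Proof.
move=> k8; apply: (integrable_le_pow k8) => //.
case: sx => _ _ i8 _; rewrite (_ : (fun w => _) = (fun w => x i w ^+ 8))//.
by apply/funext => w; rewrite -normrX ger0_norm ?exprn_even_ge0.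
Qed.

Lemma integrable_prod4 (U1 U2 U3 U4 : Om -> R) :
  measurable_fun setT U1 -> measurable_fun setT U2 ->
  measurable_fun setT U3 -> measurable_fun setT U4 ->
  P.-integrable setT (EFin \o (fun w => U1 w ^+ 4)) ->
  P.-integrable setT (EFin \o (fun w => U2 w ^+ 4)) ->
  P.-integrable setT (EFin \o (fun w => U3 w ^+ 4)) ->
  P.-integrable setT (EFin \o (fun w => U4 w ^+ 4)) ->
  P.-integrable setT (EFin \o (fun w => U1 w * U2 w * U3 w * U4 w)).
Proof.
move=> m1 m2 m3 m4 i1 i2 i3 i4.
have iS := integrableDR (integrableDR i1 i2) (integrableDR i3 i4).
apply: dominated_integrable iS.
  by do 3 apply: measurable_funM => //.
move=> w; set a := U1 w; set b := U2 w; set c := U3 w; set e := U4 w.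
have sq (y z : R) : `|y * z| <= y ^+ 2 + z ^+ 2.
  by rewrite ler_norml; have := sqr_ge0 (y + z); have := sqr_ge0 (y - z); nra.
have -> : a * b * c * e = (a * b) * (c * e) by ring.
have h1 := sq (a * b) (c * e); apply: (le_trans h1).
have sq' (y z : R) : (y * z) ^+ 2 <= y ^+ 4 + z ^+ 4.
  have -> : (y * z) ^+ 2 = y ^+ 2 * z ^+ 2 by rewrite exprMn.
  have := sq (y ^+ 2) (z ^+ 2); rewrite -!exprM; apply: le_trans; exact: ler_norm.
by rewrite lerD ?sq'.
Qed.

Let i1pow : P.-integrable setT (EFin \o (fun w : Om => (1 : R) ^+ 4)).
Proof. exact: cst_integrable. Qed.

Let E4 e f g k := \int[P]_w (x e w * x f w * x g w * x k w).

Let iE4 e f g k : P.-integrable setT (EFin \o (fun w => x e w * x f w * x g w * x k w)).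
Proof. by apply: integrable_prod4 => //; exact: ipow. Qed.

Let mom i : [/\ \int[P]_w x i w = 0, \int[P]_w (x i w ^+ 2) = 1,
        \int[P]_w (x i w ^+ 4) = 3 & \int[P]_w (x i w ^+ 8) <= K8].
Proof. by case: sx. Qed.

Let E4_single e f g k : e != k -> f != k -> g != k -> E4 e f g k = 0.
Proof.
move=> ek fk gk.
pose J := [set i | i = e \/ i = f \/ i = g].
have mU : family_mfun J x (fun w => x e w * x f w * x g w).
  by apply: measurable_funM; [apply: measurable_funM|];
    apply: family_mfun_coord; [left|right; left|right; right].
have mV : family_mfun [set k] x (x k) by exact: family_mfun_coord.
have JK : J `&` [set k] = set0.
  apply/seteqP; split => // i /= [iJ ik]; subst i.
  by case: iJ => [E|[E|E]]; move: ek fk gk; rewrite E eqxx.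
have UV := block_indep mx ix JK mU mV.
have mU' : measurable_fun setT (fun w => x e w * x f w * x g w).
  by do 2 apply: measurable_funM => //.
have iU : P.-integrable setT (EFin \o (fun w => x e w * x f w * x g w)).
  rewrite (_ : (fun w => _) = (fun w => x e w * x f w * x g w * 1)).
    by apply: integrable_prod4 => //; exact: ipow.
  by apply/funext => w; rewrite mulr1.
have iV : P.-integrable setT (EFin \o x k) by exact: (ipow k (isT : (1 <= 8)%N)).
have [_ E] := rv_indep_expectation mU' (mx k) UV iU iV.
by rewrite /E4 E; case: (mom k) => -> _ _ _; rewrite mulr0.
Qed.

Let E4_pair e g : e != g -> E4 e e g g = 1.
Proof.
move=> eg.
have mU : family_mfun [set e] x (fun w => x e w ^+ 2).
  by apply: measurable_funX; exact: family_mfun_coord.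
have mV : family_mfun [set g] x (fun w => x g w ^+ 2).
  by apply: measurable_funX; exact: family_mfun_coord.
have JK : [set e] `&` [set g] = set0.
  by apply/seteqP; split => // i /= [-> E]; move: eg; rewrite E eqxx.
have UV := block_indep mx ix JK mU mV.
have [_ E] := rv_indep_expectation (measurable_funX 2 (mx e)) (measurable_funX 2 (mx g)) UV
  (ipow e (isT : (2 <= 8)%N)) (ipow g (isT : (2 <= 8)%N)).
case: (mom e) => _ e2 _ _; case: (mom g) => _ g2 _ _.
rewrite e2 g2 mulr1 in E; rewrite -[RHS]E.
by apply: eq_Rintegral => w _; ring.
Qed.

Let E4_same e : E4 e e e e = 3.
Proof.
by case: (mom e) => _ _ <- _; apply: eq_Rintegral => w _; ring.
Qed.

Let E4_ends e f g : E4 e f g e = ((e == f) && (g == e))%:R + ((e == g) && (f == e))%:R +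
  (f == g)%:R.
Proof.
have [fg|fg] := eqVneq f g.
  subst g; have [fe|fe] := eqVneq f e; first by subst f; rewrite E4_same /=; ring.
  rewrite /= !add0r -(@E4_pair e f) 1?eq_sym//.
  by apply: eq_Rintegral => w _; ring.
rewrite addr0; have [fe|fe] := eqVneq f e.
  subst f; rewrite [g == e]eq_sym (negbTE fg) /= addr0.
  transitivity (E4 e e e g); last exact: E4_single.
  by apply: eq_Rintegral => w _; ring.
rewrite /= andbF addr0.
transitivity (E4 e g e f); last by apply: E4_single; rewrite // eq_sym.
by apply: eq_Rintegral => w _; ring.
Qed.

(** Sum over the three pairings. An index occurring only once gives 0, two distinct pairs satisfy
    one pairing and give 1, four equal indices satisfy all three and give 3. Permuting the factors
    reduces every coincidence with [k] to the case [e = k]. *)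
Lemma isserlis e f g k : \int[P]_w (x e w * x f w * x g w * x k w) =
  ((e == f) && (g == k))%:R + ((e == g) && (f == k))%:R + ((e == k) && (f == g))%:R.
Proof.
rewrite -/(E4 e f g k).
have [ek|ek] := eqVneq e k; first by subst k; rewrite E4_ends.
have [fk|fk] := eqVneq f k.
  subst k; have -> : E4 e f g f = E4 f e g f by apply: eq_Rintegral => w _; ring.
  by rewrite E4_ends [f == e]eq_sym (negbTE ek) !andbF /= ?andbT ?addr0 ?add0r.
have [gk|gk] := eqVneq g k.
  subst k; have -> : E4 e f g g = E4 g e f g by apply: eq_Rintegral => w _; ring.
  by rewrite E4_ends [g == e]eq_sym (negbTE ek) /= !andbF andbT !addr0 !add0r.
by rewrite E4_single// !andbF !addr0.
Qed.

Variables (q : nat) (Q : 'I_q -> 'I_q -> R).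
Hypothesis Qsym : forall e f, Q e f = Q f e.

(** [c] places the [q] coordinates of one cell among all the variables of [I]; the Kronecker symbol
    is the mean of the product once [c] is injective. *)
Definition quad_form (c : 'I_q -> I) (w : Om) : R :=
  \sum_e \sum_f Q e f * (x (c e) w * x (c f) w - (e == f)%:R).

Definition quad_var : R := 2 * \sum_e \sum_f Q e f ^+ 2.

Variable c : 'I_q -> I.
Hypothesis cinj : injective c.

Let ceq e f : (c e == c f) = (e == f). Proof. exact: inj_eq. Qed.

Lemma quad_form_mfun : family_mfun [set i | exists e, c e = i] x (quad_form c).
Proof.
apply: measurable_sum => e; apply: measurable_sum => f.
apply: measurable_funM => //; apply: measurable_funB => //.
by apply: measurable_funM; apply: family_mfun_coord; [exists e|exists f].
Qed.

Lemma measurable_quad_form : measurable_fun setT (quad_form c).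
Proof.
apply: measurable_sum => e; apply: measurable_sum => f.
apply: measurable_funM => //; apply: measurable_funB => //.
by apply: measurable_funM.
Qed.

Let i2 e f : P.-integrable setT (EFin \o (fun w => x e w * x f w)).
Proof.
rewrite (_ : (fun w => _) = (fun w => x e w * x f w * 1 * 1)).
  by apply: integrable_prod4 => //; exact: ipow.
by apply/funext => w; rewrite !mulr1.
Qed.

Let mom2 e f : \int[P]_w (x e w * x f w) = (e == f)%:R.
Proof.
have [ef|ef] := eqVneq e f.
  by subst f; case: (mom e) => _ <- _ _; apply: eq_Rintegral => w _; rewrite expr2.
have JK : [set e] `&` [set f] = set0.
  by apply/seteqP; split => // i /= [-> E]; move: ef; rewrite E eqxx.
have me : family_mfun [set e] x (x e) by exact: family_mfun_coord.
have mf : family_mfun [set f] x (x f) by exact: family_mfun_coord.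
have UV := block_indep mx ix JK me mf.
have [_ ->] := rv_indep_expectation (mx e) (mx f) UV (ipow e (isT : (1 <= 8)%N))
  (ipow f (isT : (1 <= 8)%N)).
by case: (mom e) => -> _ _ _; rewrite mul0r.
Qed.

Let itm e f : P.-integrable setT
  (EFin \o (fun w => Q e f * (x (c e) w * x (c f) w - (e == f)%:R))).
Proof.
apply: integrableZR.
by have := integrableB measurableT (i2 (c e) (c f)) (cst_integrable P (e == f)%:R).
Qed.

Lemma integrable_quad_form : P.-integrable setT (EFin \o quad_form c).
Proof. by apply: integrable_sumR => e _; apply: integrable_sumR => f _; exact: itm. Qed.

Lemma quad_form_mean : \int[P]_w quad_form c w = 0.
Proof.
rewrite Rintegral_sumR => [|e _]; last by apply: integrable_sumR.
rewrite big1// => e _; rewrite Rintegral_sumR//big1// => f _.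
have iB : P.-integrable setT (EFin \o (fun w => x (c e) w * x (c f) w - (e == f)%:R)).
  by have := integrableB measurableT (i2 (c e) (c f)) (cst_integrable P (e == f)%:R).
rewrite RintegralZl// RintegralB//; last exact: cst_integrable.
by rewrite mom2 Rintegral_prob_cst ceq subrr mulr0.
Qed.

Lemma sum_delta (F : 'I_q -> R) k : \sum_i F i * (k == i)%:R = F k.
Proof.
rewrite (bigD1 k)//= eqxx mulr1 big1 ?addr0// => i ik.
by rewrite eq_sym (negbTE ik) mulr0.
Qed.

(** Centring removes from Isserlis' formula exactly the pairing of [e] with [f] and of [g] with
    [k]. *)
Let moment4 e f g k :
  let F w := (x (c e) w * x (c f) w - (e == f)%:R) * (x (c g) w * x (c k) w - (g == k)%:R) in
  P.-integrable setT (EFin \o F) /\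
  \int[P]_w F w = (e == g)%:R * (f == k)%:R + (e == k)%:R * (f == g)%:R.
Proof.
pose a := x (c e); pose b := x (c f); pose a' := x (c g); pose b' := x (c k).
have iabab : P.-integrable setT (EFin \o (fun w => a w * b w * a' w * b' w)).
  exact: iE4.
have FE : (fun w => (a w * b w - (e == f)%:R) * (a' w * b' w - (g == k)%:R)) =
   (fun w => (a w * b w * a' w * b' w + - (g == k)%:R * (a w * b w)) +
             (- (e == f)%:R * (a' w * b' w) + (e == f)%:R * (g == k)%:R)).
  by apply/funext => w; ring.
move=> F; have -> : F = (fun w => (a w * b w * a' w * b' w + - (g == k)%:R * (a w * b w)) +
             (- (e == f)%:R * (a' w * b' w) + (e == f)%:R * (g == k)%:R)) by exact: FE.
have j1 : P.-integrable setT (EFin \o (fun w => a w * b w * a' w * b' w + - (g == k)%:R * (a w * b w))).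
  by apply: integrableDR => //; apply: integrableZR; exact: i2.
have j2 : P.-integrable setT (EFin \o (fun w => - (e == f)%:R * (a' w * b' w) + (e == f)%:R * (g == k)%:R)).
  by apply: integrableDR; [apply: integrableZR; exact: i2|exact: cst_integrable].
split; first exact: integrableDR.
rewrite RintegralD// RintegralD//; last by apply: integrableZR; exact: i2.
rewrite RintegralD//; [|by apply: integrableZR; exact: i2|exact: cst_integrable].
have iab : P.-integrable setT (EFin \o (fun w => a w * b w)) by exact: i2.
have iab' : P.-integrable setT (EFin \o (fun w => a' w * b' w)) by exact: i2.
rewrite (RintegralZl _ measurableT iab) (RintegralZl _ measurableT iab').
rewrite Rintegral_prob_cst isserlis !mom2 !ceq -!mulnb !natrM; ring.
Qed.

(** Each of the two remaining pairings contributes the sum of the [Q e f ^+ 2], the second one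
    through the symmetry of [Q]; hence the factor 2. *)
Lemma quad_form_variance : P.-integrable setT (EFin \o (fun w => quad_form c w ^+ 2)) /\
  \int[P]_w (quad_form c w ^+ 2) = quad_var.
Proof.
pose A e f w := x (c e) w * x (c f) w - (e == f)%:R.
have E w : quad_form c w ^+ 2 =
    \sum_e \sum_f \sum_g \sum_k (Q e f * Q g k) * (A e f w * A g k w).
  rewrite expr2 /quad_form mulr_suml; apply: eq_bigr => e _.
  rewrite mulr_suml; apply: eq_bigr => f _.
  rewrite mulr_sumr; apply: eq_bigr => g _.
  rewrite mulr_sumr; apply: eq_bigr => k _.
  by rewrite /A; ring.
have iF e f g k : P.-integrable setT (EFin \o (fun w => (Q e f * Q g k) * (A e f w * A g k w))).
  by apply: integrableZR; exact: (moment4 e f g k).1.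
have i3 e f g : P.-integrable setT (EFin \o (fun w =>
    \sum_k (Q e f * Q g k) * (A e f w * A g k w))) by exact: integrable_sumR.
have i2' e f : P.-integrable setT (EFin \o (fun w =>
    \sum_g \sum_k (Q e f * Q g k) * (A e f w * A g k w))) by exact: integrable_sumR.
have i1' e : P.-integrable setT (EFin \o (fun w =>
    \sum_f \sum_g \sum_k (Q e f * Q g k) * (A e f w * A g k w))) by exact: integrable_sumR.
rewrite (_ : (fun w => quad_form c w ^+ 2) = fun w =>
    \sum_e \sum_f \sum_g \sum_k (Q e f * Q g k) * (A e f w * A g k w)); last exact/funext.
split; first exact: integrable_sumR.
rewrite Rintegral_sumR// /quad_var mulr_sumr; apply: eq_bigr => e _.
rewrite Rintegral_sumR// mulr_sumr; apply: eq_bigr => f _.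
rewrite Rintegral_sumR//.
transitivity (\sum_g \sum_k Q e f * Q g k *
    ((e == g)%:R * (f == k)%:R + (e == k)%:R * (f == g)%:R)).
  apply: eq_bigr => g _; rewrite Rintegral_sumR//; apply: eq_bigr => k _.
  have [im Em] := moment4 e f g k.
  exact: etrans (RintegralZl _ measurableT im) (congr1 _ Em).
under eq_bigr do under eq_bigr do rewrite mulrDr.
under eq_bigr do rewrite big_split /=.
rewrite big_split /=.
have -> : \sum_g \sum_k Q e f * Q g k * ((e == g)%:R * (f == k)%:R) = Q e f ^+ 2.
  under eq_bigr do under eq_bigr do rewrite mulrA.
  under eq_bigr do rewrite sum_delta.
  by rewrite sum_delta expr2.
have -> : \sum_g \sum_k Q e f * Q g k * ((e == k)%:R * (f == g)%:R) = Q e f ^+ 2.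
  transitivity (\sum_g \sum_k (Q e f * Q g k * (f == g)%:R) * (e == k)%:R).
    by apply: eq_bigr => g _; apply: eq_bigr => k _; ring.
  under eq_bigr do rewrite sum_delta.
  by rewrite sum_delta (Qsym f e) expr2.
by rewrite mulr_natl mulr2n.
Qed.

(** Comes from two uses of [sum_pow4], then [add_pow4] and [(a b)^4 <= a^8 + b^8]. What counts is
    that it does not depend on the cell: one constant serves all summands. *)
Definition quad_bound4 : R :=
  8 ^+ q * \sum_e (8 ^+ q * \sum_f Q e f ^+ 4 * (8 * (K8 + K8 + 1))).

Lemma quad_form_moment4 : P.-integrable setT (EFin \o (fun w => quad_form c w ^+ 4)) /\
  \int[P]_w (quad_form c w ^+ 4) <= quad_bound4.
Proof.
pose dom w := 8 ^+ q * \sum_e (8 ^+ q * \sum_f Q e f ^+ 4 *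
  (8 * (x (c e) w ^+ 8 + x (c f) w ^+ 8 + 1))).
have i8 i := ipow i (leqnn 8).
have i0 e f : P.-integrable setT (EFin \o (fun w => x (c e) w ^+ 8 + x (c f) w ^+ 8 + 1)).
  by apply: integrableDR; [exact: integrableDR|exact: cst_integrable].
have ia e f : P.-integrable setT (EFin \o (fun w => 8 * (x (c e) w ^+ 8 + x (c f) w ^+ 8 + 1))).
  exact: integrableZR.
have ib e f : P.-integrable setT
    (EFin \o (fun w => Q e f ^+ 4 * (8 * (x (c e) w ^+ 8 + x (c f) w ^+ 8 + 1)))).
  exact: integrableZR.
have ic e : P.-integrable setT (EFin \o (fun w => \sum_f Q e f ^+ 4 *
    (8 * (x (c e) w ^+ 8 + x (c f) w ^+ 8 + 1)))) by exact: integrable_sumR.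
have ie e : P.-integrable setT (EFin \o (fun w => 8 ^+ q * \sum_f Q e f ^+ 4 *
    (8 * (x (c e) w ^+ 8 + x (c f) w ^+ 8 + 1)))) by exact: integrableZR.
have ig : P.-integrable setT (EFin \o (fun w => \sum_e (8 ^+ q * \sum_f Q e f ^+ 4 *
    (8 * (x (c e) w ^+ 8 + x (c f) w ^+ 8 + 1))))) by exact: integrable_sumR.
have idom : P.-integrable setT (EFin \o dom) by exact: integrableZR.
have le w : quad_form c w ^+ 4 <= dom w.
  apply: (le_trans (sum_pow4 _)); rewrite ler_wpM2l ?exprn_ge0// ler_sum// => e _.
  apply: (le_trans (sum_pow4 _)); rewrite ler_wpM2l ?exprn_ge0// ler_sum// => f _.
  rewrite exprMn ler_wpM2l ?exprn_even_ge0//.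
  set a := x (c e) w; set b := x (c f) w.
  apply: (le_trans (add_pow4 _ _)); rewrite ler_wpM2l// lerD//.
    have := sqr_ge0 (a ^+ 4 - b ^+ 4); have := sqr_ge0 (a ^+ 4 + b ^+ 4).
    by rewrite exprMn (_ : a ^+ 8 = a ^+ 4 * a ^+ 4) -?exprD// (_ : b ^+ 8 = b ^+ 4 * b ^+ 4) -?exprD//; nra.
  by case: (e == f) => /=; rewrite ?oppr0 ?expr0n// exprNn expr1n mulr1 -signr_odd expr0.
have i4 : P.-integrable setT (EFin \o (fun w => quad_form c w ^+ 4)).
  apply: dominated_integrable idom; first exact: measurable_funX measurable_quad_form.
  by move=> w; rewrite ger0_norm ?exprn_even_ge0.
split => //.
apply: (@le_trans _ _ (\int[P]_w dom w)); first by apply: le_Rintegral.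
rewrite /dom RintegralZl// ler_wpM2l ?exprn_ge0// Rintegral_sumR// ler_sum// => e _.
rewrite RintegralZl// ler_wpM2l ?exprn_ge0// Rintegral_sumR// ler_sum// => f _.
rewrite RintegralZl// ler_wpM2l ?exprn_even_ge0// RintegralZl// ler_wpM2l//.
rewrite RintegralD//; last 2 first.
- exact: integrableDR.
- exact: cst_integrable.
rewrite RintegralD// Rintegral_prob_cst.
by case: (mom (c e)) => _ _ _ ?; case: (mom (c f)) => _ _ _ ?; rewrite !lerD.
Qed.

End gaussian_quadratic_form.

(** * Central limit theorem for sums of independent quadratic forms *)

Section quadratic_clt.
Context {R : realType} {d : measure_display} {Om : measurableType d}.
Variable P : probability Om R.

Lemma variance_sum (n : nat) (z : nat -> Om -> R) (v : R) :
  (forall i, (i < n)%N -> measurable_fun setT (z i)) ->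
  (forall j, (j < n)%N -> rv_indep P (fun w => \sum_(i < j) z i w) (z j)) ->
  (forall i, (i < n)%N -> [/\ P.-integrable setT (EFin \o z i),
     P.-integrable setT (EFin \o (fun w => z i w ^+ 2)),
     \int[P]_w z i w = 0 & \int[P]_w (z i w ^+ 2) = v]) ->
  P.-integrable setT (EFin \o (fun w => (\sum_(i < n) z i w) ^+ 2)) /\
  \int[P]_w ((\sum_(i < n) z i w) ^+ 2) = n%:R * v.
Proof.
elim: n => [|n IH] mz iz H.
  under eq_fun do rewrite big_ord0 expr0n.
  rewrite mul0r Rintegral_prob_cst; split => //; exact: cst_integrable.
have {}IH := IH (fun i h => mz i (ltnW h)) (fun i h => iz i (ltnW h))
  (fun i h => H i (ltnW h)).
pose S w := \sum_(i < n) z i w.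
have mS : measurable_fun setT S.
  by apply: measurable_sum => i; apply: mz; exact: ltnW (ltn_ord i).
have mzn : measurable_fun setT (z n) by exact: mz.
have iS : P.-integrable setT (EFin \o S).
  by apply: integrable_sumR => i _; case: (H i (ltnW (ltn_ord i))).
have [i1 i2 e1 e2] := H n (ltnSn n).
have [iSS eSS] := IH.
have [iSz eSz] := rv_indep_expectation mS mzn (iz n (ltnSn n)) iS i1.
have E : (fun w => (\sum_(i < n.+1) z i w) ^+ 2) =
    (fun w => S w ^+ 2 + (2 * (S w * z n w) + z n w ^+ 2)).
  by apply/funext => w; rewrite big_ord_recr /= -/(S w); ring.
rewrite E.
have j1 : P.-integrable setT (EFin \o (fun w => 2 * (S w * z n w))) by exact: integrableZR.
have j2 : P.-integrable setT (EFin \o (fun w => 2 * (S w * z n w) + z n w ^+ 2)).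
  exact: integrableDR.
split; first exact: integrableDR.
rewrite RintegralD// RintegralD// (RintegralZl _ measurableT iSz) eSz e1 e2 eSS.
by rewrite !mulr0 add0r -natr1 mulrDl mul1r.
Qed.

Variables (n q : nat) (x : 'I_n.+1 * 'I_q -> Om -> R) (K8 : R).
Hypothesis sx : std_family P x K8.
Variable Q : 'I_q -> 'I_q -> R.
Hypothesis Qsym : forall e f, Q e f = Q f e.

Let t : R := (Num.sqrt n.+1%:R)^-1.

Definition quad_sum (w : Om) : R :=
  t * \sum_(i < n.+1) quad_form x Q (fun e => (i, e)) w.

Let c (i : nat) (e : 'I_q) : 'I_n.+1 * 'I_q := (inord i, e).
Let cinj i : injective (c i). Proof. by move=> e f []. Qed.
Let z (i : nat) (w : Om) : R := quad_form x Q (c i) w.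

Let quad_sumE w : quad_sum w = t * \sum_(i < n.+1) z i w.
Proof.
by congr (t * _); apply: eq_bigr => i _; rewrite /z /c; congr quad_form;
  apply/funext => e; rewrite inord_val.
Qed.

Let mx i : measurable_fun setT (x i). Proof. by case: sx. Qed.
Let mz i : measurable_fun setT (z i).
Proof. by apply: (measurable_quad_form sx). Qed.

Let zmfun i : (i < n.+1)%N -> family_mfun [set k | nat_of_ord k.1 = i] x (z i).
Proof.
move=> iN; have := @quad_form_mfun _ _ _ _ x q Q (c i).
by apply: family_mfunS => k [e <-] /=; rewrite inordK.
Qed.

Let zindep j : (j < n.+1)%N -> rv_indep P (fun w => \sum_(i < j) z i w) (z j).
Proof.
have ix : family_indep P x by case: sx.
exact: (@partial_sum_indep _ _ _ P _ x (fun k => nat_of_ord k.1) n.+1 z mx ix zmfun).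
Qed.

Let N0 : 0 < Num.sqrt n.+1%:R :> R. Proof. by rewrite sqrtr_gt0 ltr0n. Qed.
Let t0 : 0 < t. Proof. by rewrite invr_gt0. Qed.
Let tN : t ^+ 2 * n.+1%:R = 1.
Proof. by rewrite /t exprVn sqr_sqrtr// mulVf. Qed.

Let v := quad_var Q.

Lemma quad_sum_variance : P.-integrable setT (EFin \o (fun w => quad_sum w ^+ 2)) /\
  \int[P]_w (quad_sum w ^+ 2) = v.
Proof.
have [i1 e1] := @variance_sum n.+1 z v (fun i _ => mz i) zindep
  (fun i _ => And4 (integrable_quad_form sx Q (c i))
    (quad_form_variance sx Qsym (@cinj i)).1 (quad_form_mean sx Q (@cinj i))
    (quad_form_variance sx Qsym (@cinj i)).2).
rewrite (_ : (fun w => quad_sum w ^+ 2) = fun w => t ^+ 2 * (\sum_(i < n.+1) z i w) ^+ 2).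
  split; first exact: integrableZR.
  by rewrite RintegralZl// e1 mulrA tN mul1r.
by apply/funext => w; rewrite quad_sumE exprMn.
Qed.

(** With [t = 1 / sqrt (n + 1)], one summand costs [t^4 (K + v^2) + t^3 (1 + K)], and [n + 1] of
    them cost [t^2] and [t] times these constants. The comparison factors [expR (- (t^2 v / 2))]
    multiply to exactly [expR (- (v / 2))]. *)
Lemma quad_sum_clt (th : R) :
  `|\int[P]_w cos (th + quad_sum w) - cos th * expR (- (v / 2))| <=
  ((quad_bound4 K8 Q + v ^+ 2) + (1 + quad_bound4 K8 Q)) / Num.sqrt n.+1%:R.
Proof.
set K := quad_bound4 K8 Q.
have K0 : 0 <= K.
  have [i4 h] := quad_form_moment4 sx Q (c 0).
  by apply: le_trans h; apply: Rintegral_ge0 => w _; rewrite exprn_even_ge0.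
have v0 : 0 <= v.
  by rewrite /v /quad_var mulr_ge0// sumr_ge0// => e _; rewrite sumr_ge0// => f _; exact: sqr_ge0.
pose zt i w := t * z i w.
pose rho := expR (- (t ^+ 2 * v / 2)).
have t2v : 0 <= t ^+ 2 * v / 2 by apply: divr_ge0 => //; apply: mulr_ge0 => //; exact: sqr_ge0.
have rho1 : `|rho| <= 1.
  by rewrite ger0_norm ?expR_ge0// -expR0 ler_expR oppr_le0.
have mzt i : measurable_fun setT (zt i) by apply: measurable_funM => //; exact: mz.
have zti j : (j < n.+1)%N -> rv_indep P (fun w => \sum_(i < j) zt i w) (zt j).
  move=> jN; have ml : measurable_fun setT (fun y : R => t * y) by exact: measurable_funM.
  have := rv_indep_comp ml ml (zindep jN).
  congr rv_indep; apply/funext => w /=.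
  by rewrite mulr_sumr.
have := @cos_sum_bound _ _ _ P n.+1 zt (fun=> rho) th (fun i _ => mzt i) zti (fun _ _ => rho1).
rewrite prodr_const card_ord.
have -> : rho ^+ n.+1 = expR (- (v / 2)).
  rewrite /rho -expRM_natl; congr expR.
  rewrite mulrN; congr (- _); rewrite (_ : n.+1%:R * _ = t ^+ 2 * n.+1%:R * (v / 2)); last by ring.
  by rewrite tN mul1r.
have -> : (fun w => cos (th + \sum_(i < n.+1) zt i w)) = (fun w => cos (th + quad_sum w)).
  by apply/funext => w; rewrite quad_sumE mulr_sumr.
move=> /le_trans; apply.
have t1 : t <= 1.
  rewrite /t invf_le1// -[leLHS]sqrtr1 ler_sqrt// ler1n//.
apply: (@le_trans _ _ (\sum_(i < n.+1) (t ^+ 4 * (K + v ^+ 2) + t ^+ 3 * (1 + K)))).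
  apply: ler_sum => i _.
  have [i4 h4] := quad_form_moment4 sx Q (c i).
  have [h1 h2] := cos_sin_moment (mz i) v0 (ltW t0) i4 (quad_form_mean sx Q (@cinj i))
    (quad_form_variance sx Qsym (@cinj i)).2 h4.
  exact: lerD h1 h2.
rewrite sumr_const card_ord -[_ *+ n.+1]mulr_natl mulrDr.
have -> : n.+1%:R * (t ^+ 4 * (K + v ^+ 2)) = (t ^+ 2 * n.+1%:R) * t ^+ 2 * (K + v ^+ 2) by ring.
have -> : n.+1%:R * (t ^+ 3 * (1 + K)) = (t ^+ 2 * n.+1%:R) * t * (1 + K) by ring.
rewrite tN !mul1r -/t mulrDl -/t [X in _ <= X + _]mulrC [X in _ <= _ + X]mulrC lerD2r.
rewrite ler_wpM2r ?addr_ge0 ?sqr_ge0//.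
by rewrite expr2 ler_piMl// ltW.
Qed.

End quadratic_clt.

(** * Wiener increments *)

Lemma cvg_div_sqrt (R : realType) (C : R) : C / Num.sqrt n.+1%:R @[n --> \oo] --> 0.
Proof.
apply/cvgrPdist_le => e e0; near=> n.
have s0 : 0 < Num.sqrt (n.+1%:R : R) by rewrite sqrtr_gt0.
rewrite sub0r normrN normrM normfV (gtr0_norm s0) ler_pdivrMr// mulrC -ler_pdivrMr//.
have y0 : 0 <= `|C| / e by rewrite divr_ge0// ltW.
rewrite -(ger0_norm y0) -sqrtr_sqr ler_sqrt//.
apply: (@le_trans _ _ n%:R); last by rewrite ler_nat.
by near: n; exact: nbhs_infty_ger.
Unshelve. all: by end_near. Qed.

Section wiener_increments.
Context {R : realType} {d : measure_display} {Om : measurableType d}.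
Variables (P : probability Om R) (T : R).

Definition moment8_bound : R := 8`!%:R * (2 * expR (2^-1)).

Section one_process.
Variable Y : R -> Om -> R.
Hypothesis wY : wiener1 P T Y.

Lemma measurable_increment s t : 0 <= s <= T -> 0 <= t <= T ->
  measurable_fun setT (fun w => Y t w - Y s w).
Proof. by case: wY => mY _ _ _ _ sT tT; apply: measurable_funB; exact: mY. Qed.

Definition std_incr (s t : R) (w : Om) : R := (Num.sqrt (t - s))^-1 * (Y t w - Y s w).

Section standardized.
Variables s t : R.
Hypotheses (s0 : 0 <= s) (st : s < t) (tT : t <= T).

Let sT : 0 <= s <= T. Proof. by rewrite s0 (le_trans (ltW st)). Qed.
Let tT' : 0 <= t <= T. Proof. by rewrite tT (le_trans s0 (ltW st)). Qed.
Let m0 : measurable_fun setT (fun w => Y t w - Y s w).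
Proof. exact: measurable_increment. Qed.
Let sq0 : 0 < Num.sqrt (t - s). Proof. by rewrite sqrtr_gt0 subr_gt0. Qed.

Lemma increment_law A : measurable A ->
  P ((fun w => Y t w - Y s w) @^-1` A) = normal_prob 0 (Num.sqrt (t - s)) A.
Proof.
case: wY => _ _ _ _ lY mA.
by have := lY s t s0 st tT A mA; rewrite /gauss1 subr_eq0 gt_eqF.
Qed.

Lemma measurable_std_incr : measurable_fun setT (std_incr s t).
Proof. exact: measurable_funM. Qed.

Lemma integrable_std_incr k : P.-integrable setT (EFin \o (fun w => std_incr s t w ^+ k)).
Proof.
rewrite (_ : (fun w => _) = fun w => (Num.sqrt (t - s))^-1 ^+ k * (Y t w - Y s w) ^+ k).
  by apply: integrableZR; exact: normal_rv_integrable m0 increment_law sq0 k.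
by apply/funext => w; rewrite exprMn.
Qed.

Lemma std_incr_moments : [/\ \int[P]_w std_incr s t w = 0,
  \int[P]_w (std_incr s t w ^+ 2) = 1, \int[P]_w (std_incr s t w ^+ 4) = 3 &
  \int[P]_w (std_incr s t w ^+ 8) <= moment8_bound].
Proof.
have [e1 e2 e4] := normal_rv_moments m0 increment_law sq0.
have e8 := normal_rv_moment8 m0 increment_law sq0.
have iN := normal_rv_integrable m0 increment_law sq0.
have E k : \int[P]_w (std_incr s t w ^+ k) =
    (Num.sqrt (t - s))^-1 ^+ k * \int[P]_w ((Y t w - Y s w) ^+ k).
  rewrite -(RintegralZl _ measurableT (iN k)).
  by apply: eq_Rintegral => w _; rewrite exprMn.
split.
- by have := E 1%N; under eq_Rintegral do rewrite expr1; move=> ->;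
    under eq_Rintegral do rewrite expr1; rewrite e1 mulr0.
- by rewrite E e2 -exprMn mulVf ?gt_eqF// expr1n.
- by rewrite E e4 mulrCA -exprMn mulVf ?gt_eqF// expr1n mulr1.
- rewrite E; apply: (le_trans (ler_wpM2l _ e8)); first by rewrite exprn_ge0// invr_ge0 ltW.
  by rewrite mulrCA -exprMn mulVf ?gt_eqF// expr1n mulr1.
Qed.

End standardized.

Lemma increments_indep (m : nat) (t : nat -> R) : 0 <= t 0%N -> t m <= T ->
  (forall i, (i < m)%N -> t i <= t i.+1) ->
  family_indep P (fun (i : 'I_m) w => Y (t i.+1) w - Y (t i) w).
Proof.
case: wY => _ _ _ iY _ t0 tm ti A mA.
apply: (iY m t t0 tm ti) => i; apply: sub_sigma_algebra.
by exists tt => //; exists (A i) => //; rewrite setTI.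
Qed.

(** No oscillating integral is computed: the increment is cut into [n.+1] independent increments, to
    which the cosine estimate applies with an error [O(1 / sqrt n)]. The quantity estimated does not
    depend on [n], so the error is zero. *)
Lemma wiener_increment_cos (s t th a : R) : 0 <= s -> s < t -> t <= T ->
  \int[P]_w cos (th + a * (Y t w - Y s w)) = cos th * expR (- (a ^+ 2 * (t - s) / 2)).
Proof.
move=> s0 st tT; wlog a0 : th a / 0 <= a => [H|].
  have [/H//|/ltW a0] := leP 0 a.
  rewrite -[cos th]cosN -[a ^+ 2]sqrrN -H ?oppr_ge0//.
  by apply: eq_Rintegral => w _; rewrite -cosN opprD mulNr.
pose c := t - s; have c0 : 0 < c by rewrite subr_gt0.
(* The two 4s are [3 + 1 ^+ 2] and [1 + 3], from the fourth moment 3 and the variance 1 of a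
   standardized increment. *)
pose C := 4 * (a * Num.sqrt c) ^+ 4 + 4 * (a * Num.sqrt c) ^+ 3.
suff bd n : `|\int[P]_w cos (th + a * (Y t w - Y s w)) -
    cos th * expR (- (a ^+ 2 * (t - s) / 2))| <= C / Num.sqrt n.+1%:R.
  apply/eqP; rewrite -subr_eq0 -normr_le0.
  apply: (cvgr_to_ge (cvg_div_sqrt C)).
  by apply: nearW => n; exact: bd.
pose g (i : nat) := s + i%:R * (c / n.+1%:R).
have del0 : 0 < c / n.+1%:R by rewrite divr_gt0.
have gS i : g i.+1 - g i = c / n.+1%:R by rewrite /g -natr1; ring.
have gle i : g i <= g i.+1 by rewrite -subr_ge0 gS ltW.
have gN : g n.+1 = t by rewrite /g mulrC mulfVK// /c; ring.
have g0 : g 0%N = s by rewrite /g mul0r addr0.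
have gi0 i : 0 <= g i by rewrite addr_ge0// mulr_ge0// ltW.
have giT i : (i <= n.+1)%N -> g i <= T.
  by move=> iN; rewrite (le_trans _ tT)// -gN lerD2l ler_wpM2r ?ler_nat// ltW.
pose x (i : 'I_n.+1) w := Y (g i.+1) w - Y (g i) w.
have mx i : measurable_fun setT (x i).
  by apply: measurable_increment; rewrite gi0 giT// ltnW.
have ix : family_indep P x.
  by apply: increments_indep => //; exact: giT.
pose z i w := a * (Y (g i.+1) w - Y (g i) w).
have mz i : (i < n.+1)%N -> measurable_fun setT (z i).
  by move=> iN; apply: measurable_funM => //; apply: measurable_increment; rewrite gi0 giT// ltnW.
have zi j : (j < n.+1)%N -> rv_indep P (fun w => \sum_(i < j) z i w) (z j).
  apply: (@partial_sum_indep _ _ _ P _ x (fun i => nat_of_ord i)) => // i iN.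
  apply: measurable_funM => //.
  exact: (@family_mfun_coord _ _ _ _ [set k : 'I_n.+1 | nat_of_ord k = i] x (Ordinal iN)).
pose del := c / n.+1%:R.
pose b := a * Num.sqrt del.
have b0 : 0 <= b by rewrite mulr_ge0// sqrtr_ge0.
pose rho : R := expR (- (b ^+ 2 * 1 / 2)).
have rho1 : `|rho| <= 1.
  rewrite ger0_norm ?expR_ge0// -expR0 ler_expR oppr_le0.
  by apply: divr_ge0 => //; apply: mulr_ge0 => //; exact: sqr_ge0.
have := @cos_sum_bound _ _ _ P n.+1 z (fun=> rho) th mz zi (fun _ _ => rho1).
have -> : (fun w => cos (th + \sum_(i < n.+1) z i w)) =
    fun w => cos (th + a * (Y t w - Y s w)).
  apply/funext => w; congr (cos (_ + _)).
  rewrite /z -mulr_sumr -(big_mkord xpredT (fun i => Y (g i.+1) w - Y (g i) w)).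
  by rewrite telescope_sumr// gN g0.
rewrite prodr_const card_ord.
have b2 : b ^+ 2 * n.+1%:R = a ^+ 2 * c.
  rewrite exprMn sqr_sqrtr ?(ltW del0)// -mulrA; congr (_ * _).
  by rewrite mulfVK.
have -> : rho ^+ n.+1 = expR (- (a ^+ 2 * (t - s) / 2)).
  rewrite /rho -expRM_natl -/c -b2; congr expR; ring.
move=> /le_trans; apply.
apply: (@le_trans _ _ (\sum_(i < n.+1) (b ^+ 4 * (3 + 1 ^+ 2) + b ^+ 3 * (1 + 3)))).
  apply: ler_sum => i _.
  have gl : g i < g i.+1 by rewrite -subr_gt0 gS.
  have [e1 e2 e4 _] := std_incr_moments (gi0 i) gl (giT _ (ltn_ord i)).
  have i4 := integrable_std_incr (gi0 i) gl (giT _ (ltn_ord i)) 4.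
  have mS := measurable_std_incr (gi0 i) gl (giT _ (ltn_ord i)).
  have e4' : \int[P]_w (std_incr (g i) (g i.+1) w ^+ 4) <= 3 by rewrite e4.
  have [h1 h2] := cos_sin_moment mS ler01 b0 i4 e1 e2 e4'.
  have zE w : z i w = b * std_incr (g i) (g i.+1) w.
    rewrite /z /b /std_incr gS -/del mulrA mulfK//.
    by rewrite gt_eqF// sqrtr_gt0.
  have -> : (fun w => cos (z i w)) = (fun w => cos (b * std_incr (g i) (g i.+1) w)).
    by apply/funext => w; rewrite zE.
  have -> : (fun w => sin (z i w)) = (fun w => sin (b * std_incr (g i) (g i.+1) w)).
    by apply/funext => w; rewrite zE.
  exact: lerD h1 h2.
rewrite sumr_const card_ord -[_ *+ n.+1]mulr_natl expr1n.
have sn0 : 0 < Num.sqrt (n.+1%:R : R) by rewrite sqrtr_gt0.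
have bE : b = a * Num.sqrt c / Num.sqrt n.+1%:R.
  by rewrite /b /del sqrtrM ?(ltW c0)// sqrtrV// mulrA.
have nE : n.+1%:R = Num.sqrt (n.+1%:R : R) ^+ 2 by rewrite sqr_sqrtr.
have sn1 : 1 <= Num.sqrt (n.+1%:R : R) by rewrite -[leLHS]sqrtr1 ler_sqrt// ler1n.
have al0 : 0 <= a * Num.sqrt c by rewrite mulr_ge0 ?sqrtr_ge0.
rewrite {}bE {1}nE /C; move: (Num.sqrt n.+1%:R) (a * Num.sqrt c) sn0 sn1 al0 => S al S0 S1 al0.
rewrite [leLHS](_ : _ = (4 * al ^+ 4 / S + 4 * al ^+ 3) / S).
  rewrite ler_pM2r ?invr_gt0// lerD2r ler_pdivrMr// ler_peMr// mulr_ge0//.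
  exact: exprn_ge0.
by field; rewrite gt_eqF.
Qed.

End one_process.
End wiener_increments.

Section noise_family.
Context {R : realType} {d : measure_display} {Om : measurableType d}.
Variables (P : probability Om R) (T : R) (q : nat) (Nz : 'I_q -> R -> Om -> R).
Hypothesis T0 : 0 < T.
Hypothesis wNz : forall a, wiener1 P T (Nz a).
Hypothesis iNz : mutually_indep P (fun a => sigma_scalar T (Nz a)).

Definition grid_std_incr (n : nat) (ia : 'I_n.+1 * 'I_q) : Om -> R :=
  std_incr (Nz ia.2) (ia.1%:R * (T / n.+1%:R)) (ia.1.+1%:R * (T / n.+1%:R)).

Let g (n i : nat) : R := i%:R * (T / n%:R).

Let gle n i : (i < n)%N -> g n i < g n i.+1.
Proof.
case: n => // n _; by rewrite /g ltr_pM2r ?divr_gt0 ?ltr0n// ltr_nat.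
Qed.

Let g_ge0 n i : (i <= n)%N -> 0 <= g n i.
Proof. by move=> ni; case/andP: (grid_in T0 ni). Qed.
Let g_leT n i : (i <= n)%N -> g n i <= T.
Proof. by move=> ni; case/andP: (grid_in T0 ni). Qed.

(** Independence is needed jointly in time and across processes. The events of one process over all
    cells form a single event of that process, so the processes are separated first, and then the
    increments within each. *)
Lemma std_family_noise n : std_family P (@grid_std_incr n) moment8_bound.
Proof.
have H (i : 'I_n.+1) : [/\ 0 <= g n.+1 i, g n.+1 i < g n.+1 i.+1 & g n.+1 i.+1 <= T].
  by split; [apply/g_ge0/ltnW|exact: gle|exact: g_leT].
split => [[i a]|||[i a]].
- by have [h1 h2 h3] := H i; exact: (measurable_std_incr (wNz a)).
- pose x (ia : 'I_n.+1 * 'I_q) w := Nz ia.2 (g n.+1 ia.1.+1) w - Nz ia.2 (g n.+1 ia.1) w.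
  suff ix : family_indep P x.
    pose c (ia : 'I_n.+1 * 'I_q) (y : R) : R :=
      (Num.sqrt (g n.+1 ia.1.+1 - g n.+1 ia.1))^-1 * y.
    have mc ia : measurable_fun setT (c ia) by exact: measurable_funM.
    exact: (family_indep_comp mc ix).
  move=> A mA.
  pose E (a : 'I_q) := \bigcap_i (x (i, a) @^-1` A (i, a)).
  have sE a : sigma_scalar T (Nz a) (E a).
    rewrite /sigma_scalar /generated.
    have mx i : measurable_fun (setT : set (g_sigma_algebraType
        (family_sets `[0, T]%classic (Nz a)))) (x (i, a)).
      apply: measurable_funB; apply: family_mfun_coord; rewrite /= in_itv /=;
        by rewrite g_ge0 ?g_leT// ltnW.
    apply: (@fin_bigcap_measurable _ (g_sigma_algebraType
        (family_sets `[0, T]%classic (Nz a)))) => // i _.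
    by rewrite -[X in measurable X]setTI; apply: mx.
  have -> : \bigcap_ia (x ia @^-1` A ia) = \bigcap_a E a.
    apply/seteqP; split => w /=; first by move=> h a _ i _; exact: h.
    by move=> h [i a] _; exact: (h a).
  rewrite (iNz sE) (eq_bigr (fun ia => P (x (ia.1, ia.2) @^-1` A (ia.1, ia.2)))); last by case.
  rewrite -(pair_bigA _ (fun i a => P (x (i, a) @^-1` A (i, a)))) /= exchange_big /=.
  apply: eq_bigr => a _.
  have t0 : 0 <= g n.+1 0 by exact: g_ge0.
  have tm : g n.+1 n.+1 <= T by exact: g_leT.
  by apply: (increments_indep (wNz a) t0 tm (fun i iN => ltW (gle iN)) (fun i => mA (i, a))).
- by move=> [i a]; have [h1 h2 h3] := H i; exact: (integrable_std_incr (wNz a)).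
- by have [h1 h2 h3] := H i; exact: (std_incr_moments (wNz a)).
Qed.

End noise_family.

Section joint_noise.
Context {R : realType} {d : measure_display} {Om : measurableType d}.
Variables (P : probability Om R) (T : R) (r p : nat).
Variables (W : R -> Om -> 'cV[R]_r) (Bm : 'I_p -> R -> Om -> R).

Definition joint_noise (a : 'I_(r + p)) (t : R) (w : Om) : R :=
  match fintype.split a with inl j => W t w j 0 | inr i => Bm i t w end.

Lemma joint_noise_lshift j t w : joint_noise (lshift p j) t w = W t w j 0.
Proof. by rewrite /joint_noise (unsplitK (inl j)). Qed.

Lemma joint_noise_rshift i t w : joint_noise (rshift r i) t w = Bm i t w.
Proof. by rewrite /joint_noise (unsplitK (inr i)). Qed.

Lemma joint_noise_wiener : wiener P T W -> (forall i, wiener1 P T (Bm i)) ->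
  forall a, wiener1 P T (joint_noise a).
Proof.
move=> [wW _] wB a; rewrite -[a]fintype.splitK; case: (fintype.split a) => [j|i] /=.
  by have := wW j; congr wiener1; apply/funext => t; apply/funext => w;
    rewrite joint_noise_lshift.
by have := wB i; congr wiener1; apply/funext => t; apply/funext => w;
  rewrite joint_noise_rshift.
Qed.

(** Two levels: the block [W] against the processes [Bm], then the coordinates of [W] among
    themselves. [None] stands for the block; the intersection of the events of its coordinates
    belongs to its sigma-algebra. *)
Lemma joint_noise_indep : wiener P T W -> noises_indep P T W Bm ->
  mutually_indep P (fun a => sigma_scalar T (joint_noise a)).
Proof.
move=> [_ iW] iWB E sE.
have lE j : joint_noise (lshift p j) = fun t w => W t w j 0.
  by apply/funext => t; apply/funext => w; rewrite joint_noise_lshift.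
have rE i : joint_noise (rshift r i) = Bm i.
  by apply/funext => t; apply/funext => w; rewrite joint_noise_rshift.
pose F (o : option 'I_p) : set Om :=
  if o is Some i then E (rshift r i) else \bigcap_j E (lshift p j).
have -> : \bigcap_a E a = \bigcap_o F o.
  apply/seteqP; split => w /=; first by move=> h [i|] _ /=; [exact: h|move=> j _; exact: h].
  move=> h a _; rewrite -[a]fintype.splitK; case: (fintype.split a) => [j|i] /=; first exact: (h None).
  exact: (h (Some i)).
have sl j : sigma_scalar T (fun t w => W t w j 0) (E (lshift p j)) by rewrite -lE.
rewrite iWB; last first.
  case=> [i|] /=; first by rewrite -rE.
  rewrite /sigma_vector /generated.
  apply: (@fin_bigcap_measurable _ (g_sigma_algebraType
    (\bigcup_(ti in [set ti : R * 'I_r | 0 <= ti.1 <= T])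
      preimage_set_system setT (fun w => W ti.1 w ti.2 0) measurable))) => // j _.
  apply: sub_sigma_algebra2 (sl j) => A [t tT tA].
  by exists (t, j) => //=; move: tT; rewrite /= in_itv.
rewrite big_split_ord /= -(iW _ sl) (bigD1 None)//=; congr (_ * _)%E.
rewrite (reindex_omap Some id)/=; last by case.
by apply: eq_bigl => i; rewrite eqxx.
Qed.

End joint_noise.

(** * Laws determined by their cosines *)

Section law_uniqueness.
Context {R : realType}.

Lemma exceed_small (q : nat) d (Om : measurableType d) (P : probability Om R)
    (Y : Om -> 'cV[R]_q) (e : R) : mvec Y -> 0 < e ->
  exists2 L : R, 0 < L & fine (P (exceed L Y)) <= e.
Proof.
move=> mY e0.
have mE n : measurable (exceed n.+1%:R Y) by exact: measurable_exceed.
have : P (exceed n.+1%:R Y) @[n --> \oo] --> P (\bigcap_n exceed n.+1%:R Y).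
  apply: nonincreasing_cvg_mu => //.
  - by rewrite (le_lt_trans (probability_le1 _ _))// ltry.
  - exact: bigcapT_measurable.
  - apply/nonincreasing_seqP => n; apply/subsetPset => w [c nc]; exists c.
    by rewrite (le_lt_trans _ nc)// ler_nat.
have -> : \bigcap_n exceed n.+1%:R Y = set0.
  apply/seteqP; split => // w h.
  pose L := \sum_c `|Y w c 0|.
  have L0 : 0 <= L by rewrite sumr_ge0.
  have [c] := h (Num.trunc L) Logic.I.
  rewrite ltNge => /negP; apply.
  apply: (@le_trans _ _ L); first by rewrite /L (bigD1 c)//= lerDl sumr_ge0.
  by rewrite ltW// truncnS_gt.
rewrite measure0 => /fine_cvg /cvgrPdist_le /(_ _ e0) [N _ HN].
exists N.+1%:R => //.
have := HN N (leqnn N); rewrite /= sub0r normrN.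
by rewrite ger0_norm ?fine_ge0.
Qed.

(** Equals [1 - 1 / (1 + 2 n (x - a)^+)]: continuous, with values in [0, 1], and tending pointwise
    to the indicator of the open ray beyond [a]. *)
Definition ramp (a : R) (n : nat) (x : R) : R := 1 - (1 + n%:R * ((x - a) + `|x - a|))^-1.

Lemma ramp_den (a : R) n (x : R) : 1 <= 1 + n%:R * ((x - a) + `|x - a|).
Proof. rewrite lerDl mulr_ge0//.
by have := lerNnormlW (lexx `|x - a|); rewrite -subr_ge0 opprK addrC. Qed.

Lemma ramp_bound (a : R) n x : `|ramp a n x| <= 1.
Proof.
have h := ramp_den a n x.
have h0 : 0 < 1 + n%:R * ((x - a) + `|x - a|) by rewrite (lt_le_trans ltr01).
rewrite ger0_norm /ramp ?subr_ge0 ?invf_le1//.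
by rewrite gerBl invr_ge0 ltW.
Qed.

Lemma continuous_ramp a n : continuous (ramp a n).
Proof.
move=> x; apply: cvgB; first exact: cvg_cst.
apply: cvgV; first by rewrite gt_eqF// (lt_le_trans ltr01 (ramp_den a n x)).
apply: cvgD; first exact: cvg_cst.
apply: cvgM; first exact: cvg_cst.
have h : (fun y : R => y - a) @ x --> x - a by apply: cvgB; [exact: cvg_id|exact: cvg_cst].
by apply: cvgD => //; exact: cvg_norm.
Qed.

Lemma ramp_cvg a x : ramp a n x @[n --> \oo] --> (\1_(`]a, +oo[%classic) x : R).
Proof.
have [xa|ax] := leP x a.
  rewrite (_ : \1_ _ x = 0); last first.
    by rewrite indicE memNset//= in_itv/= andbT; apply/negP; rewrite -leNgt.
  rewrite (_ : (fun n => ramp a n x) = fun=> 0); first exact: cvg_cst.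
  apply/funext => n; rewrite /ramp ler0_norm ?subr_le0//.
  by rewrite subrr mulr0 addr0 invr1 subrr.
rewrite (_ : \1_ _ x = 1); last by rewrite indicE mem_set//= in_itv/= andbT.
pose z := (x - a) + `|x - a|.
have z0 : 0 < z by rewrite /z ltr_wpDr// subr_gt0.
apply/cvgrPdist_le => e e0; near=> n.
have h1 : 1 <= 1 + n%:R * z by exact: ramp_den.
have h0 : 0 < 1 + n%:R * z by rewrite (lt_le_trans ltr01).
rewrite /ramp -/z opprB addrCA subrr addr0 ger0_norm ?invr_ge0 ?(ltW h0)//.
rewrite -[leRHS]invrK lef_pV2 ?posrE ?invr_gt0//.
apply: (@le_trans _ _ (n%:R * z)); last by rewrite lerDr.
rewrite -ler_pdivrMr//.
by near: n; exact: nbhs_infty_ger.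
Unshelve. all: by end_near. Qed.

Lemma expectation_ramp_cvg d (Om : measurableType d) (P : probability Om R)
    (X : Om -> R) (a : R) : measurable_fun setT X ->
  \int[P]_w ramp a n (X w) @[n --> \oo] --> fine (P (X @^-1` `]a, +oo[)).
Proof.
move=> mX.
have mr n : measurable_fun setT (fun w => ramp a n (X w)).
  apply: (@measurableT_comp _ _ _ _ _ _ (ramp a n)) => //.
  exact: continuous_measurable_fun (@continuous_ramp a n).
have mA : measurable (X @^-1` `]a, +oo[) by rewrite -[X in measurable X]setTI; exact: mX.
have -> : fine (P (X @^-1` `]a, +oo[)) = \int[P]_w \1_(`]a, +oo[%classic) (X w).
  rewrite /Rintegral (_ : (fun w => _) = (fun w => (\1_(X @^-1` `]a, +oo[) w)%:E)).
    by rewrite integral_indic// setIT.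
  by apply/funext => w.
apply: fine_cvg.
have ind : P.-integrable setT (EFin \o (fun w => \1_(`]a, +oo[%classic) (X w))).
  apply: (@bounded_integrable _ _ _ _ _ 1) => [|w].
    rewrite (_ : (fun w => _) = \1_(X @^-1` `]a, +oo[)); first exact: measurable_indic.
  by apply/funext => w.
  by rewrite indicE; case: (_ \in _); rewrite ?normr1 ?normr0.
rewrite [X in _ --> X]fineK; last exact: (integrable_fin_num _ ind).
have := @dominated_convergence _ Om R P setT measurableT
  (fun n => EFin \o (fun w => ramp a n (X w)))
  (EFin \o (fun w => \1_(`]a, +oo[%classic) (X w))) (fun=> 1%E).
case => //.
- by move=> n; apply/measurable_EFinP.
- by case/integrableP : ind.
- by apply: aeW => w _ /=; apply/fine_cvgP; split; [exact: nearW|exact: ramp_cvg].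
- exact: (cst_integrable P 1).
- by apply: aeW => w n _ /=; rewrite lee_fin ramp_bound.
Qed.

(** Applied to constant sequences, [cvg_expectation_cont] says that expectations of bounded
    continuous functions agree; ramps then give equality on the rays []a, +oo[], a pi-system
    generating the Borel sets. *)
Lemma cos_law_unique d d' (Om : measurableType d) (Om' : measurableType d')
    (P : probability Om R) (P' : probability Om' R) (X : Om -> R) (Z : Om' -> R) :
  measurable_fun setT X -> measurable_fun setT Z ->
  (forall th a, \int[P]_w cos (th + a * X w) = \int[P']_w cos (th + a * Z w)) ->
  forall A, measurable A -> P (X @^-1` A) = P' (Z @^-1` A).
Proof.
move=> mX mZ XZ.
have mcX : mvec (fun w => const_mx (X w) : 'cV[R]_1).
  by move=> c; under eq_fun do rewrite mxE.
have mcZ : mvec (fun w => const_mx (Z w) : 'cV[R]_1).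
  by move=> c; under eq_fun do rewrite mxE.
have E g : continuous g -> (forall x, `|g x| <= 1) ->
    \int[P]_w g (X w) = \int[P']_w g (Z w).
  move=> cg g1.
  have := @cvg_expectation_cont R 1 _ _ Om Om' P P'
    (fun _ w => const_mx (X w)) (fun w => const_mx (Z w)) (fun=> mcX) mcZ.
  move=> /(_ _ _ (fun x => g (x 0 0)) 1).
  have h (Om1 : Type) (Y : Om1 -> R) : (fun w => g ((const_mx (Y w) : 'cV[R]_1) 0 0)) =
      (fun w => g (Y w)).
    by apply/funext => w; rewrite mxE.
  rewrite !h => H.
  suff : \int[P]_w g (X w) @[n --> \oo] --> \int[P']_w g (Z w).
    by move/cvg_lim => <- //; rewrite lim_cst.
  apply: H => //.
  - move=> th u.
    have h' (Om1 : Type) (Y : Om1 -> R) : (fun w => cos (th + dotc u (const_mx (Y w)))) =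
        (fun w => cos (th + u 0 0 * Y w)).
      by apply/funext => w; rewrite /dotc big_ord1 mxE.
    by rewrite !h' XZ; exact: cvg_cst.
  - move=> e e0.
    have [L1 L10 H1] := exceed_small P mcX e0; have [L2 L20 H2] := exceed_small P' mcZ e0.
    exists (Num.max L1 L2); first by rewrite lt_max L10.
    split; last by apply: le_trans H2; apply: exceed_mono => //; rewrite le_max lexx orbT.
    by apply: nearW => n; apply: le_trans H1; apply: exceed_mono => //; rewrite le_max lexx.
  - move=> x; apply: (@continuous_comp _ _ _ (fun x : 'cV[R]_1 => x 0 0) g).
      exact: coord_continuous.
    exact: cg.
have ray a : P (X @^-1` `]a, +oo[) = P' (Z @^-1` `]a, +oo[).
  have h1 := @expectation_ramp_cvg _ _ P _ a mX; have h2 := @expectation_ramp_cvg _ _ P' _ a mZ.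
  have mA : measurable (X @^-1` `]a, +oo[) by rewrite -[X in measurable X]setTI; exact: mX.
  have mA' : measurable (Z @^-1` `]a, +oo[) by rewrite -[X in measurable X]setTI; exact: mZ.
  rewrite -[LHS]fineK ?fin_num_measure// -[RHS]fineK ?fin_num_measure//; congr EFin.
  rewrite -(cvg_lim (@Rhausdorff R) h1) -(cvg_lim (@Rhausdorff R) h2).
  have -> // : (fun n => \int[P]_w ramp a n (X w)) = (fun n => \int[P']_w ramp a n (Z w)).
  by apply/funext => n; apply: E; [exact: continuous_ramp|exact: ramp_bound].
move=> A mA.
pose X' : {RV P >-> R} := HB.pack X (isMeasurableFun.Build _ _ _ _ _ mX).
pose Z' : {RV P' >-> R} := HB.pack Z (isMeasurableFun.Build _ _ _ _ _ mZ).
(* The whole line joins the rays, since uniqueness of measures asks for a covering by members of the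
   pi-system. *)
pose G := @RGenOInfty.G R `|` [set setT].
have GE : G.-sigma.-measurable A.
  have : (@RGenOInfty.G R).-sigma.-measurable A by rewrite -RGenOInfty.measurableE.
  by apply: sub_sigma_algebra2 => B GB; left.
have Gm : G `<=` @measurable _ R by move=> B [[x ->]|->] //; exact: measurable_itv.
have GI : setI_closed G.
  move=> B C [[x ->]|->] [[y ->]|->]; rewrite ?setTI ?setIT; [|by left; eexists..|by right].
  left; exists (Num.max x y); apply/seteqP; split => z /=; rewrite !in_itv/= !andbT gt_max.
    by case=> -> ->.
  by case/andP.
have GT (n : nat) : G setT by right.
have Gc : \bigcup_(n : nat) (setT : set R) = setT by apply: bigcup_const; exists 0%N.
have lawG B : G B -> distribution P X' B = distribution P' Z' B.
  case=> [[x ->]|->]; first exact: ray.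
  by rewrite /distribution /pushforward !preimage_setT !probability_setT.
have fin (n : nat) : (distribution P X' setT < +oo)%E.
  by rewrite (le_lt_trans (probability_le1 _ _))// ltry.
exact: (g_sigma_algebra_measure_unique G Gm (fun=> setT) GT Gc _ _ GI lawG fin A GE).
Qed.

End law_uniqueness.

Section normal_law.
Context {R : realType} {d : measure_display} {Om : measurableType d}.
Variables (P : probability Om R) (T : R) (Y : R -> Om -> R).
Hypotheses (T0 : 0 < T) (wY : wiener1 P T Y).

(* [1 + cos] is nonnegative, so that the change of variables needs no
   integrability. *)
Lemma normal_cos (s th a : R) : 0 < s ->
  (\int[normal_prob 0 s]_x (1 + cos (th + a * x))%:E =
   (1 + cos th * expR (- (a ^+ 2 * s ^+ 2 / 2)))%:E)%E.
Proof.
move=> s0.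
have cG b : continuous (fun x : R => 1 + cos (th + b * x)).
  move=> x; apply: cvgD; first exact: cvg_cst.
  apply: continuous_comp; last exact: continuous_cos.
  by apply: cvgD; [exact: cvg_cst|apply: cvgM; [exact: cvg_cst|exact: cvg_id]].
have G0 b (x : R) : 0 <= 1 + cos (th + b * x).
  by rewrite -lerBlDl sub0r cos_geN1.
have sT0 : 0 < Num.sqrt T by rewrite sqrtr_gt0.
have m0 : measurable_fun setT (fun w => Y T w - Y 0 w).
  by apply: (measurable_increment wY); rewrite lexx ltW.
have law0 A : measurable A -> P ((fun w => Y T w - Y 0 w) @^-1` A) =
    normal_prob 0 (Num.sqrt T) A.
  by move=> mA; rewrite -[in RHS](subr0 T); exact: (increment_law wY).
(* [Y T - Y 0] has deviation [Num.sqrt T], so [b] times it has the law of [a] times a centred normal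
   variable of deviation [s]; its cosine is known from [wiener_increment_cos]. *)
pose b := a * s / Num.sqrt T.
have mG : measurable_fun setT (fun x : R => (1 + cos (th + b * x))%:E).
  by apply/measurable_EFinP; apply: continuous_measurable_fun; exact: cG.
have := ge0_integral_normal_rv m0 law0 mG (fun x => G0 b x).
rewrite (normal_scale sT0 (cG b) (G0 b)) (normal_scale s0 (cG a) (G0 a)).
have -> : (fun x => (1 + cos (th + b * (Num.sqrt T * x)))%:E) =
    (fun x => (1 + cos (th + a * (s * x)))%:E).
  apply/funext => x; congr (1 + cos (th + _))%:E.
  by rewrite /b; field; rewrite gt_eqF.
move=> <-.
have ic : P.-integrable setT (EFin \o (fun w => cos (th + b * (Y T w - Y 0 w)))).
  by apply: integrable_cos; apply: measurable_funD => //; exact: measurable_funM.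
rewrite EFin_Rintegral; last by apply: integrableDR => //; exact: cst_integrable.
rewrite RintegralD//; last exact: cst_integrable.
rewrite Rintegral_prob_cst (wiener_increment_cos wY)// subr0.
congr (1 + _ * expR (- (_ / 2)))%:E.
by rewrite /b !exprMn exprVn sqr_sqrtr ?(ltW T0)// mulfVK// gt_eqF.
Qed.

Lemma gauss1_of_cos d' (Om' : measurableType d') (P' : probability Om' R) (X : Om' -> R)
    (v : R) : measurable_fun setT X -> 0 <= v ->
  (forall th a, \int[P']_w cos (th + a * X w) = cos th * expR (- (a ^+ 2 * v / 2))) ->
  forall A, measurable A -> P' (X @^-1` A) = gauss1 0 v A.
Proof.
move=> mX; rewrite le_eqVlt => /predU1P[<-|v0] cX A mA; rewrite /gauss1.
  rewrite eqxx (@cos_law_unique R _ _ _ _ P' P' X (fun=> 0) mX)//.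
    rewrite preimage_cst diracE; case: ifP => _; first exact: probability_setT.
    exact: measure0.
  move=> th a; rewrite cX mulr0 mul0r oppr0 expR0 mulr1.
  by rewrite mulr0 addr0 Rintegral_prob_cst.
rewrite gt_eqF//; set s := Num.sqrt v; have s0 : 0 < s by rewrite sqrtr_gt0.
pose N : probability (measurableTypeR R) R := normal_prob 0 s.
apply: (@cos_law_unique R _ _ Om' (measurableTypeR R) P' N X id mX) => //.
move=> th a; rewrite cX.
have ml : measurable_fun [set: R] (fun x : R => th + a * x).
  by apply: measurable_funD => //; exact: measurable_funM.
have E : (\int[N]_x (1 + cos (th + a * x))%:E =
   (1 + cos th * expR (- (a ^+ 2 * s ^+ 2 / 2)))%:E)%E by exact: normal_cos.
have ic : N.-integrable setT (EFin \o (fun x : measurableTypeR R => cos (th + a * x))).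
  exact: (@integrable_cos _ _ _ N (fun x : measurableTypeR R => th + a * x)).
move: E; rewrite EFin_Rintegral; last by apply: integrableDR => //; exact: cst_integrable.
rewrite RintegralD//; last exact: cst_integrable.
rewrite Rintegral_prob_cst => -[] /addrI ->.
by rewrite sqr_sqrtr// ltW.
Qed.

End normal_law.

(** * Gaussian vectors *)

Section borel_vectors.
Context {R : realType} {q : nat}.

(** Countably many boxes suffice: rational centre and radius [1 / n.+1]. The condition that the box
    lie in [U] is placed in the set itself, so that the index set does not depend on [U]. *)
Lemma open_cV_boxes (U : set 'cV[R]_q) : open U ->
  U = \bigcup_(cn in [set: 'cV[rat]_q * nat]) [set y | (forall i, `|ratr (cn.1 i 0) - y i 0| < cn.2.+1%:R^-1) /\
    (forall z : 'cV[R]_q, (forall i, `|ratr (cn.1 i 0) - z i 0| < cn.2.+1%:R^-1) -> U z)].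
Proof.
move=> oU; apply/seteqP; split => x; last by case=> cn _ [xc]; exact.
move=> Ux; have /nbhs_ballP[e /= e0 xeU] : nbhs x U by exact: open_nbhs_nbhs.
pose n := Num.trunc (2 / e).
have n0 : 0 < n.+1%:R^-1 :> R by rewrite invr_gt0.
have ne : 2 * n.+1%:R^-1 < e.
  by rewrite ltr_pdivrMr// mulrC -ltr_pdivrMr// truncnS_gt.
have H i : exists c : rat, `|ratr c - x i 0| < n.+1%:R^-1.
  have [c] : exists c : rat, ratr c \in `]x i 0 - n.+1%:R^-1, x i 0 + n.+1%:R^-1[.
    by apply: rat_in_itvoo; rewrite ltrBlDr -addrA ltrDl addr_gt0.
  by rewrite in_itv /= -ltr_distl => h; exists c.
have [c cP] := choice H.
exists (\col_i c i, n) => //; split => /= [i|z zc]; first by rewrite mxE.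
apply: xeU; split => // i j; rewrite [j]ord1 /ball /=.
apply: (@le_lt_trans _ _ (`|ratr (c i) - x i 0| + `|ratr (c i) - z i 0|)).
  by rewrite distrC [`|ratr _ - x _ _|]distrC;
    have := ler_distD (ratr (c i)) (x i 0) (z i 0); rewrite [`|z _ _ - _|]distrC.
rewrite (lt_trans _ ne)// mulr_natl mulr2n ltrD//.
by have := zc i; rewrite mxE.
Qed.

Lemma measurable_borel_cV d (Om : measurableType d) (Y : Om -> 'cV[R]_q) :
  mvec Y -> measurable_fun setT (Y : Om -> borel_cV R q).
Proof.
move=> mY; apply: (@measurability _ _ Om (borel_cV R q) setT Y (@open 'cV[R]_q)) => //.
move=> _ [U oU <-]; rewrite setTI (open_cV_boxes oU) preimage_bigcup.
apply: countable_bigcupT_measurable => // -[c n].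
have [h|h] := pselect (forall z : 'cV[R]_q,
  (forall i, `|ratr (c i 0) - z i 0| < n.+1%:R^-1) -> U z); last first.
  rewrite (_ : _ @^-1` _ = set0)//.
  by apply/seteqP; split => // w /= [_ h'].
rewrite (_ : _ @^-1` _ = \bigcap_(i in [set: 'I_q])
    [set w | `|ratr (c i 0) - Y w i 0| < n.+1%:R^-1]); last first.
  by apply/seteqP; split => w /=; [case=> h' _ i _; exact: h'|move=> h'; split => // i; exact: h'].
apply: fin_bigcap_measurable => // i _.
have mi : measurable_fun setT (fun w => `|ratr (c i 0) - Y w i 0|).
  by apply: measurableT_comp => //; exact: measurable_funB.
rewrite (_ : [set w | _] = (fun w => `|ratr (c i 0) - Y w i 0|) @^-1` `]-oo, n.+1%:R^-1[).
  by rewrite -[X in measurable X]setTI; exact: mi.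
by apply/seteqP; split => w /=; rewrite in_itv.
Qed.

Lemma continuous_borel_cV (g : 'cV[R]_q -> R) : continuous g ->
  measurable_fun setT (g : borel_cV R q -> R).
Proof.
move=> cg; apply: (@measurability _ _ (borel_cV R q) R setT g (@RGenOInfty.G R)); first exact: RGenOInfty.measurableE.
move=> _ [_ [a ->] <-]; rewrite setTI; apply: sub_sigma_algebra.
by move/continuousP: cg; apply; exact: interval_open.
Qed.

End borel_vectors.

Section gaussian_vector.
Context {R : realType} {d : measure_display} {Om : measurableType d}.
Variables (P : probability Om R) (q : nat) (x : 'I_q -> Om -> R).
Hypotheses (mx : forall i, measurable_fun setT (x i)) (ix : family_indep P x).
Hypothesis cosx : forall i th a, \int[P]_w cos (th + a * x i w) = cos th * expR (- (a ^+ 2 / 2)).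

(** Here the right side of [cos_sum_bound] is zero: each cosine expectation equals its comparison
    factor, and each sine expectation, being that of the cosine with phase [- (pi / 2)],
    vanishes. *)
Lemma linear_comb_cos (c : 'I_q -> R) (th : R) :
  \int[P]_w cos (th + \sum_j c j * x j w) = cos th * expR (- ((\sum_j c j ^+ 2) / 2)).
Proof.
pose z (i : nat) w := \sum_(j < q | nat_of_ord j == i) c j * x j w.
have zE (j : 'I_q) w : z j w = c j * x j w.
  by rewrite /z (big_pred1 j).
pose rho (i : nat) : R := if insub i is Some j then expR (- (c j ^+ 2 / 2)) else 1.
have rhoE (j : 'I_q) : rho j = expR (- (c j ^+ 2 / 2)) by rewrite /rho valK.
have rho1 i : (i < q)%N -> `|rho i| <= 1.
  move=> iq; rewrite -[i]/(nat_of_ord (Ordinal iq)) rhoE ger0_norm ?expR_ge0//.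
  by rewrite -expR0 ler_expR oppr_le0 divr_ge0// sqr_ge0.
have mz i : (i < q)%N -> measurable_fun setT (z i).
  move=> iq; rewrite (_ : z i = fun w => c (Ordinal iq) * x (Ordinal iq) w).
    exact: measurable_funM.
  by apply/funext => w; rewrite -[i]/(nat_of_ord (Ordinal iq)) zE.
have zi j : (j < q)%N -> rv_indep P (fun w => \sum_(i < j) z i w) (z j).
  apply: (@partial_sum_indep _ _ _ P _ x (fun i => nat_of_ord i)) => // i iq.
  rewrite (_ : z i = fun w => c (Ordinal iq) * x (Ordinal iq) w); last first.
    by apply/funext => w; rewrite -[i]/(nat_of_ord (Ordinal iq)) zE.
  apply: measurable_funM => //.
  exact: (@family_mfun_coord _ _ _ _ [set k : 'I_q | nat_of_ord k = i] x (Ordinal iq)).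
have := @cos_sum_bound _ _ _ P q z rho th mz zi rho1.
rewrite [X in _ <= X -> _]big1 => [|j _].
  have -> : (fun w => cos (th + \sum_(i < q) z i w)) = (fun w => cos (th + \sum_j c j * x j w)).
    by apply/funext => w; congr (cos (_ + _)); apply: eq_bigr => j _; rewrite zE.
  rewrite normr_le0 subr_eq0 => /eqP ->; congr (_ * _).
  rewrite (eq_bigr (fun j => expR (- (c j ^+ 2 / 2)))) => [|j _]; last exact: rhoE.
  by rewrite -expR_sum sumrN -mulr_suml.
have -> : \int[P]_w cos (z j w) = rho j.
  rewrite rhoE; have := cosx j 0 (c j); rewrite cos0 mul1r => <-.
  by apply: eq_Rintegral => w _; rewrite zE add0r.
have -> : \int[P]_w sin (z j w) = 0.
  have := cosx j (- (pi / 2)) (c j); rewrite cosN cos_pihalf mul0r => <-.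
  apply: eq_Rintegral => w _.
  by rewrite zE addrC cosBpihalf.
by rewrite subrr normr0 addr0.
Qed.

Variables (m : nat) (L : 'M[R]_(m, q)).

Definition gaussian_vec (w : Om) : 'cV[R]_m := L *m \col_i x i w.

Lemma mvec_gaussian_vec : mvec gaussian_vec.
Proof.
move=> c; rewrite (_ : (fun w => _) = fun w => \sum_j L c j * x j w).
  by apply: measurable_sum => j; exact: measurable_funM.
by apply/funext => w; rewrite mxE; apply: eq_bigr => j _; rewrite mxE.
Qed.

Lemma dotc_gaussian_vec u w : dotc u (gaussian_vec w) = \sum_j (u^T *m L) 0 j * x j w.
Proof.
transitivity ((u^T *m gaussian_vec w) 0 0).
  by rewrite [RHS]mxE; apply: eq_bigr => c _; rewrite [u^T _ _]mxE.
by rewrite /gaussian_vec mulmxA mxE; apply: eq_bigr => j _; rewrite [X in _ * X = _]mxE.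
Qed.

Lemma quad_norm (u : 'cV[R]_m) : (u^T *m (L *m L^T) *m u) 0 0 = \sum_j ((u^T *m L) 0 j) ^+ 2.
Proof.
have -> : u^T *m (L *m L^T) *m u = (u^T *m L) *m (u^T *m L)^T.
  by rewrite trmx_mul trmxK !mulmxA.
by rewrite mxE; apply: eq_bigr => j _; rewrite [X in _ * X = _]mxE expr2.
Qed.

Lemma gaussian_vec_cos u th : \int[P]_w cos (th + dotc u (gaussian_vec w)) =
  cos th * expR (- ((u^T *m (L *m L^T) *m u) 0 0 / 2)).
Proof.
rewrite quad_norm -linear_comb_cos.
by apply: eq_Rintegral => w _; rewrite dotc_gaussian_vec.
Qed.

End gaussian_vector.

Section normal_existence.
Context {R : realType} {d : measure_display} {Om : measurableType d}.
Variables (P : probability Om R) (T : R) (Y : R -> Om -> R).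
Hypotheses (T0 : 0 < T) (wY : wiener1 P T Y).

Lemma std_incr_cos s t th a : 0 <= s -> s < t -> t <= T ->
  \int[P]_w cos (th + a * std_incr Y s t w) = cos th * expR (- (a ^+ 2 / 2)).
Proof.
move=> s0 st tT; have st0 : 0 < t - s by rewrite subr_gt0.
have := wiener_increment_cos wY th (a / Num.sqrt (t - s)) s0 st tT.
rewrite expr_div_n sqr_sqrtr ?(ltW st0)// divfK ?gt_eqF// => <-.
by apply: eq_Rintegral => w _; rewrite /std_incr mulrA.
Qed.

(** [q] successive standardized increments of one Wiener process are independent standard normal
    variables, and [L] maps them to the wanted vector. The vector [G] is exported with its law
    because [cvg_expectation_cont] takes its limit as a random vector. *)
Lemma normal_law_exists (m q : nat) (L : 'M[R]_(m, q)) :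
  exists2 mu : probability (borel_cV R m) R, is_normal_law 0 (L *m L^T) mu &
  exists G : Om -> 'cV[R]_m, [/\ mvec G,
    forall g M, continuous g -> (forall x, `|g x| <= M) ->
      (\int[mu]_x (g x)%:E = (\int[P]_w g (G w))%:E)%E &
    forall u th, \int[P]_w cos (th + dotc u (G w)) =
      cos th * expR (- ((u^T *m (L *m L^T) *m u) 0 0 / 2))].
Proof.
pose t (i : nat) := i%:R * (T / q%:R).
have tin i : (i <= q)%N -> 0 <= t i <= T by exact: grid_in.
have tlt i : (i < q)%N -> t i < t i.+1.
  by move=> iq; rewrite ltr_pM2r ?ltr_nat// divr_gt0// ltr0n (leq_trans _ iq).
have H (i : 'I_q) : [/\ 0 <= t i, t i < t i.+1 & t i.+1 <= T].
  split; last by case/andP: (tin i.+1 (ltn_ord i)).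
    by case/andP: (tin i (ltnW (ltn_ord i))).
  exact: tlt.
pose x (i : 'I_q) := std_incr Y (t i) (t i.+1).
have mx i : measurable_fun setT (x i) by have [h1 h2 h3] := H i; exact: (measurable_std_incr wY).
have cosx i th a : \int[P]_w cos (th + a * x i w) = cos th * expR (- (a ^+ 2 / 2)).
  by have [h1 h2 h3] := H i; exact: std_incr_cos.
have ix : family_indep P x.
  have t0 : 0 <= t 0%N by case/andP: (tin 0%N (leq0n q)).
  have tm : t q <= T by case/andP: (tin q (leqnn q)).
  have := increments_indep wY t0 tm (fun i iq => ltW (tlt i iq)).
  pose c (i : 'I_q) (y : R) : R := (Num.sqrt (t i.+1 - t i))^-1 * y.
  have mc i : measurable_fun setT (c i) by exact: measurable_funM.
  exact: (family_indep_comp mc).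
pose G := gaussian_vec x L.
have mG : mvec G by exact: mvec_gaussian_vec.
have cosG := gaussian_vec_cos mx ix cosx L.
have mG' : measurable_fun setT (G : Om -> borel_cV R m) by exact: measurable_borel_cV.
pose G' : {RV P >-> borel_cV R m} :=
  HB.pack (G : Om -> borel_cV R m) (isMeasurableFun.Build _ _ _ _ _ mG').
exists (distribution P G'); last exists G.
- move=> u A mA; rewrite mulmx0 mxE.
  have dE (v : 'cV[R]_m) : (u^T *m v) 0 0 = dotc u v.
    by rewrite mxE; apply: eq_bigr => c _; rewrite [u^T _ _]mxE.
  have v0 : 0 <= (u^T *m (L *m L^T) *m u) 0 0.
    by rewrite quad_norm sumr_ge0// => j _; exact: sqr_ge0.
  rewrite -(@gauss1_of_cos _ _ _ P T Y T0 wY _ _ P (fun w => dotc u (G w)) _ _ v0 _ A mA).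
  + rewrite /distribution /pushforward /=; congr (P _); apply/seteqP; split => w /=;
    by rewrite dE.
  + exact: measurable_dotc.
  + move=> th a.
    transitivity (\int[P]_w cos (th + dotc (a *: u) (G w))).
      apply: eq_Rintegral => w _; congr (cos (_ + _)).
      by rewrite /dotc mulr_sumr; apply: eq_bigr => c _; rewrite [(a *: u) c 0]mxE mulrA.
    rewrite cosG; congr (_ * expR (- (_ / 2))).
    have -> : (a *: u)^T = a *: u^T by apply/matrixP => i j; rewrite !mxE.
    by rewrite -scalemxAr -scalemxAl -scalemxAl scalerA mxE expr2.
- split => // g M cg gM.
  have mg : measurable_fun setT (g : borel_cV R m -> R) by exact: continuous_borel_cV.
  have ig : P.-integrable setT (EFin \o (fun w => g (G w))).
    by apply: (@bounded_integrable _ _ _ _ _ M) => //; exact: measurable_cont_vec cg gM.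
  rewrite -EFin_Rintegral//.
  have mgE : measurable_fun setT (fun x : borel_cV R m => (g x)%:E) by exact/measurable_EFinP.
  exact: (@integral_distribution _ _ _ _ _ P G' _ mgE ig).
Qed.

End normal_existence.

(** * Half-vectorization *)

Lemma sum_mxtens (R : nmodType) (m n : nat) (F : 'I_m * 'I_n -> R) :
  \sum_(u < m * n) F (mxtens_unindex u) = \sum_j \sum_i F (j, i).
Proof.
rewrite pair_bigA /= [RHS](reindex (@mxtens_unindex m n)) /=; last first.
  by exists (@mxtens_index m n) => u _; rewrite (mxtens_indexK, mxtens_unindexK).
by apply: eq_bigr => u _.
Qed.

Section duplication.
Context {R : realType} {p : nat}.
Local Notation D := (duplication_mx R p).
Local Notation Dp := (duplication_pinv R p).

Lemma vech_pos_inj : injective (@vech_pos p).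
Proof. by move=> s t /enum_val_inj /cast_ord_inj. Qed.

Lemma vech_pos_surj (i j : 'I_p) : (j <= i)%N -> exists s, vech_pos s = (j, i).
Proof.
move=> ji; have inj : (j, i) \in @lower_tri p by [].
exists (cast_ord (card_lower_tri p) (enum_rank_in inj (j, i))).
by rewrite /vech_pos cast_ordK enum_rankK_in.
Qed.

(** The rows of [D] at lower triangular positions form an identity matrix. Hence [D] is injective,
    and its Gram matrix is invertible. *)
Lemma duplication_vech_pos s t : D (mxtens_index (vech_pos s)) t = (s == t)%:R.
Proof.
rewrite !mxE mxtens_indexK /= -surjective_pairing (inj_eq vech_pos_inj).
have [//|st] := eqVneq s t; rewrite /= (_ : (_ == _) = false)//.
apply/negP => /eqP E.
have ps : ((vech_pos s).1 <= (vech_pos s).2)%N by have : vech_pos s \in @lower_tri p by exact: enum_valP.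
have : vech_pos t \in @lower_tri p by exact: enum_valP.
rewrite -E inE /= => pt.
have e12 : (vech_pos s).1 = (vech_pos s).2 by apply/val_inj/eqP; rewrite eqn_leq ps pt.
move/eqP: st; apply; apply: vech_pos_inj.
by rewrite -E [LHS]surjective_pairing e12.
Qed.

Lemma duplication_sym u v s : mxtens_unindex u = ((mxtens_unindex v).2, (mxtens_unindex v).1) ->
  D u s = D v s.
Proof. by rewrite !mxE => -> /=; rewrite orbC; case: (mxtens_unindex v). Qed.

Lemma duplication_free (v : 'rV[R]_(pbar p)) : v *m D^T = 0 -> v = 0.
Proof.
move=> vD; apply/rowP => s.
have := congr1 (fun A : 'rV[R]_(p * p) => A 0 (mxtens_index (vech_pos s))) vD.
move=> E; transitivity ((v *m D^T) 0 (mxtens_index (vech_pos s))); last by rewrite E !mxE.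
rewrite [RHS]mxE (bigD1 s)//= big1 ?addr0 => [|t ts].
  by rewrite [D^T _ _]mxE duplication_vech_pos eqxx mulr1.
by rewrite [D^T _ _]mxE duplication_vech_pos eq_sym (negbTE ts) mulr0.
Qed.

Lemma duplication_gram_unit : D^T *m D \in unitmx.
Proof.
rewrite -row_free_unit; apply: inj_row_free => v vDD; apply: duplication_free.
have : (v *m D^T) *m (v *m D^T)^T = 0 by rewrite trmx_mul trmxK mulmxA -(mulmxA v) vDD mul0mx.
move/matrixP/(_ 0 0); rewrite !mxE => /eqP; rewrite psumr_eq0 => [|j _]; last first.
  by rewrite [X in _ * X]mxE -expr2 sqr_ge0.
move=> /allP h; apply/rowP => j; have := h j (mem_index_enum j).
by rewrite [X in _ * X]mxE -expr2 sqrf_eq0 => /eqP ->; rewrite mxE.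
Qed.

Lemma duplication_pinvK : Dp *m D = 1%:M.
Proof. by rewrite /duplication_pinv -mulmxA mulVmx// duplication_gram_unit. Qed.

(** Turns [u^T vech] into the entrywise pairing with a full symmetric matrix, on which congruence by
    [G] acts simply. *)
Definition dual_mx (u : 'cV[R]_(pbar p)) : 'M[R]_p :=
  \matrix_(i, j) (Dp^T *m u) (mxtens_index (j, i)) 0.

Lemma dual_mx_sym u i j : dual_mx u i j = dual_mx u j i.
Proof.
rewrite !mxE /duplication_pinv; set M := invmx _.
apply: eq_bigr => s _; congr (_ * _).
rewrite !mxE; apply: eq_bigr => t _; congr (_ * _).
rewrite [LHS]mxE [RHS]mxE.
by apply: duplication_sym; rewrite !mxtens_indexK.
Qed.

(** The pseudo-inverse is a left inverse of [D], so [vech A] is its value at [vec A]; transposition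
    moves it onto [u]. *)
Lemma dotc_vech u (A : 'M[R]_p) : A^T = A ->
  dotc u (vech A) = \sum_i \sum_j dual_mx u i j * A i j.
Proof.
move=> sA.
have -> : vech A = Dp *m vec A by rewrite vec_duplication// mulmxA duplication_pinvK mul1mx.
transitivity (\sum_c (Dp^T *m u) c 0 * vec A c 0).
  transitivity ((u^T *m (Dp *m vec A)) 0 0).
    by rewrite [RHS]mxE; apply: eq_bigr => c _; rewrite [u^T _ _]mxE.
  rewrite mulmxA -[u^T *m Dp]trmxK trmx_mul trmxK mxE.
  by apply: eq_bigr => c _; rewrite [(_ *m _)^T _ _]mxE.
rewrite exchange_big /= -(sum_mxtens (fun ji => dual_mx u ji.2 ji.1 * A ji.2 ji.1)).
apply: eq_bigr => c _; rewrite [vec A _ _]mxE [dual_mx _ _ _]mxE.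
by rewrite -surjective_pairing mxtens_unindexK.
Qed.

End duplication.

Section covariance_factor.
Context {R : realType} {p q : nat}.
Variables (G : 'M[R]_(p, q)).
Let Sigma := G *m G^T.

(** A rectangular square root of the limit covariance, by multiplicativity of the Kronecker product.
    Its [q * q] columns count the standard variables from which the limit vector is built. *)
Definition cov_factor : 'M[R]_(pbar p, q * q) :=
  Num.sqrt 2 *: (duplication_pinv R p *m (G *t G)).

Lemma cov_factorE : cov_factor *m cov_factor^T = asymptotic_cov Sigma.
Proof.
rewrite /cov_factor /asymptotic_cov linearZ /= -scalemxAl -scalemxAr scalerA -expr2 sqr_sqrtr//.
by rewrite trmx_mul !mulmxA -tensmx_mul trmx_tens !mulmxA.
Qed.

(** Here the variance of the quadratic forms meets the covariance of the statement: up to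
    [Num.sqrt 2], the row [u^T *m cov_factor] lists the entries of [G^T *m dual_mx u *m G], so its
    squared norm is their sum of squares doubled. *)
Lemma asymptotic_cov_quad u :
  (u^T *m asymptotic_cov Sigma *m u) 0 0 = quad_var (fun e f => (G^T *m dual_mx u *m G) e f).
Proof.
rewrite -cov_factorE quad_norm /quad_var.
have E (c : 'I_(q * q)) : (u^T *m cov_factor) 0 c =
    Num.sqrt 2 * (G^T *m dual_mx u *m G) (mxtens_unindex c).2 (mxtens_unindex c).1.
  rewrite /cov_factor -scalemxAr mxE; congr (_ * _).
  case: (mxtens_unindex c) (mxtens_unindexK c) => f e /= <-.
  rewrite mulmxA -[u^T *m _]trmxK trmx_mul trmxK mxE.
  rewrite [RHS]mxE; under [RHS]eq_bigr do rewrite mxE mulr_suml.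
  rewrite -(sum_mxtens (fun ji => G^T e ji.2 * dual_mx u ji.2 ji.1 * G ji.1 f)).
  apply: eq_bigr => c' _; rewrite [(_ *m _)^T _ _]mxE [dual_mx _ _ _]mxE.
  rewrite -surjective_pairing mxtens_unindexK [G^T _ _]mxE.
  rewrite -{2}(mxtens_unindexK c'); case: (mxtens_unindex c') => j i /=.
  by rewrite tensmxE; ring.
under eq_bigr do rewrite E exprMn sqr_sqrtr//.
rewrite -mulr_sumr; congr (_ * _).
rewrite (sum_mxtens (fun fe => (G^T *m dual_mx u *m G) fe.2 fe.1 ^+ 2)).
by rewrite exchange_big.
Qed.

End covariance_factor.

(** * The drift *)

Section drift.
Context {R : realType}.
Variable T : R.
Notation mu := (@lebesgue_measure R).

Lemma segment_unif_cont (a : R -> R) (e : R) : {within `[0, T], continuous a} -> 0 < e ->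
  exists2 dl : R, 0 < dl & forall s u, 0 <= s <= T -> 0 <= u <= T ->
    `|u - s| <= dl -> `|a u - a s| <= e.
Proof.
move=> /subspace_continuousP ca e0.
have := @segment_compact R 0 T => /compact_near_coveringP/near_covering_withinP cK.
pose Q (dl : R) (s : R) := forall u, 0 <= u <= T -> `|u - s| <= dl -> `|a u - a s| <= e.
have : \forall dl \near 0^'+, `[0, T]%classic `<=` Q dl.
  apply: (cK R (0^'+) Q) => s Ks.
  have /cvgrPdist_lt /(_ (e / 2)) := ca s Ks.
  rewrite divr_gt0// => /(_ isT) /nbhs_ballP[r /= r0 br].
  exists (ball s (r / 2), [set dl : R | dl < r / 2]) => /=.
    split; first by apply: nbhsx_ballx; rewrite divr_gt0.
    by apply: nbhs_right_lt; rewrite divr_gt0.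
  move=> [s' dl] [/= ss' dlr] s'T u uT us'.
  have r2 : r / 2 < r by rewrite ltr_pdivrMr// ltr_pMr// ltr1n.
  have h1 : `|a s - a s'| < e / 2.
    by apply: br => //; apply: le_ball ss'; exact: ltW.
  have h2 : `|a s - a u| < e / 2.
    apply: br; rewrite /= ?in_itv//= /ball /=; move: ss'; rewrite /ball /= => ss'.
    rewrite (_ : s - u = (s - s') - (u - s')); last by ring.
    by rewrite (le_lt_trans (ler_normB _ _))//; move: ss' us' dlr; lra.
  rewrite (_ : a u - a s' = (a s - a s') - (a s - a u)); last by ring.
  by rewrite (le_trans (ler_normB _ _))//; move: h1 h2; lra.
move=> H; have [dl [/= dl0 Hdl]] : exists dl : R, 0 < dl /\ `[0, T]%classic `<=` Q dl.
  near (0 : R)^'+ => dl; exists dl; split; first by near: dl; exact: nbhs_right_gt.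
  by near: dl.
by exists dl => // s u sT uT us; apply: (Hdl s) => //=.
Unshelve. all: by end_near. Qed.

(** For [t <= t'] the error is the integral of [a u - a s] over []t, t']], all of whose points are
    within [dl] of [s]; uniform continuity of [a] bounds the integrand by [e]. *)
Lemma drift_udiff (a D : R -> R) : {within `[0, T], continuous a} ->
  (forall t, 0 <= t <= T -> D t = \int[mu]_(s in `[0, t]) a s) -> udiff T D.
Proof.
move=> ca DE; have [T0|T0] := leP 0 T; last first.
  exists (fun=> 0), 0; split => [s|e e0]; first by rewrite normr0.
  by exists 1 => // s t t' /andP[s0 sT]; move: (le_trans s0 sT); rewrite leNgt T0.
exists a.
have [dl1 dl10 _] := segment_unif_cont ca ltr01.
have cabs : {within `[0, T], continuous (fun s => `|a s|)}.
  by move=> s; apply: cvg_norm; exact: ca.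
have [c cT cmax] := EVT_max T0 cabs.
exists `|a c|; split => [s sT|e e0]; first by apply: cmax; rewrite in_itv.
have [dl dl0 Hdl] := segment_unif_cont ca e0.
exists dl => // s t t' sT.
have int0T : mu.-integrable `[0, T] (EFin \o a).
  by apply: continuous_compact_integrable => //; exact: segment_compact.
wlog tt' : t t' / t <= t' => [H|] tT t'T ts t's.
  have [/H|/ltW t't] := leP t t'; first exact.
  rewrite -normrN [`|t' - t|]distrC.
  rewrite (_ : - (D t' - D t - a s * (t' - t)) = D t - D t' - a s * (t - t')); last by ring.
  exact: H.
have /andP[t0 tleT] := tT; have /andP[t'0 t'leT] := t'T.
have i0t' : mu.-integrable `[0, t'] (EFin \o a).
  by apply: integrableS int0T => //; apply: subset_itvl; rewrite bnd_simp.
have itt' : mu.-integrable `]t, t'] (EFin \o a).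
  by apply: integrableS i0t' => //; apply: subset_itvr; rewrite bnd_simp.
have ic (y : R) : mu.-integrable `]t, t'] (EFin \o (fun=> y)).
  apply: (@integrableS _ _ _ mu `[t, t']) => //; first exact: subset_itv_oc_cc.
  apply: continuous_compact_integrable; first exact: segment_compact.
  by move=> z; exact: cvg_cst.
have cE (y : R) : \int[mu]_(_ in `]t, t']) y = y * (t' - t).
  rewrite Rintegral_cst//= lebesgue_measure_itv /= lte_fin.
  by move: tt'; rewrite le_eqVlt => /predU1P[->|->] //; rewrite ltxx subrr.
rewrite !DE// Rintegral_itvB ?bnd_simp// -cE -RintegralB//.
have tt0 : 0 <= t' - t by rewrite subr_ge0.
rewrite (ger0_norm tt0) -cE.
have iB : mu.-integrable `]t, t'] (EFin \o (fun u => a u - a s)).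
  have mI : measurable (`]t, t']%classic : set (measurableTypeR R)) by exact: measurable_itv.
  by have := integrableB mI itt' (ic (a s)).
apply: (le_trans (le_normr_Rintegral _ iB)) => //.
apply: le_Rintegral => //; first exact: integrable_norm.
move=> u /=; rewrite in_itv /= => /andP[tu ut'].
apply: Hdl => //; first by rewrite (le_trans ut') ?(le_trans t0 (ltW tu)).
move: ts t's; rewrite !ler_norml; lra.
Qed.

End drift.

(** * The realized covariance *)

Section vanishing.
Context {R : realType}.
Implicit Types (V F : nat -> R).

(** For one path, [F] tends to 0 along those [n] with [V n <= K]. The variation of the noise along
    the grids is controlled in mean only, not path by path uniformly in [n], hence the
    restriction. *)
Definition vanishing_on V (K : R) F : Prop := forall e : R, 0 < e ->
  \forall n \near \oo, V n <= K -> `|F n| <= e.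

Lemma vanishing_onD V K F F' : vanishing_on V K F -> vanishing_on V K F' ->
  vanishing_on V K (fun n => F n + F' n).
Proof.
move=> vF vF' e e0; have e2 : 0 < e / 2 by rewrite divr_gt0.
near=> n => VK; rewrite (splitr e) (le_trans (ler_normD _ _))// lerD//.
  by move: VK; near: n; exact: vF.
by move: VK; near: n; exact: vF'.
Unshelve. all: by end_near. Qed.

Lemma vanishing_onZ V K c F : vanishing_on V K F -> vanishing_on V K (fun n => c * F n).
Proof.
move=> vF e e0; have c0 : 0 < `|c| + 1 by rewrite ltr_wpDl.
near=> n => VK; rewrite normrM.
apply: (@le_trans _ _ ((`|c| + 1) * (e / (`|c| + 1)))); last by rewrite mulrC divfK// gt_eqF.
rewrite ler_pM// ?lerDl//.
by move: VK; near: n; apply: vF; rewrite divr_gt0.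
Unshelve. all: by end_near. Qed.

Lemma vanishing_on0 V K : vanishing_on V K (fun=> 0).
Proof. by move=> e e0; apply: nearW => n _; rewrite normr0 ltW. Qed.

Lemma vanishing_on_sum V K (I : Type) (s : seq I) (F : I -> nat -> R) :
  (forall i, vanishing_on V K (F i)) -> vanishing_on V K (fun n => \sum_(i <- s) F i n).
Proof.
move=> vF; elim: s => [|i s IH].
  by under eq_fun do rewrite big_nil; exact: vanishing_on0.
by under eq_fun do rewrite big_cons; exact: vanishing_onD.
Qed.

Lemma vanishing_on_norm V K F : vanishing_on V K F -> vanishing_on V K (fun n => `|F n|).
Proof.
by move=> vF e e0; near do rewrite normr_id; exact: vF.
Unshelve. all: by end_near. Qed.

Lemma eq_vanishing_on V K F F' : F =1 F' -> vanishing_on V K F -> vanishing_on V K F'.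
Proof. by move=> /funext ->. Qed.

End vanishing.

(** * From paths to probabilities *)

Section probability_bounds.
Context {R : realType} {d : measure_display} {Om : measurableType d}.
Variable P : probability Om R.

Lemma fine_probU (A B : set Om) : measurable A -> measurable B ->
  fine (P (A `|` B)) <= fine (P A) + fine (P B).
Proof.
move=> mA mB; rewrite -fineD ?fin_num_measure// fine_le ?fin_num_measure ?measurableU//.
- exact: measurableU.
- by rewrite fin_numD !fin_num_measure.
- exact: measureU2.
Qed.

Lemma fine_prob_indic (A : set Om) : measurable A -> fine (P A) = \int[P]_w \1_A w.
Proof. by move=> mA; rewrite /Rintegral integral_indic// setIT. Qed.

Lemma markov_prob (U : Om -> R) (K : R) : measurable_fun setT U -> (forall w, 0 <= U w) ->
  P.-integrable setT (EFin \o U) -> 0 < K ->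
  fine (P [set w | K < U w]) <= (\int[P]_w U w) / K.
Proof.
move=> mU U0 iU K0; have mA := measurable_gt K mU.
rewrite fine_prob_indic// ler_pdivlMr// mulrC -RintegralZl//; last exact: integrable_indic.
apply: le_Rintegral => //; first by apply: integrableZR; exact: integrable_indic.
move=> w _; rewrite indicE; case: (boolP (w \in _)) => [|_]; rewrite ?mulr0 ?mulr1//.
by rewrite inE /= => /ltW.
Qed.

(** Markov's inequality makes [K < V n] unlikely, uniformly in [n]. On the complement the indicator
    of a large [F n] tends to 0 almost surely, and dominated convergence makes its mean tend to
    0. *)
Lemma vanishing_prob (F V : nat -> Om -> R) (C : R) :
  (forall n, measurable_fun setT (F n)) -> (forall n, measurable_fun setT (V n)) ->
  (forall n w, 0 <= V n w) ->
  (forall n, P.-integrable setT (EFin \o V n) /\ \int[P]_w V n w <= C) ->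
  {ae P, forall w, forall K, vanishing_on (V^~ w) K (F^~ w)} ->
  forall e del : R, 0 < e -> 0 < del ->
    \forall n \near \oo, fine (P [set w | e < `|F n w|]) <= del.
Proof.
move=> mF mV V0 iV vF e del e0 del0.
have C0 : 0 <= C.
  by have [_] := iV 0%N; apply: le_trans; apply: Rintegral_ge0 => w _.
pose K := (2 * C + 1) / del.
have K0 : 0 < K by rewrite divr_gt0// ltr_wpDl// mulr_ge0.
have mnF n : measurable_fun setT (fun w => `|F n w|) by exact: measurableT_comp.
pose A n : set Om := [set w | e < `|F n w|] `\` [set w | K < V n w].
have mA n : measurable (A n) by apply: measurableD; exact: measurable_gt.
have A0 : \int[P]_w \1_(A n) w @[n --> \oo] --> (0 : R).
  have := @dominated_convergence _ Om R P setT measurableT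
    (fun n w => (\1_(A n) w)%:E) (fun=> 0%E) (fun=> 1%E).
  case => //.
  - by move=> n; apply/measurable_EFinP; exact: measurable_indic.
  - move: vF => [N [mN PN HN]]; exists N; split => // w /= nw; apply: HN => h.
    apply: nw => _; apply: cvg_near_cst.
    near=> n; rewrite indicE memNset// /A /= => -[eF /negP]; rewrite -leNgt => VK.
    move: eF; rewrite ltNge => /negP; apply.
    by move: VK; near: n; exact: (h K).
  - exact: (cst_integrable P 1).
  - apply: aeW => w n _ /=; rewrite indicE.
    by case: (_ \in _); rewrite /= ?normr1 ?normr0.
  - move=> _ _; rewrite integral0 => /fine_cvg /=.
    by apply: cvg_trans.
have /cvgrPdist_le /(_ (del / 2)) := A0; rewrite divr_gt0// => /(_ isT) A0'.
near=> n.
have h1 : fine (P (A n)) <= del / 2.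
  rewrite fine_prob_indic//.
  have : `|0 - \int[P]_w \1_(A n) w| <= del / 2 by near: n.
  by rewrite sub0r normrN; apply: le_trans; exact: ler_norm.
have h2 : fine (P [set w | K < V n w]) <= del / 2.
  have [iVn Cn] := iV n.
  rewrite (le_trans (markov_prob (mV n) (V0 n) iVn K0))// ler_pdivrMr//.
  rewrite (le_trans Cn)// /K [leRHS](_ : _ = C + 2^-1); first by rewrite lerDl.
  by field; rewrite gt_eqF.
rewrite (splitr del); apply: le_trans (lerD h1 h2).
apply: le_trans (fine_probU (mA n) (measurable_gt K (mV n))).
apply: le_fine_prob; [exact: measurable_gt|apply: measurableU => //; exact: measurable_gt|].
by move=> w /= eF; have [KV|KV] := pselect (K < V n w); [right|left].
Unshelve. all: by end_near. Qed.

Lemma cos_dist (a b e : R) : 0 <= e <= 1 -> `|a - b| <= e -> `|cos a - cos b| <= 2 * e.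
Proof.
move=> /andP[e0 e1] ab; set dl := a - b; have -> : a = b + dl by rewrite /dl; ring.
rewrite cosD (_ : _ - _ - _ = cos b * (cos dl - 1) - sin b * sin dl); last by ring.
rewrite (le_trans (ler_normB _ _))// !normrM mulr_natl mulr2n lerD//.
  rewrite (@le_trans _ _ `|cos dl - 1|)//; first by rewrite ler_piMl// cos_max.
  rewrite distrC ger0_norm ?subr_ge0 ?cos_le1//.
  have := cos_ge dl; have : dl ^+ 2 <= e ^+ 2 by rewrite -(real_normK (num_real dl)) ler_sqr ?nnegrE.
  nra.
rewrite (@le_trans _ _ `|sin dl|)//; first by rewrite ler_piMl// sin_max.
rewrite (le_trans _ ab)// -ler_sqr ?nnegrE// !real_normK ?num_real//.
exact: sqr_sin_le.
Qed.

(** Off an event of small probability the cosines are close by [cos_dist]; on it they differ by at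
    most 2. This is Slutsky's theorem at the level of cosines. *)
Lemma cos_slutsky (F F' : nat -> Om -> R) (th l : R) :
  (forall n, measurable_fun setT (F n)) -> (forall n, measurable_fun setT (F' n)) ->
  (forall e del : R, 0 < e -> 0 < del ->
    \forall n \near \oo, fine (P [set w | e < `|F' n w - F n w|]) <= del) ->
  \int[P]_w cos (th + F n w) @[n --> \oo] --> l ->
  \int[P]_w cos (th + F' n w) @[n --> \oo] --> l.
Proof.
move=> mF mF' small cF.
suff h : \int[P]_w cos (th + F' n w) - \int[P]_w cos (th + F n w) @[n --> \oo] --> (0 : R).
  rewrite (_ : (fun n => _) = (fun n => (\int[P]_w cos (th + F' n w) -
    \int[P]_w cos (th + F n w)) + \int[P]_w cos (th + F n w))).
    by rewrite -[l]add0r; exact: cvgD.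
  by apply/funext => n; rewrite subrK.
apply/cvgrPdist_le => e e0.
pose e1 := Num.min 1 (e / 4).
have e10 : 0 < e1 by rewrite lt_min ltr01 divr_gt0.
have e11 : 0 <= e1 <= 1 by rewrite ltW//= ge_min lexx.
have e1e : e1 <= e / 4 by rewrite ge_min lexx orbT.
near=> n; rewrite sub0r normrN.
have PA : fine (P [set w | e1 < `|F' n w - F n w|]) <= e / 4.
  by near: n; apply: small => //; rewrite divr_gt0.
set A := [set w | e1 < `|F' n w - F n w|] in PA *.
have mA : measurable A.
  apply: measurable_gt; apply: measurableT_comp => //; exact: measurable_funB.
have m1 : measurable_fun setT (fun w => th + F n w) by exact: measurable_funD.
have m2 : measurable_fun setT (fun w => th + F' n w) by exact: measurable_funD.
have i1 := integrable_cos P m1; have i2 := integrable_cos P m2.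
rewrite -RintegralB//.
have iB : P.-integrable setT (EFin \o (fun w => cos (th + F' n w) - cos (th + F n w))).
  by have := integrableB measurableT i2 i1.
have iA : P.-integrable setT (EFin \o \1_A) by exact: integrable_indic.
have iE : P.-integrable setT (EFin \o (fun w => 2 * e1 + 2 * \1_A w)).
  by apply: integrableDR; [exact: cst_integrable|exact: integrableZR].
rewrite (le_trans (le_normr_Rintegral _ iB))//.
apply: (@le_trans _ _ (\int[P]_w (2 * e1 + 2 * \1_A w))); last first.
  rewrite RintegralD//; [|exact: cst_integrable|exact: integrableZR].
  rewrite Rintegral_prob_cst RintegralZl// -fine_prob_indic//.
  move: PA e1e; lra.
apply: le_Rintegral => //; first exact: integrable_norm.
move=> w _; rewrite indicE; case: (boolP (w \in A)) => [_|].
  rewrite mulr1 (@le_trans _ _ 2)//; last by rewrite lerDr mulr_ge0// ltW.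
  rewrite (le_trans (ler_normB _ _))//.
  by have := cos_max (th + F' n w); have := cos_max (th + F n w); lra.
rewrite notin_setE /A /= => /negP; rewrite -leNgt mulr0 addr0 => h.
apply: cos_dist => //; rewrite (_ : _ - _ = F' n w - F n w)//; ring.
Unshelve. all: by end_near. Qed.

End probability_bounds.

(** * Algebra of the realized covariance *)

Section realized_covariance_algebra.
Context {R : realType} {d : measure_display} {Om : measurableType d}.
Variables (T : R) (p : nat).

Lemma realized_cov_entry (X : R -> Om -> 'cV[R]_p) n w i j :
  realized_cov T X n w i j =
  T^-1 * \sum_(l < n) incr T n (fun t => X t w i 0) l * incr T n (fun t => X t w j 0) l.
Proof.
rewrite /realized_cov mxE summxE; congr (_ * _); apply: eq_bigr => l _.
by rewrite !mxE big_ord1 !mxE.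
Qed.

Lemma realized_cov_sym (X : R -> Om -> 'cV[R]_p) n w :
  (realized_cov T X n w)^T = realized_cov T X n w.
Proof.
apply/matrixP => i j; rewrite mxE !realized_cov_entry; congr (_ * _).
by apply: eq_bigr => l _; rewrite mulrC.
Qed.

Variables (q : nat) (G : 'M[R]_(p, q)).

Lemma sum_congruence (N : 'M[R]_p) (M : 'M[R]_q) :
  \sum_i \sum_j N i j * (G *m M *m G^T) i j =
  \sum_e \sum_f (G^T *m N *m G) e f * M e f.
Proof.
have tr m (A B : 'M[R]_m) : \sum_i \sum_j A i j * B i j = \tr (A^T *m B).
  rewrite exchange_big; apply: eq_bigr => j _ /=; rewrite mxE.
  by apply: eq_bigr => i _; rewrite mxE.
by rewrite !tr !trmx_mul trmxK !mulmxA mxtrace_mulC !mulmxA.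
Qed.

Definition cov_error (X : R -> Om -> 'cV[R]_p) (n : nat) (w : Om) : 'cV[R]_(pbar p) :=
  Num.sqrt n%:R *: (vech (realized_cov T X n w) - vech (G *m G^T)).

Lemma cov_error_coord X n w c : cov_error X n w c 0 = Num.sqrt n%:R *
  (realized_cov T X n w - G *m G^T) (vech_pos c).2 (vech_pos c).1.
Proof. by rewrite !mxE. Qed.

Lemma dotc_cov_error X n w u : dotc u (cov_error X n w) = Num.sqrt n%:R *
  \sum_i \sum_j dual_mx u i j * (realized_cov T X n w - G *m G^T) i j.
Proof.
rewrite -dotc_vech; last by rewrite linearB /= realized_cov_sym trmx_mul trmxK.
rewrite /dotc mulr_sumr; apply: eq_bigr => c _; rewrite cov_error_coord [vech _ _ _]mxE.
by rewrite mulrCA.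
Qed.

Variables (Nz : 'I_q -> R -> Om -> R).
Hypothesis T0 : 0 < T.

Definition mixed_noise (t : R) (w : Om) : 'cV[R]_p := G *m \col_a Nz a t w.

Lemma incr_std n (a : 'I_q) (i : 'I_n.+1) w : incr T n.+1 (fun t => Nz a t w) i =
  Num.sqrt (T / n.+1%:R) * grid_std_incr T Nz (i, a) w.
Proof.
have h0 : 0 < T / n.+1%:R by rewrite divr_gt0.
rewrite /grid_std_incr /std_incr /= grid_step// mulVKf//.
by rewrite gt_eqF// sqrtr_gt0.
Qed.

(** Since [h / T = 1 / n.+1], the realized covariance of the noise minus its limit is [G M G^T],
    with [M] the mean over the cells of [y y^T - 1]. Moving [G] onto [dual_mx u] leaves quadratic
    forms in standard variables, and [sqrt n / n] gives their normalization. *)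
Lemma dotc_cov_error_noise u n w : dotc u (cov_error mixed_noise n.+1 w) =
  quad_sum (grid_std_incr T Nz (n := n)) (fun e f => (G^T *m dual_mx u *m G) e f) w.
Proof.
pose h := T / n.+1%:R; have h0 : 0 < h by rewrite divr_gt0.
pose y (i : 'I_n.+1) a := grid_std_incr T Nz (i, a) w.
pose v (i : 'I_n.+1) : 'cV[R]_q := \col_a (Num.sqrt h * y i a).
pose M := T^-1 *: (\sum_i v i *m (v i)^T) - 1%:M.
have -> : dotc u (cov_error mixed_noise n.+1 w) = Num.sqrt n.+1%:R *
    \sum_i \sum_j dual_mx u i j * (G *m M *m G^T) i j.
  rewrite dotc_cov_error; congr (_ * _); apply: eq_bigr => i _; apply: eq_bigr => j _.
  congr (_ * _); congr (fun A : 'M[R]_p => A i j).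
  rewrite /M mulmxBr mulmx1 mulmxBl; congr (_ - _).
  rewrite /realized_cov -scalemxAr -scalemxAl; congr (_ *: _).
  rewrite mulmx_sumr mulmx_suml; apply: eq_bigr => l _.
  have -> : mixed_noise (l.+1%:R * (T / n.+1%:R)) w - mixed_noise (l%:R * (T / n.+1%:R)) w =
      G *m v l.
    rewrite /mixed_noise -mulmxBr; congr (_ *m _); apply/colP => a; rewrite !mxE.
    by rewrite -incr_std.
  by rewrite trmx_mul !mulmxA.
rewrite sum_congruence /quad_sum.
set Q := G^T *m _ *m _.
have ME e f : M e f = n.+1%:R^-1 * \sum_i (y i e * y i f - (e == f)%:R).
  rewrite /M !mxE summxE sumrB sumr_const card_ord mulrBr.
  congr (_ - _); last by rewrite -[(e == f)%:R *+ n.+1]mulr_natl mulKf.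
  rewrite (eq_bigr (fun i => h * (y i e * y i f))) => [|i _]; last first.
    rewrite !mxE big_ord1 !mxE mulrACA -expr2 sqr_sqrtr ?ltW//.
  rewrite -mulr_sumr mulrA; congr (_ * _).
  by rewrite /h mulrA mulVf ?mul1r// gt_eqF.
have sn : Num.sqrt n.+1%:R * n.+1%:R^-1 = (Num.sqrt n.+1%:R)^-1 :> R.
  have s0 : Num.sqrt n.+1%:R != 0 :> R by rewrite gt_eqF// sqrtr_gt0.
  rewrite -[X in _ * X^-1](@sqr_sqrtr R n.+1%:R)// expr2 invfM mulrA mulfV// mul1r.
  exact: erefl.
rewrite -sn -mulrA; congr (_ * _).
rewrite [RHS]mulr_sumr.
rewrite (eq_bigr (fun e => \sum_f \sum_i n.+1%:R^-1 * (Q e f * (y i e * y i f - (e == f)%:R)))).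
  rewrite (eq_bigr (fun e => \sum_i \sum_f n.+1%:R^-1 * (Q e f * (y i e * y i f - (e == f)%:R)))).
    rewrite exchange_big /=; apply: eq_bigr => i _.
    rewrite /quad_form mulr_sumr; apply: eq_bigr => e _.
    by rewrite mulr_sumr.
  by move=> e _; rewrite exchange_big.
move=> e _; apply: eq_bigr => f _; rewrite ME mulrCA mulr_sumr mulr_sumr.
by apply: eq_bigr.
Qed.

End realized_covariance_algebra.

Section pathwise_remainder.
Context {R : realType}.
Variables (T : R) (p q : nat) (G : 'M[R]_(p, q)).
Hypothesis T0 : 0 < T.

Definition noise_variation (N : 'I_q -> R -> R) (n : nat) : R :=
  \sum_a \sum_(l < n) incr T n (N a) l ^+ 2.

(** The difference expands into products of increments [D_i D_j], [D_i Z_j] and [D_j Z_i]: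
    [udiff_quad] treats the first, [udiff_cross] the two others after expanding [Z] over the
    noises. *)
Lemma covariation_remainder (N : 'I_q -> R -> R) (D X Z : 'I_p -> R -> R) (B K : R) :
  (forall i, udiff T (D i)) -> (forall a t, 0 <= t <= T -> `|N a t| <= B) ->
  (forall i t, 0 <= t <= T -> Z i t = \sum_a G i a * N a t) ->
  (forall i t, 0 <= t <= T -> X i t = D i t + Z i t) ->
  forall i j, vanishing_on (noise_variation N) K (fun n => Num.sqrt n%:R *
    (\sum_(l < n) incr T n (X i) l * incr T n (X j) l -
     \sum_(l < n) incr T n (Z i) l * incr T n (Z j) l)).
Proof.
move=> uD NB ZE XE i j.
pose A n := Num.sqrt n%:R * \sum_(l < n) incr T n (D i) l * incr T n (D j) l.
pose C i a n := Num.sqrt n%:R * \sum_(l < n) incr T n (D i) l * incr T n (N a) l.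
have vA : vanishing_on (noise_variation N) K A.
  move=> e e0; have [M HM] := udiff_quad T0 (uD i) (uD j) e0; exists M => // n /= Mn _.
  by rewrite /A normrM ger0_norm ?sqrtr_ge0// HM.
have vC i' a : vanishing_on (noise_variation N) K (C i' a).
  move=> e e0; have [M HM] := udiff_cross T0 K (uD i') (NB a) e0; exists M => // n /= Mn VK.
  rewrite /C normrM ger0_norm ?sqrtr_ge0// HM// (le_trans _ VK)//.
  rewrite /noise_variation (bigD1 a)//= lerDl sumr_ge0// => a' _.
  by rewrite sumr_ge0// => l _; exact: sqr_ge0.
have incrE n (f g : R -> R) l : (l < n)%N -> (forall t, 0 <= t <= T -> f t = g t) ->
    incr T n f l = incr T n g l.
  by move=> ln fg; rewrite /incr !fg// grid_in// ltnW.
have ZI n l i' : (l < n)%N -> incr T n (Z i') l = \sum_a G i' a * incr T n (N a) l.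
  move=> ln; rewrite (incrE _ _ _ _ ln (ZE i')) /incr -sumrB.
  by apply: eq_bigr => a _; rewrite mulrBr.
have XI n l i' : (l < n)%N -> incr T n (X i') l = incr T n (D i') l + incr T n (Z i') l.
  by move=> ln; rewrite (incrE _ _ _ _ ln (XE i')) /incr; ring.
apply: (@eq_vanishing_on _ _ _ (fun n => A n +
   (\sum_a G j a * C i a n + \sum_a G i a * C j a n))).
  move=> n; have E i1 i2 : \sum_a G i2 a * C i1 a n =
      Num.sqrt n%:R * \sum_(l < n) incr T n (D i1) l * incr T n (Z i2) l.
    rewrite (eq_bigr (fun l : 'I_n => \sum_a G i2 a * (incr T n (D i1) l * incr T n (N a) l))).
      rewrite exchange_big /= mulr_sumr; apply: eq_bigr => a _.
      by rewrite /C mulrCA mulr_sumr.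
    by move=> l _; rewrite ZI// mulr_sumr; apply: eq_bigr => a _; rewrite mulrCA.
  rewrite !E -!mulrDr; congr (_ * _); rewrite -!big_split -sumrB /=.
  by apply: eq_bigr => l _; rewrite !XI//; ring.
apply: vanishing_onD => //; apply: vanishing_onD;
  by apply: vanishing_on_sum => a; exact: vanishing_onZ.
Qed.

End pathwise_remainder.

(** * Limit theorems for the realized covariance *)

Section realized_clt.
Context {R : realType} {d : measure_display} {Om : measurableType d}.
Variables (P : probability Om R) (T : R) (p q : nat) (G : 'M[R]_(p, q)).
Variable Nz : 'I_q -> R -> Om -> R.
Hypothesis T0 : 0 < T.
Hypothesis wNz : forall a, wiener1 P T (Nz a).
Hypothesis iNz : mutually_indep P (fun a => sigma_scalar T (Nz a)).
Let Sigma := G *m G^T.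
Let Z := mixed_noise G Nz.

Lemma cov_error0 (X : R -> Om -> 'cV[R]_p) w : cov_error T G X 0 w = 0.
Proof. by rewrite /cov_error sqrtr0 scale0r. Qed.

Lemma measurable_incr (Y : R -> Om -> R) n l : (l < n)%N ->
  (forall t, 0 <= t <= T -> measurable_fun setT (Y t)) ->
  measurable_fun setT (fun w => incr T n (fun t => Y t w) l).
Proof. by move=> ln mY; apply: measurable_funB; apply: mY; rewrite grid_in// ltnW. Qed.

Lemma mvec_cov_error (X : R -> Om -> 'cV[R]_p) n :
  (forall t i, 0 <= t <= T -> measurable_fun setT (fun w => X t w i 0)) ->
  mvec (cov_error T G X n).
Proof.
move=> mX c; under eq_fun do rewrite cov_error_coord mxE realized_cov_entry.
apply: measurable_funM => //; apply: measurable_funD => //.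
apply: measurable_funM => //; apply: measurable_sum => l.
by apply: measurable_funM; apply: (measurable_incr (Y := fun t w => X t w _ 0)) => // t tT; exact: mX.
Qed.

Let mNz a t : 0 <= t <= T -> measurable_fun setT (Nz a t).
Proof. by case: (wNz a) => mN _ _ _ _; exact: mN. Qed.

Lemma measurable_mixed_noise t i : 0 <= t <= T -> measurable_fun setT (fun w => Z t w i 0).
Proof.
move=> tT; rewrite (_ : (fun w => _) = fun w => \sum_a G i a * Nz a t w).
  by apply: measurable_sum => a; apply: measurable_funM => //; exact: mNz.
by apply/funext => w; rewrite mxE; apply: eq_bigr => a _; rewrite mxE.
Qed.

Let Q u e f := (G^T *m dual_mx u *m G) e f.

Let Qsym u e f : Q u e f = Q u f e.
Proof.
have Ns : (dual_mx u)^T = dual_mx u.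
  by apply/matrixP => i j; rewrite mxE dual_mx_sym.
have : (G^T *m dual_mx u *m G)^T = G^T *m dual_mx u *m G.
  by rewrite !trmx_mul trmxK Ns mulmxA.
by rewrite /Q => {1}<-; rewrite mxE.
Qed.

Let sfam n := std_family_noise T0 wNz iNz n.

Lemma noise_error_cos u th :
  \int[P]_w cos (th + dotc u (cov_error T G Z n w)) @[n --> \oo] -->
  cos th * expR (- ((u^T *m asymptotic_cov Sigma *m u) 0 0 / 2)).
Proof.
rewrite -cvg_shiftS /= asymptotic_cov_quad; apply/cvgrPdist_le => e e0.
have := fun n => quad_sum_clt (sfam n) (Qsym u) th.
set C := _ + _ => H.
have /cvgrPdist_le /(_ e e0) small := cvg_div_sqrt C.
near=> n; rewrite distrC.
rewrite (_ : (fun w => _) = fun w => cos (th + quad_sum (grid_std_incr T Nz (n:=n)) (Q u) w)).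
  rewrite (le_trans (H n))// (le_trans (ler_norm _))// -normrN -sub0r.
  by near: n.
by apply/funext => w; rewrite dotc_cov_error_noise.
Unshelve. all: by end_near. Qed.

(** Second moments are what tightness needs. At [n = 0] the error is 0 because of the factor
    [Num.sqrt 0], whence an inequality. *)
Lemma noise_error_moment u n :
  P.-integrable setT (EFin \o (fun w => dotc u (cov_error T G Z n w) ^+ 2)) /\
  \int[P]_w (dotc u (cov_error T G Z n w) ^+ 2) <= quad_var (Q u).
Proof.
case: n => [|n].
  rewrite (_ : (fun w => _) = fun=> 0); last first.
    by apply/funext => w; rewrite cov_error0 /dotc big1 ?expr0n// => c _; rewrite mxE mulr0.
  split; first exact: cst_integrable.
  rewrite Rintegral_prob_cst mulr_ge0// sumr_ge0// => e _; rewrite sumr_ge0// => f _.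
  exact: sqr_ge0.
rewrite (_ : (fun w => _) = fun w => quad_sum (grid_std_incr T Nz (n:=n)) (Q u) w ^+ 2).
  by have [i ->] := quad_sum_variance (sfam n) (Qsym u).
by apply/funext => w; rewrite dotc_cov_error_noise.
Qed.

Let V n w := noise_variation T (fun a t => Nz a t w) n.

Lemma noise_variation_moment n :
  P.-integrable setT (EFin \o V n) /\ \int[P]_w V n w <= q%:R * T.
Proof.
have H a (l : 'I_n) : P.-integrable setT (EFin \o (fun w => incr T n (fun t => Nz a t w) l ^+ 2)) /\
    \int[P]_w (incr T n (fun t => Nz a t w) l ^+ 2) = T / n%:R.
  case: n l => [[]//|n] l.
  have [_ _ i8 mom] := sfam n; have [_ m2 _ _] := mom (l, a).
  have h0 : 0 < T / n.+1%:R by rewrite divr_gt0.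
  rewrite (_ : (fun w => _) = fun w => T / n.+1%:R * grid_std_incr T Nz (l, a) w ^+ 2); last first.
    by apply/funext => w; rewrite incr_std// exprMn sqr_sqrtr// ltW.
  have i2 : P.-integrable setT (EFin \o (fun w => grid_std_incr T Nz (l, a) w ^+ 2)).
    have [m _ _ _] := sfam n.
    apply: (@integrable_le_pow _ _ _ _ _ 2 8) => //.
    rewrite (_ : (fun w => _) = fun w => grid_std_incr T Nz (l, a) w ^+ 8)//.
    by apply/funext => w; rewrite -normrX ger0_norm ?exprn_even_ge0.
  by split; [exact: integrableZR|rewrite RintegralZl// m2 mulr1].
have ia a : P.-integrable setT (EFin \o (fun w => \sum_(l < n) incr T n (fun t => Nz a t w) l ^+ 2)).
  by apply: integrable_sumR => l _; exact: (H a l).1.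
split; first exact: integrable_sumR.
rewrite Rintegral_sumR//.
apply: (@le_trans _ _ (\sum_(a < q) T)); last by rewrite sumr_const card_ord mulr_natl.
apply: ler_sum => a _; rewrite Rintegral_sumR => [|l _]; last exact: (H a l).1.
rewrite (eq_bigr (fun=> T / n%:R)) => [|l _]; last exact: (H a l).2.
rewrite sumr_const card_ord; case: n {H ia} => [|n]; first by rewrite mulr0n ltW.
by rewrite -[T / _ *+ _]mulr_natr divfK.
Qed.

Lemma measurable_noise_variation n : measurable_fun setT (V n).
Proof.
apply: measurable_sum => a; apply: measurable_sum => l; apply: measurable_funX.
by apply: measurable_incr => // t tT; exact: mNz.
Qed.

Variable X : R -> Om -> 'cV[R]_p.
Hypothesis mX : forall t i, 0 <= t <= T -> measurable_fun setT (fun w => X t w i 0).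
Hypothesis decX : {ae P, forall w, exists D : 'I_p -> R -> R, (forall i, udiff T (D i)) /\
  forall i t, 0 <= t <= T -> X t w i 0 = D i t + \sum_a G i a * Nz a t w}.

Lemma ae_bounded_noise : {ae P, forall w, exists B : R, forall a t, 0 <= t <= T ->
  `|Nz a t w| <= B}.
Proof.
have H : {ae P, forall w, forall a, {within `[0, T], continuous (fun t => Nz a t w)}}.
  apply: filter_forall => a; by case: (wNz a).
move: H; apply: filterS => w cN.
have H a : exists B : R, forall t, 0 <= t <= T -> `|Nz a t w| <= B.
  have cabs : {within `[0, T], continuous (fun s => `|Nz a s w|)}.
    by move=> s; apply: cvg_norm; exact: cN.
  have [c cT cmax] := EVT_max (ltW T0) cabs.
  by exists (`|Nz a c w|) => t tT; apply: cmax; rewrite in_itv.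
have [B HB] := choice H; exists (\sum_a `|B a|) => a t tT.
rewrite (le_trans (HB a t tT))// (le_trans (ler_norm _))// (bigD1 a)//= lerDl.
by rewrite sumr_ge0.
Qed.

Lemma ae_remainder : {ae P, forall w, forall K c, vanishing_on (V^~ w) K
  (fun n => cov_error T G X n w c 0 - cov_error T G Z n w c 0)}.
Proof.
move: decX ae_bounded_noise; apply: filterS2 => w [D [uD DX]] [B NB] K c.
set i := (vech_pos c).2; set j := (vech_pos c).1.
have := @covariation_remainder _ T p q G T0 (fun a t => Nz a t w) D
  (fun i t => X t w i 0) (fun i t => Z t w i 0) B K uD NB.
move=> /(_ _ _ i j) H.
apply: (@eq_vanishing_on _ _ _ (fun n => T^-1 * (Num.sqrt n%:R *
    (\sum_(l < n) incr T n (fun t => X t w i 0) l * incr T n (fun t => X t w j 0) l -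
     \sum_(l < n) incr T n (fun t => Z t w i 0) l * incr T n (fun t => Z t w j 0) l)))).
  move=> n; rewrite !cov_error_coord -mulrBr mulrCA; congr (_ * _).
  have mB (A A' : 'M[R]_p) : (A - A') i j = A i j - A' i j by rewrite !mxE.
  by rewrite !mB !realized_cov_entry; ring.
have ZE i' t : 0 <= t <= T -> Z t w i' 0 = \sum_a G i' a * Nz a t w.
  by move=> tT; rewrite mxE; apply: eq_bigr => a _; rewrite mxE.
apply/vanishing_onZ/H => // i' t tT.
by rewrite ZE// DX.
Qed.

Let Xerr := cov_error T G X.
Let Zerr := cov_error T G Z.

Let mXerr n : mvec (Xerr n). Proof. exact: mvec_cov_error. Qed.
Let mZerr n : mvec (Zerr n).
Proof. by apply: mvec_cov_error => t i tT; exact: measurable_mixed_noise. Qed.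

Let remainder_small (F : nat -> Om -> R) : (forall n, measurable_fun setT (F n)) ->
  {ae P, forall w, forall K, vanishing_on (V^~ w) K (F^~ w)} ->
  forall e del : R, 0 < e -> 0 < del ->
    \forall n \near \oo, fine (P [set w | e < `|F n w|]) <= del.
Proof.
move=> mF; apply: vanishing_prob => //.
- exact: measurable_noise_variation.
- by move=> n w; rewrite sumr_ge0// => a _; rewrite sumr_ge0// => l _; exact: sqr_ge0.
- exact: noise_variation_moment.
Qed.

Lemma cov_error_cos u th :
  \int[P]_w cos (th + dotc u (Xerr n w)) @[n --> \oo] -->
  cos th * expR (- ((u^T *m asymptotic_cov Sigma *m u) 0 0 / 2)).
Proof.
have m1 n : measurable_fun setT (fun w => dotc u (Zerr n w)) by exact: measurable_dotc.
have m2 n : measurable_fun setT (fun w => dotc u (Xerr n w)) by exact: measurable_dotc.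
have sm := @remainder_small (fun n w => dotc u (Xerr n w) - dotc u (Zerr n w))
  (fun n => measurable_funB (m2 n) (m1 n)).
apply: (cos_slutsky m1 m2 (sm _) (@noise_error_cos u th)).
move: ae_remainder; apply: filterS => w H K.
apply: (@eq_vanishing_on _ _ _ (fun n => \sum_c u c 0 * (Xerr n w c 0 - Zerr n w c 0))).
  by move=> n; rewrite /dotc -sumrB; apply: eq_bigr => c _; rewrite mulrBr.
by apply: vanishing_on_sum => c; exact/vanishing_onZ/H.
Qed.

(** Chebyshev's inequality makes the noise error tight, its second moments being bounded; the
    remainder is small in probability, so tightness passes to [Xerr] without any moment of it being
    computed. *)
Lemma cov_error_tight e : 0 < e ->
  exists2 L : R, 0 < L & \forall n \near \oo, fine (P (exceed L (Xerr n))) <= e.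
Proof.
move=> e0; pose U n w := \sum_c Zerr n w c 0 ^+ 2.
pose C := \sum_c quad_var (Q (delta_mx c 0)).
have coordE c (x : 'cV[R]_(pbar p)) : dotc (delta_mx c 0) x = x c 0.
  rewrite /dotc (bigD1 c)//= big1 ?addr0 => [|c' c'c]; rewrite mxE ?eqxx ?mul1r//.
  by rewrite (negbTE c'c) mul0r.
have H n c : P.-integrable setT (EFin \o (fun w => Zerr n w c 0 ^+ 2)) /\
    \int[P]_w (Zerr n w c 0 ^+ 2) <= quad_var (Q (delta_mx c 0)).
  have := noise_error_moment (delta_mx c 0) n.
  by under eq_fun do rewrite coordE.
have iU n : P.-integrable setT (EFin \o U n).
  by apply: integrable_sumR => c _; exact: (H n c).1.
have EU n : \int[P]_w U n w <= C.
  rewrite Rintegral_sumR => [|c _]; last exact: (H n c).1.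
  by apply: ler_sum => c _; exact: (H n c).2.
have U0 n w : 0 <= U n w by rewrite sumr_ge0// => c _; exact: sqr_ge0.
have mU n : measurable_fun setT (U n).
  by apply: measurable_sum => c; apply: measurable_funX; exact: mZerr.
have C0 : 0 <= C by apply: le_trans (EU 0%N); apply: Rintegral_ge0 => w _.
pose K := (2 * C + 1) / e.
have K0 : 0 < K by rewrite divr_gt0// ltr_wpDl// mulr_ge0.
pose F n w := \sum_c `|Xerr n w c 0 - Zerr n w c 0|.
have mF n : measurable_fun setT (F n).
  apply: measurable_sum => c; apply: measurableT_comp => //.
  by apply: measurable_funB; [exact: mXerr|exact: mZerr].
have F0 n w : 0 <= F n w by rewrite sumr_ge0.
have aF : {ae P, forall w, forall K, vanishing_on (V^~ w) K (F^~ w)}.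
  move: ae_remainder; apply: filterS => w h K'.
  by apply: vanishing_on_sum => c; apply: vanishing_on_norm; exact: h.
have e2 : 0 < e / 2 by rewrite divr_gt0.
have small := remainder_small mF aF ltr01 e2.
(* Beyond [K + 2], with a remainder at most 1, the noise error exceeds [K + 1], and its square
   exceeds [K]. *)
exists (K + 2); first by rewrite addr_gt0.
near=> n.
have h1 : fine (P [set w | K < U n w]) <= e / 2.
  rewrite (le_trans (markov_prob (mU n) (U0 n) (iU n) K0))// ler_pdivrMr// (le_trans (EU n))//.
  rewrite /K [leRHS](_ : _ = C + 2^-1); first by rewrite lerDl.
  by field; rewrite gt_eqF.
have h2 : fine (P [set w | 1 < `|F n w|]) <= e / 2 by near: n.
have mA := measurable_gt K (mU n).
have mB : measurable [set w | 1 < `|F n w|].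
  by apply: measurable_gt; exact: measurableT_comp.
rewrite (splitr e); apply: le_trans (lerD h1 h2); apply: le_trans (fine_probU P mA mB).
apply: le_fine_prob; [exact: measurable_exceed|exact: measurableU|].
move=> w [c Lc] /=.
have [F1|F1] := pselect (1 < `|F n w|); [by right|left].
move/negP: F1; rewrite -leNgt ger0_norm// => F1.
have R1 : `|Xerr n w c 0 - Zerr n w c 0| <= 1.
  by apply: le_trans F1; rewrite /F (bigD1 c)//= lerDl sumr_ge0.
have Z1 : K + 1 < `|Zerr n w c 0|.
  have := ler_normD (Xerr n w c 0 - Zerr n w c 0) (Zerr n w c 0).
  by rewrite subrK; move: R1 Lc; lra.
apply: (@lt_le_trans _ _ (Zerr n w c 0 ^+ 2)); last first.
  by rewrite /U (bigD1 c)//= lerDl sumr_ge0// => c' _; exact: sqr_ge0.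
rewrite -(real_normK (num_real (Zerr n w c 0))).
by move: Z1 K0; set z := `|_|; nra.
Unshelve. all: by end_near. Qed.

(** The index [a0] supplies one Wiener process, from which the limit vector is built on the same
    probability space. *)
Lemma realized_cov_cvg_in_law (a0 : 'I_q) :
  exists2 mu : probability (borel_cV R (pbar p)) R,
    is_normal_law 0 (asymptotic_cov Sigma) mu & cvg_in_law P Xerr mu.
Proof.
have [mu Nmu [Gv [mG intG cosG]]] := normal_law_exists T0 (wNz a0) (cov_factor G).
rewrite cov_factorE in Nmu cosG; exists mu => // g cg [M gM].
rewrite (intG g M)//.
have -> : (fun n => 'E_P[g \o Xerr n]%E) = (fun n => (\int[P]_w g (Xerr n w))%:E).
  apply/funext => n; rewrite unlock EFin_Rintegral//.
  apply: (@bounded_integrable _ _ _ _ _ M) => [|w]; last exact: gM.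
  exact: (measurable_cont_vec (mXerr n) cg gM).
apply: cvg_EFin; first exact: nearW.
apply: (@cvg_expectation_cont R _ _ _ Om Om P P Xerr Gv mXerr mG _ _ g M cg gM).
- by move=> th u; rewrite cosG; exact: cov_error_cos.
- move=> e e0; have [L1 L10 H1] := cov_error_tight e0.
  have [L2 L20 H2] := exceed_small P mG e0.
  exists (Num.max L1 L2); first by rewrite lt_max L10.
  split; last by apply: le_trans H2; apply: exceed_mono => //; rewrite le_max lexx orbT.
  apply: filterS H1 => n; apply: le_trans; apply: exceed_mono => //.
  by rewrite le_max lexx.
Qed.

(** Deduced from tightness of the rescaled error: off a small event every entry of the error is at
    most [L / sqrt n], by symmetry also above the diagonal, so its Frobenius norm is at most
    [p * L / sqrt n]. *)
Lemma realized_cov_cvg_in_prob : cvg_in_prob P (realized_cov T X) Sigma.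
Proof.
move=> eps eps0.
pose S n w := \sum_i \sum_j (realized_cov T X n w - Sigma) i j ^+ 2.
have mS n : measurable_fun setT (S n).
  apply: measurable_sum => i; apply: measurable_sum => j; apply: measurable_funX.
  under eq_fun do rewrite mxE realized_cov_entry.
  apply: measurable_funD => //; apply: measurable_funM => //; apply: measurable_sum => l.
  by apply: measurable_funM; apply: (measurable_incr (Y := fun t w => X t w _ 0)) => // t tT; exact: mX.
have SE n : [set w | eps <= frob (realized_cov T X n w - Sigma)] = [set w | eps ^+ 2 <= S n w].
  apply/seteqP; have s0 w : 0 <= S n w.
    by rewrite sumr_ge0// => i _; rewrite sumr_ge0// => j _; exact: sqr_ge0.
  have E w : (eps <= frob (realized_cov T X n w - Sigma)) = (eps ^+ 2 <= S n w).
    by rewrite -(sqr_sqrtr (s0 w)) ler_sqr ?nnegrE ?sqrtr_ge0// ltW.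
  by split => w /=; rewrite E.
have mA n : measurable [set w | eps <= frob (realized_cov T X n w - Sigma)].
  rewrite SE (_ : [set w | _] = S n @^-1` `[eps ^+ 2, +oo[).
    by rewrite -[X in measurable X]setTI; exact: mS.
  by apply/seteqP; split => w /=; rewrite in_itv/= andbT.
have -> : (fun n => P [set w | eps <= frob (realized_cov T X n w - Sigma)]) =
    (fun n => (fine (P [set w | eps <= frob (realized_cov T X n w - Sigma)]))%:E).
  by apply/funext => n; rewrite fineK// fin_num_measure.
apply: cvg_EFin; first exact: nearW.
apply/cvgrPdist_le => e e0.
have [L L0 tL] := cov_error_tight e0.
(* [eps / 2] rather than [eps], because the event to exclude contains the equality case. *)
have [N HN] := @eventually_small R (p%:R * L) (eps / 2) (divr_gt0 eps0 (ltr0Sn _ 1)).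
near=> n.
rewrite sub0r normrN ger0_norm; last by rewrite !fine_ge0// lee_fin fine_ge0.
have tLn : fine (P (exceed L (Xerr n))) <= e by near: n.
have Nn : (N <= n)%N by near: n; exact: nbhs_infty_ge.
have [n0 small] := HN n Nn.
apply: le_trans tLn; apply: le_fine_prob => //; first exact: measurable_exceed.
move=> w /= ew; apply: contrapT => nE.
have sn0 : 0 < Num.sqrt (n%:R : R) by rewrite sqrtr_gt0 ltr0n.
pose A := realized_cov T X n w - Sigma.
have As : A^T = A by rewrite linearB /= realized_cov_sym trmx_mul trmxK.
have Ac c : `|A (vech_pos c).2 (vech_pos c).1| <= L / Num.sqrt n%:R.
  have : `|Xerr n w c 0| <= L by rewrite leNgt; apply/negP => h; apply: nE; exists c.
  by rewrite cov_error_coord normrM (gtr0_norm sn0) ler_pdivlMr// mulrC.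
have Aij i j : `|A i j| <= L / Num.sqrt n%:R.
  wlog ji : i j / (j <= i)%N => [H|].
    have [/H//|/ltnW /H] := leqP j i.
    by have -> : A j i = A i j by rewrite -[in LHS]As mxE.
  have [c cE] := vech_pos_surj ji.
  by have := Ac c; rewrite cE.
have : frob A <= p%:R * (L / Num.sqrt n%:R).
  have m0 : 0 <= p%:R * (L / Num.sqrt n%:R).
    by rewrite mulr_ge0// divr_ge0 ?(ltW L0) ?(ltW sn0).
  rewrite /frob -[leRHS](ger0_norm m0) -sqrtr_sqr ler_sqrt ?sqr_ge0//.
  apply: (@le_trans _ _ (\sum_(i < p) \sum_(j < p) (L / Num.sqrt n%:R) ^+ 2)).
    apply: ler_sum => i _; apply: ler_sum => j _.
    rewrite -(real_normK (num_real (A i j))) lerXn2r ?nnegrE//.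
    by rewrite divr_ge0 ?(ltW L0) ?(ltW sn0).
  by rewrite !sumr_const !card_ord -mulrnA -[_ *+ (p * p)]mulr_natl natrM -expr2 -exprMn.
move/(le_trans ew); rewrite mulrA => /le_trans /(_ small).
by rewrite leNgt gtr_pMr// invf_lt1// ltr1n.
Unshelve. all: by end_near. Qed.

End realized_clt.

Lemma mixing_cov (R : realType) (k p r : nat) (kp : (k <= p)%N) (A : 'M[R]_(p - k, k))
    (S : 'M[R]_(k, r)) (sigma : 'I_p -> R) (G := row_mx (loading kp A *m S) (diag_mx (\row_i sigma i))) :
  G *m G^T = factor_cov kp A (S *m S^T) (fun i => sigma i ^+ 2).
Proof.
rewrite tr_row_mx mul_row_col trmx_mul tr_diag_mx mulmx_diag /factor_cov !mulmxA.
by congr (_ + diag_mx _); apply/rowP => i; rewrite !mxE expr2.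
Qed.

Lemma within_continuous_vec (R : realType) (q : nat) (A : set R) (g : 'cV[R]_q -> R)
    (F : R -> 'cV[R]_q) : continuous g ->
  (forall c, {within A, continuous (fun t => F t c 0)}) ->
  {within A, continuous (fun t => g (F t))}.
Proof.
move=> cg cF.
have cF' : {within A, continuous F} by apply: continuous_to_mx => i j; rewrite (ord1 j); exact: cF.
by move=> t; apply: continuous_comp; [exact: cF'|exact: cg].
Qed.

Theorem theorem5 (R : realType) (d : measure_display) (Om : measurableType d)
    (P : probability Om R) (k p r : nat) (k_ge1 : (1 <= k)%N) (k_lt_p : (k < p)%N)
    (r_ge1 : (1 <= r)%N) (T : R) (T_gt0 : 0 < T)
    (A : 'M[R]_(p - k, k)) (S : 'M[R]_(k, r)) (sigma : 'I_p -> R)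
    (b : 'cV[R]_k -> 'cV[R]_k) (B : 'I_p -> R -> R)
    (c1 : 'cV[R]_k) (c2 : 'cV[R]_p)
    (W : R -> Om -> 'cV[R]_r) (Bm : 'I_p -> R -> Om -> R)
    (f : R -> Om -> 'cV[R]_k) (e : R -> Om -> 'cV[R]_p)
    (X : R -> Om -> 'cV[R]_p)
    (W_wiener : wiener P T W)
    (Bm_wiener : forall i, wiener1 P T (Bm i))
    (W_Bm_indep : noises_indep P T W Bm)
    (f_sde : forall j, ito_eq P T (c1 j 0) (fun t w => b (f t w) j 0)
      (fun t w => (S *m W t w) j 0) (fun t w => f t w j 0))
    (e_sde : forall i, ito_eq P T (c2 i 0) (fun t w => B i (e t w i 0))
      (fun t w => sigma i * Bm i t w) (fun t w => e t w i 0))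
    (X_def : forall t w, 0 <= t <= T ->
      X t w = loading (ltnW k_lt_p) A *m f t w + e t w)
    (b_lip : exists2 C : R, 0 < C &
      forall x y, frob (b x - b y) <= C * frob (x - y))
    (f_mom : bounded_moments P T f)
    (b_smooth : forall j, C_up (@frob R k 1) 4 (fun x => b x j 0))
    (B_lip : exists2 C : R, 0 < C &
      forall i x y, `|B i x - B i y| <= C * `|x - y|)
    (e_mom : bounded_moments P T e)
    (B_smooth : forall i, C_up (fun x : R => `|x|) 4 (B i))
    (sigma_gt0 : forall i, 0 < sigma i) :
  let Sigma := factor_cov (ltnW k_lt_p) A (S *m S^T) (fun i => sigma i ^+ 2) in
  let Q := realized_cov T X in
  cvg_in_prob P Q Sigma /\
  exists2 mu : probability (borel_cV R (pbar p)) R,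
    is_normal_law 0 (asymptotic_cov Sigma) mu &
    cvg_in_law P
      (fun n w => Num.sqrt n%:R *: (vech (Q n w) - vech Sigma)) mu.
Proof.
move=> Sigma Q.
pose kp := ltnW k_lt_p.
pose G := row_mx (loading kp A *m S) (diag_mx (\row_i sigma i)).
pose Nz := joint_noise W Bm.
have GE : G *m G^T = Sigma by exact: mixing_cov.
have wNz : forall a, wiener1 P T (Nz a) by exact: joint_noise_wiener.
have iNz : mutually_indep P (fun a => sigma_scalar T (Nz a)) by exact: joint_noise_indep.
have XE t w i : 0 <= t <= T ->
    X t w i 0 = \sum_j loading kp A i j * f t w j 0 + e t w i 0.
  by move=> tT; rewrite X_def// !mxE.
have mX t i : 0 <= t <= T -> measurable_fun setT (fun w => X t w i 0).
  move=> tT; under eq_fun do rewrite XE//.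
  apply: measurable_funD; last by case: (e_sde i) => + _; exact.
  apply: measurable_sum => j; apply: measurable_funM => //.
  by case: (f_sde j) => + _; exact.
(* On almost every path the initial values and drift integrals go into [D], while the images of [W]
   and [Bm] are read off as a row of [G]. *)
have decX : {ae P, forall w, exists D : 'I_p -> R -> R, (forall i, udiff T (D i)) /\
    forall i t, 0 <= t <= T -> X t w i 0 = D i t + \sum_a G i a * Nz a t w}.
  have aef : {ae P, forall w, forall j, {within `[0, T], continuous (fun t => f t w j 0)} /\
      forall t, 0 <= t <= T -> f t w j 0 =
        c1 j 0 + \int[lebesgue_measure]_(s in `[0, t]) b (f s w) j 0 + (S *m W t w) j 0}.
    by apply: filter_forall => j; case: (f_sde j).
  have aee : {ae P, forall w, forall i, {within `[0, T], continuous (fun t => e t w i 0)} /\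
      forall t, 0 <= t <= T -> e t w i 0 =
        c2 i 0 + \int[lebesgue_measure]_(s in `[0, t]) B i (e s w i 0) + sigma i * Bm i t w}.
    by apply: filter_forall => i; case: (e_sde i).
  move: aef aee; apply: filterS2 => w fw ew.
  pose Df j t := \int[lebesgue_measure]_(s in `[0, t]) b (f s w) j 0.
  pose De i t := \int[lebesgue_measure]_(s in `[0, t]) B i (e s w i 0).
  have uDf j : udiff T (Df j).
    apply: (@drift_udiff _ _ (fun s => b (f s w) j 0)) => //.
    apply: (within_continuous_vec (g := fun x => b x j 0)) => [|c].
      by case: (b_smooth j).
    by case: (fw c).
  have uDe i : udiff T (De i).
    apply: (@drift_udiff _ _ (fun s => B i (e s w i 0))) => //.
    move=> t; apply: continuous_comp; first by case: (ew i) => + _; exact.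
    by case: (B_smooth i) => + _ _; exact.
  exists (fun i t => \sum_j loading kp A i j * (c1 j 0 + Df j t) + (c2 i 0 + De i t)); split.
    move=> i; apply: udiffD; last by apply: udiffD => //; exact: udiff_cst.
    by apply: udiff_sum => j; apply: udiffZ; apply: udiffD => //; exact: udiff_cst.
  move=> i t tT; rewrite XE// (proj2 (ew i) t tT).
  rewrite (eq_bigr (fun j => loading kp A i j * (c1 j 0 + Df j t) +
      loading kp A i j * (S *m W t w) j 0)) => [|j _]; last first.
    by rewrite (proj2 (fw j) t tT) mulrDr.
  have -> : \sum_a G i a * Nz a t w =
      \sum_j loading kp A i j * (S *m W t w) j 0 + sigma i * Bm i t w.
    rewrite big_split_ord /=; congr (_ + _).
      transitivity ((loading kp A *m S *m W t w) i 0).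
        rewrite [RHS]mxE; apply: eq_bigr => l _.
        by rewrite /Nz joint_noise_lshift /G row_mxEl.
      by rewrite -mulmxA mxE.
    rewrite (bigD1 i)//= big1 ?addr0 => [|i' i'i].
      by rewrite /Nz joint_noise_rshift /G row_mxEr !mxE eqxx mulr1n.
    by rewrite /G row_mxEr !mxE eq_sym (negbTE i'i) mulr0n mul0r.
  by rewrite big_split /= addrACA.
(* Since [k < p], the index [k] is in range, so some [Bm] is available to build the limit law. *)
have i0 : 'I_p by exact: Ordinal k_lt_p.
split.
  rewrite -GE; exact: (@realized_cov_cvg_in_prob _ _ _ P T p (r + p) G Nz).
have := @realized_cov_cvg_in_law _ _ _ P T p (r + p) G Nz T_gt0 wNz iNz X mX decX (rshift r i0).
by rewrite /cov_error GE.
Qed.
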